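(* Consider a network operating under a WMW policy, and a vector $\lambda$ in its capacity region, with a corresponding set of invariant states $\mathcal{I}(\lambda)$. Fix some $T\in\mathbb{R}_+$, and let $\{\lambda^r\}$ be a sequence that converges to $\lambda$. Consider two functions $f:\mathbb{N}\times\mathbb{R}_+\to\mathbb{R}_+$ and $g:\mathbb{N}\to\mathbb{R}_+$, with $\liminf_{r\to\infty}\, g(r)/r>0$. Let $A^r(\cdot)$ be an $f$-tailed sequence of arrival processes with limit mean $\lambda$, and let $\hat q^r(\cdot)$ be a corresponding sequence of $g$-time-scaled queue length processes. Suppose that $d\big(\hat q^r(0)\,,\, \mathcal{I}(\lambda)\big) \to 0$, as $r\to\infty$. (a) Suppose that for every $\epsilon>0$, we have $\liminf_{r\to\infty}\, rf(r,\epsilon)/g(r) > 0$. Then, for any $\delta>0$, $$\mathbb{P}\Big(\sup_{t\in [0,T]}\,d\big(\hat q^r(t)\,,\, \mathcal{I}(\lambda)\big)>\delta\Big) \xrightarrow[r\to\infty]{} 0.$$ (b) Under all the assumptions stated above together with the assumption of part (a) (namely, $\liminf_{r\to\infty} rf(r,\epsilon)/g(r)>0$ for every $\epsilon>0$), the rate of convergence in (a) can be bounded: for any $\delta>0$, there exists an $\epsilon>0$ such that $$\frac{rf(r,\epsilon)}{g(r)}\, \mathbb{P}\Big(\sup_{t\in [0,T]}\,d\big(\hat q^r(t)\,,\, \mathcal{I}(\lambda)\big)>\delta\Big) \xrightarrow[r\to\infty]{} 0.$$ Moreover, for the case of a MW policy, this holds for every $\epsilon\le\min(\delta,\alpha)/(2C)$,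 where $C$ is the sensitivity constant of the network and $\alpha=\alpha(\lambda)$ is the attraction constant associated with $\lambda$. (c) Conversely, suppose that $f:\mathbb{N}\times\mathbb{R}_+\to\mathbb{R}_+$ and $g:\mathbb{N}\to\mathbb{R}_+$ are such that $\lim_{r\to\infty}\, rf(r,\epsilon)/g(r) = 0$ for every $\epsilon>0$, and $\lim_{r\to\infty} g(r)/r =\infty$. Then, for any network operating under a MW policy, any arrival rate $\lambda$ in its capacity region (excluding its extreme points), and any $q_0\in\mathcal{I}(\lambda)$, there exists an $f$-tailed sequence of arrival processes and a corresponding sequence of $g$-time-scaled processes $\hat q^r(\cdot)$, $r\in\mathbb{N}$, initialized at $\hat q^r(0) = q_0$, such that $$\mathbb{P}\Big(\sup_{t\in [0,T]}\,d\big(\hat q^r(t)\,,\, \mathcal{I}(\lambda)\big)>\delta\Big) \xrightarrow[r\to\infty]{} 1,$$ for all $\delta>0$.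
   Context: Network model: $n$ queues, a non-negative $n\times n$ routing matrix $R$, and a finite set $\mathcal{S}\subset\mathbb{R}_+^n$ of service vectors such that for any $\mu\in\mathcal{S}$ and any $i$, the vector obtained by setting the $i$th component of $\mu$ to zero is also in $\mathcal{S}$. Given arrivals $A(t)\in\mathbb{R}_+^n$, queues evolve as $Q(t+1)=Q(t)+A(t)+(R-I)\min(\mu(t),Q(t))$ (componentwise min). A $w$-WMW policy ($w\in\mathbb{R}^n_{++}$, $W=\mathrm{diag}(w)$) chooses $\mu(t)\in\arg\max_{\mu\in\mathcal{S}} Q(t)^TW(I-R)\mu$; MW is the case $w=(1,\dots,1)$. The capacity region $\mathcal{C}$ is the closure of the set of arrival rates for which some policy makes the network positive recurrent. A fluid solution for rate $\lambda$ is an absolutely continuous $q:\mathbb{R}_+\to\mathbb{R}_+^n$ such that, together with functions $s_\mu:\mathbb{R}_+\to[0,1]$ ($\mu\in\mathcal{S}$) and $y:\mathbb{R}_+\to\mathbb{R}_+^n$, a.e. $\dot q=\lambda+(R-I)(\sum_\mu s_\mu\mu-y)$, $\sum_\mu s_\mu=1$, $y_i\le\sum_\mu s_\mu\mu_i$, $y_i=0$ whenever $q_i>0$, and $s_\mu=0$ whenever $\mu$ is not a maximizer of $q^TW(I-R)\mu$. The set of invariant states is $\mathcal{I}(\lambda)=\{q_0\in\mathbb{R}_+^n: q(t)\equiv q_0 \text{ is a fluid solution}\}$; $d(x,\mathcal{I})$ is Euclidean distance. A sequence $A^r(\cdot)$ of stationary processes with means $\lambda^r\to\lambda$ is $f$-tailed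 with limit mean $\lambda$ if for every $\delta>0$, $f(r,\delta)\,\mathbb{P}\big(\frac1r\sup_{t\le r}\|\sum_{\tau=0}^t (A^r(\tau)-\lambda^r)\|_2>\delta\big)\to0$ as $r\to\infty$. The $g$-time-scaled processes are $\hat q^r(t)=\frac1r Q^r(\lfloor g(r)t\rfloor)$, where $Q^r$ is the queue process driven by $A^r$. The sensitivity constant $C$ is a network constant such that for any arrival function $A(\cdot)$, any $\lambda\succeq0$, and the fluid solution $q$ with $q(0)=Q(0)$, $\|Q(k)-q(k)\|_2\le C\big(1+\|\lambda\|+\max_{t<k}\|\sum_{\tau=0}^t(A(\tau)-\lambda)\|_2\big)$ for all $k\in\mathbb{Z}_+$. The attraction constant $\alpha(\lambda)>0$ (for MW and $\lambda\in\mathcal{C}$) is such that for every fluid solution $q$ with rate $\lambda$, $q(t)\notin\mathcal{I}(\lambda)$ implies the right derivative of $d(q(t),\mathcal{I}(\lambda))$ exists and is at most $-\alpha(\lambda)$.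
   Formalization: In part (c) the horizon is taken with T > 0, since for T = 0 the claim fails: the process starts at q_0 in I(λ), so the supremum is 0 and the probability is 0 rather than tending to 1. *)

(* Defs.v *)
From HB Require Import structures.
From mathcomp Require Import all_boot all_order all_algebra.
From mathcomp Require Import all_classical all_reals all_analysis.
Set Implicit Arguments. Unset Strict Implicit. Unset Printing Implicit Defensive.
Import Order.TTheory GRing.Theory Num.Theory.
Import numFieldNormedType.Exports.
Local Open Scope classical_set_scope.
Local Open Scope ring_scope.

Section NetworkDefs.
Variable R : realType.
Variable n : nat.
Implicit Types (x y q w lam mu a : 'cV[R]_n) (Rm : 'M[R]_n) (S : seq 'cV[R]_n).

Definition norm2 x : R := Num.sqrt (\sum_i (x i 0) ^+ 2).
Definition dist_set x (I : set 'cV[R]_n) : R := inf [set norm2 (x - y) | y in I].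

Definition nonneg x : Prop := forall i, 0 <= x i 0.

Definition cmin x y : 'cV[R]_n := \col_i Order.min (x i 0) (y i 0).

Definition zero_comp mu (i : 'I_n) : 'cV[R]_n := \col_j (if j == i then 0 else mu j 0).

(* Network model: non-negative routing matrix Rm, finite set S (a list) of
   service vectors in R_+^n, closed under zeroing any single component. *)
Definition network_ok Rm S : Prop :=
  (forall i j, 0 <= Rm i j) /\
  (forall mu, mu \in S -> nonneg mu) /\
  (forall mu i, mu \in S -> zero_comp mu i \in S).

(* the vector of all ones (the MW weights) *)
Definition ones : 'cV[R]_n := const_mx 1.
Definition pos_weights w : Prop := forall i, 0 < w i 0.

Definition wobj Rm w q mu : R := \sum_i q i 0 * w i 0 * ((1%:M - Rm) *m mu) i 0.

Definition wmw_choice Rm S w q mu : Prop :=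
  mu \in S /\ forall nu, nu \in S -> wobj Rm w q nu <= wobj Rm w q mu.

Definition qstep Rm q a mu : 'cV[R]_n := q + a + (Rm - 1%:M) *m cmin mu q.

(* Q is a (deterministic) queue trajectory driven by the arrival function A
   under the w-WMW policy (with arbitrary tie-breaking at each step). *)
Definition wmw_path Rm S w (A : nat -> 'cV[R]_n) (Q : nat -> 'cV[R]_n) : Prop :=
  forall t, exists mu, wmw_choice Rm S w (Q t) mu /\ Q t.+1 = qstep Rm (Q t) (A t) mu.

Definition max_dev (A : nat -> 'cV[R]_n) lam (k : nat) : R :=
  \big[Num.max/0]_(t < k) norm2 (\sum_(tau < t.+1) (A tau - lam)).

Definition abs_cont_on (f : R -> R) (a b : R) : Prop :=
  forall e, 0 < e -> exists2 d, 0 < d &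
    forall (k : nat) (u v : 'I_k -> R),
      (forall j, a <= u j /\ u j <= v j /\ v j <= b) ->
      (forall j l, j != l -> v j <= u l \/ v l <= u j) ->
      \sum_j (v j - u j) < d -> \sum_j `|f (v j) - f (u j)| < e.

Definition fluid_solution Rm S w lam (q : R -> 'cV[R]_n) : Prop :=
  (forall t, 0 <= t -> nonneg (q t)) /\
  (forall i t, 0 <= t -> abs_cont_on (fun u => q u i 0) 0 t) /\
  exists (s : 'cV[R]_n -> R -> R) (y : R -> 'cV[R]_n),
    (forall mu t, 0 <= t -> 0 <= s mu t <= 1) /\
    (forall t, 0 <= t -> nonneg (y t)) /\
    {ae (@lebesgue_measure R), forall t : R, 0 < t ->
       (forall i, derivable (fun u => q u i 0) t 1) /\
       (forall i, derive1 (fun u => q u i 0) t =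
           (lam + (Rm - 1%:M) *m (\sum_(mu <- undup S) s mu t *: mu - y t)) i 0) /\
       \sum_(mu <- undup S) s mu t = 1 /\
       (forall i, y t i 0 <= (\sum_(mu <- undup S) s mu t *: mu) i 0) /\
       (forall i, 0 < q t i 0 -> y t i 0 = 0) /\
       (forall mu, mu \in S -> ~ wmw_choice Rm S w (q t) mu -> s mu t = 0)}.

Definition invariant_states Rm S w lam : set 'cV[R]_n :=
  [set q0 | nonneg q0 /\ fluid_solution Rm S w lam (fun _ => q0)].

(* stationarity of a process (A t)_t of random vectors: shift invariance of all
   finite-dimensional distributions, tested on Borel rectangles *)
Definition stationary {d} {T : measurableType d} (P : probability T R)
    (A : nat -> T -> 'cV[R]_n) : Prop :=
  forall (k m : nat) (B : nat -> 'I_n -> set R), (forall t i, measurable (B t i)) ->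
    P [set om | forall t i, (t < m)%N -> B t i (A (t + k)%N om i 0)] =
    P [set om | forall t i, (t < m)%N -> B t i (A t om i 0)].

Definition arrival_process {d} {T : measurableType d} (A : nat -> T -> 'cV[R]_n) : Prop :=
  (forall t i, measurable_fun setT (fun om => A t om i 0)) /\
  (forall t om, nonneg (A t om)).

Definition stationary_with_mean {d} {T : measurableType d} (P : probability T R)
    (A : nat -> T -> 'cV[R]_n) lam : Prop :=
  arrival_process A /\ stationary P A /\
  forall i, (\int[P]_om (A 0%N om i 0)%:E = (lam i 0)%:E)%E.

Definition iid {d} {T : measurableType d} (P : probability T R)
    (A : nat -> T -> 'cV[R]_n) : Prop :=
  (forall (m : nat) (B : nat -> 'I_n -> set R), (forall t i, measurable (B t i)) ->
    P [set om | forall t i, (t < m)%N -> B t i (A t om i 0)] =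
    (\prod_(t < m) P [set om | forall i, B t i (A t om i ord0)])%E) /\
  (forall t (B : 'I_n -> set R), (forall i, measurable (B i)) ->
    P [set om | forall i, B i (A t om i 0)] = P [set om | forall i, B i (A 0%N om i 0)]).

Fixpoint pol_queue Rm (pi : 'cV[R]_n -> 'cV[R]_n) (A : nat -> 'cV[R]_n) x (t : nat)
  : 'cV[R]_n :=
  match t with
  | 0 => x
  | t'.+1 => let q := pol_queue Rm pi A x t' in qstep Rm q (A t') (pi q)
  end.

(* lam is supportable: there are i.i.d. arrivals with mean lam and a policy
   under which the network is positive recurrent (finite expected return time
   to a bounded set, from every initial state). *)
Definition supportable Rm S lam : Prop :=
  exists (d : measure_display) (T : measurableType d) (P : probability T R)
         (A : nat -> T -> 'cV[R]_n) (pi : 'cV[R]_n -> 'cV[R]_n),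
    arrival_process A /\ iid P A /\
    (forall i, (\int[P]_om (A 0%N om i 0)%:E = (lam i 0)%:E)%E) /\
    (forall x, pi x \in S) /\
    (forall x t i, nonneg x ->
       measurable_fun setT (fun om => pol_queue Rm pi (A^~ om) x t i 0)) /\
    exists M : R, forall x, nonneg x ->
      (\int[P]_om ereal_inf [set (t%:R)%:E | t in
          [set t : nat | (1 <= t)%N /\ (norm2 (pol_queue Rm pi (A^~ om) x t) <= M)%R]]
        < +oo)%E.

Definition capacity_region Rm S : set 'cV[R]_n :=
  [set lam | forall e, 0 < e -> exists lam', supportable Rm S lam' /\ norm2 (lam - lam') < e].

Definition extreme_point (C : set 'cV[R]_n) lam : Prop :=
  C lam /\ forall y z (th : R), C y -> C z -> 0 < th < 1 ->
    lam = th *: y + (1 - th) *: z -> y = lam /\ z = lam.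

Definition f_tailed (f : nat -> R -> R)
    (d : nat -> measure_display) (T : forall r, measurableType (d r))
    (P : forall r, probability (T r) R) (A : forall r, nat -> T r -> 'cV[R]_n)
    (lamr : nat -> 'cV[R]_n) lam : Prop :=
  (forall r, stationary_with_mean (P r) (A r) (lamr r)) /\
  (forall i, (fun r => lamr r i 0) @ \oo --> lam i 0) /\
  forall delta, 0 < delta ->
    (fun r => f r delta * fine (P r [set om |
        (r%:R)^-1 * max_dev (A r ^~ om) (lamr r) r.+1 > delta])) @ \oo --> 0.

Definition scaled (g : nat -> R) (r : nat) (Q : nat -> 'cV[R]_n) (t : R) : 'cV[R]_n :=
  (r%:R)^-1 *: Q `|Num.floor (g r * t)|%N.

Definition far_event {d} {Om : measurableType d} (g : nat -> R) (r : nat)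
    (Q : nat -> Om -> 'cV[R]_n) (I : set 'cV[R]_n) (Tend delta : R) : set Om :=
  [set om | sup [set dist_set (scaled g r (Q^~ om) t) I | t in `[0, Tend]] > delta].

Definition queue_processes Rm S w
    (d : nat -> measure_display) (T : forall r, measurableType (d r))
    (A : forall r, nat -> T r -> 'cV[R]_n) (Q : forall r, nat -> T r -> 'cV[R]_n)
    (Q0 : nat -> 'cV[R]_n) : Prop :=
  forall r, (forall t i, measurable_fun setT (fun om => Q r t om i 0)) /\
    forall om, Q r 0%N om = Q0 r /\ wmw_path Rm S w (A r ^~ om) (Q r ^~ om).

Definition sensitivity_const Rm S (C : R) : Prop :=
  0 < C /\
  forall (A : nat -> 'cV[R]_n) lam (Q : nat -> 'cV[R]_n) (q : R -> 'cV[R]_n),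
    (forall t, nonneg (A t)) -> nonneg lam -> nonneg (Q 0%N) ->
    wmw_path Rm S ones A Q -> fluid_solution Rm S ones lam q -> q 0 = Q 0%N ->
    forall k : nat,
      norm2 (Q k - q k%:R) <= C * (1 + norm2 lam + max_dev A lam k).

Definition attraction_const Rm S lam (alpha : R) : Prop :=
  0 < alpha /\
  forall q : R -> 'cV[R]_n, fluid_solution Rm S ones lam q -> forall t, 0 <= t ->
    ~ invariant_states Rm S ones lam (q t) ->
    exists2 D, D <= - alpha &
      (fun s => (dist_set (q (t + s)) (invariant_states Rm S ones lam)
                 - dist_set (q t) (invariant_states Rm S ones lam)) / s) @ 0^'+ --> D.

End NetworkDefs.

(* Main.v *)
Require Import Defs.
From HB Require Import structures.
From mathcomp Require Import all_boot all_order all_algebra.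
From mathcomp Require Import all_classical all_reals all_analysis.
From mathcomp Require Import measurable_realfun ring lra zify.
Set Implicit Arguments. Unset Strict Implicit. Unset Printing Implicit Defensive.
Import Order.TTheory GRing.Theory Num.Theory.
Import numFieldNormedType.Exports.
Local Open Scope classical_set_scope.
Local Open Scope ring_scope.

(** With [Phi q := max_(mu in S) wobj q mu - <q, lam>_w], WMW is a (sub)gradient
    descent of the convex, positively homogeneous, piecewise linear function
    [Phi] on the orthant, up to bounded errors.  For [lam] in the capacity region
    [Phi >= 0], the invariant states are the polyhedral cone [Phi = 0], and
    Hoffman's error bound gives [Phi q >= c * dist q].  Hence, once the cumulative
    fluctuation of the arrivals is subtracted, the squared distance of the queue
    to a fixed invariant state decreases at rate proportional to [dist]: over a
    window of [r] steps with fluctuation at most [e * r], a queue starting within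
    [d' * r] of the cone stays within [delta * r] and ends within [d' * r].  A
    union bound over the [g r / r] windows gives (a) and (b).  For MW, windows
    overlapping by three quarters make the constant [min delta alpha / (2 C)]
    sufficient; a fluid solution to compare with is piecewise linear, following
    the least-norm velocity, whose norm strictly decreases at each breakpoint and
    takes finitely many values.

    For (c), the arrivals are [lam] plus one burst per period [g r * Tend] with
    uniform random phase: a window of length [r] contains a burst with probability
    of order [r / g r], but one occurs before time [g r * Tend] with certainty. *)

(** * Euclidean distance and compactness *)

(** Single arrivals are unbounded, so the increments of [Q] are uncontrolled; those of [Q - cumdev]
    are bounded drifts, and the price of the subtraction is one term linear in the deviation.
    Measuring from one fixed point of the cone per window keeps the expansion of the square exact.
    Chaining windows needs more than staying close: each window must end as near as it began. A
    queue at distance of order [d' * r] throughout loses an amount linear in [d'], which beats an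
    initial energy quadratic in [d']. All of this requires [lam = (I - Rm) rho] with [rho] in the
    convex hull of [S], whereas the capacity region is a closure of rates defined by recurrence. One
    returning sample path gives an approximate inequality, compactness an exact one, and a fixed
    point of the routing map the equality. For MW, [C * e <= alpha / 2] bounds the loss over a
    window. A start between [3r/4] and [r] steps earlier gains at least [3/4 * alpha * r], which
    pays for [alpha / 2] plus [alpha / 4] of lower-order terms; with disjoint windows, times just
    after a start could exceed [delta]. *)

Section Euclid.
Variables (R : realType) (n : nat).
Implicit Types (x y z p q u v w : 'cV[R]_n) (I : set 'cV[R]_n).

(** The weight is a parameter because the Lyapunov function uses the inner product of [w], while
    distances use that of [ones]. *)
Definition dotw w x y : R := \sum_i w i 0 * x i 0 * y i 0.

Lemma dotwC w x y : dotw w x y = dotw w y x.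
Proof. by apply: eq_bigr => i _; rewrite mulrAC. Qed.

Lemma dotwDl w x y z : dotw w (x + y) z = dotw w x z + dotw w y z.
Proof. by rewrite -big_split /=; apply: eq_bigr => i _; rewrite mxE; ring. Qed.

Lemma dotwZl w a x z : dotw w (a *: x) z = a * dotw w x z.
Proof. by rewrite mulr_sumr; apply: eq_bigr => i _; rewrite mxE; ring. Qed.

Lemma dotwNl w x z : dotw w (- x) z = - dotw w x z.
Proof. by rewrite -scaleN1r dotwZl mulN1r. Qed.

Lemma dotwBl w x y z : dotw w (x - y) z = dotw w x z - dotw w y z.
Proof. by rewrite dotwDl dotwNl. Qed.

Lemma dotwDr w x y z : dotw w z (x + y) = dotw w z x + dotw w z y.
Proof. by rewrite dotwC dotwDl !(dotwC _ z). Qed.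

Lemma dotwZr w a x z : dotw w z (a *: x) = a * dotw w z x.
Proof. by rewrite dotwC dotwZl (dotwC _ z). Qed.

Lemma dotwNr w x z : dotw w z (- x) = - dotw w z x.
Proof. by rewrite dotwC dotwNl (dotwC _ z). Qed.

Lemma dotwBr w x y z : dotw w z (x - y) = dotw w z x - dotw w z y.
Proof. by rewrite dotwDr dotwNr. Qed.

Lemma dotw0l w z : dotw w 0 z = 0.
Proof. by rewrite -(scale0r 0) dotwZl mul0r. Qed.

Lemma dotw0r w z : dotw w z 0 = 0.
Proof. by rewrite dotwC dotw0l. Qed.

Lemma dotw_sqrD w x y :
  dotw w (x + y) (x + y) = dotw w x x + 2 * dotw w x y + dotw w y y.
Proof. rewrite !dotwDl !dotwDr (dotwC w y x); ring. Qed.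

Lemma dotw_ge0 w x y : nonneg w -> nonneg x -> nonneg y -> 0 <= dotw w x y.
Proof. by move=> w0 x0 y0; apply: sumr_ge0 => i _; rewrite !mulr_ge0. Qed.

Lemma norm2_ge0 x : 0 <= norm2 x.
Proof. exact: sqrtr_ge0. Qed.

Lemma sumsq_ge0 x : 0 <= \sum_i (x i 0) ^+ 2.
Proof. by apply: sumr_ge0 => i _; exact: sqr_ge0. Qed.

Lemma norm2_sqr x : norm2 x ^+ 2 = dotw (ones R n) x x.
Proof.
rewrite sqr_sqrtr ?sumsq_ge0//; apply: eq_bigr => i _.
by rewrite mxE mul1r expr2.
Qed.

Lemma coord_le_norm2 x i : `|x i 0| <= norm2 x.
Proof.
rewrite -sqrtr_sqr; apply: ler_wsqrtr.
by rewrite (bigD1 i) //= lerDl; apply: sumr_ge0 => j _; exact: sqr_ge0.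
Qed.

Lemma norm2_0 : norm2 (0 : 'cV[R]_n) = 0.
Proof.
rewrite /norm2 big1 ?sqrtr0// => i _; by rewrite mxE expr0n.
Qed.

Lemma norm2_eq0 x : norm2 x = 0 -> x = 0.
Proof.
move=> x0; apply/colP => i; rewrite mxE; apply/eqP.
by rewrite -normr_le0 -x0 coord_le_norm2.
Qed.

Lemma norm2Z a x : norm2 (a *: x) = `|a| * norm2 x.
Proof.
rewrite /norm2 -sqrtr_sqr -sqrtrM ?sqr_ge0//; congr Num.sqrt.
by rewrite mulr_sumr; apply: eq_bigr => i _; rewrite mxE exprMn.
Qed.

Lemma norm2N x : norm2 (- x) = norm2 x.
Proof. by rewrite -scaleN1r norm2Z normrN1 mul1r. Qed.

Lemma norm2_distC x y : norm2 (x - y) = norm2 (y - x).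
Proof. by rewrite -opprB norm2N. Qed.

Lemma cauchy_schwarz x y : dotw (ones R n) x y <= norm2 x * norm2 y.
Proof.
have [/norm2_eq0->|y0] := eqVneq (norm2 y) 0.
  by rewrite dotw0r norm2_0 mulr0.
have [/norm2_eq0->|x0] := eqVneq (norm2 x) 0.
  by rewrite dotw0l norm2_0 mul0r.
have := sumsq_ge0 (norm2 y *: x - norm2 x *: y).
have -> : \sum_i ((norm2 y *: x - norm2 x *: y) i 0) ^+ 2 =
          norm2 (norm2 y *: x - norm2 x *: y) ^+ 2.
  by rewrite sqr_sqrtr// sumsq_ge0.
rewrite norm2_sqr !dotwDl !dotwDr !dotwNl !dotwNr !dotwZl !dotwZr -!norm2_sqr (dotwC _ y x).
have xy : 0 < norm2 x * norm2 y by rewrite mulr_gt0 ?lt0r ?norm2_ge0 ?x0 ?y0.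
move=> h; rewrite -(ler_pM2l xy); nra.
Qed.

Lemma norm2D x y : norm2 (x + y) <= norm2 x + norm2 y.
Proof.
rewrite -(@ler_pXn2r _ 2%N) ?nnegrE ?addr_ge0 ?norm2_ge0//.
rewrite norm2_sqr dotw_sqrD -!norm2_sqr.
by have := cauchy_schwarz x y; nra.
Qed.

Lemma norm2B_le x y z : norm2 (x - z) <= norm2 (x - y) + norm2 (y - z).
Proof. by rewrite -{1}(subrK y x) -addrA norm2D. Qed.

Lemma norm2_le_sum x : norm2 x <= \sum_i `|x i 0|.
Proof.
rewrite -[leRHS]ger0_norm ?sumr_ge0// -sqrtr_sqr ler_wsqrtr//.
suff [] : 0 <= \sum_i `|x i 0| /\ \sum_i (x i 0) ^+ 2 <= (\sum_i `|x i 0|) ^+ 2 by [].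
elim/big_rec2 : _ => [|i a b _ [b0 ab]]; first by rewrite expr0n.
split; first by rewrite addr_ge0.
have := normr_ge0 (x i 0); rewrite -(real_normK (num_real (x i 0))); nra.
Qed.

Lemma norm2_le_coord x (e : R) : 0 <= e -> (forall i, `|x i 0| <= e) -> norm2 x <= n%:R * e.
Proof.
move=> e0 xe; apply: le_trans (norm2_le_sum x) _.
apply: le_trans (ler_sum _ (fun i _ => xe i)) _.
by rewrite sumr_const card_ord mulr_natl.
Qed.

Lemma dist_set_has_inf x I : I !=set0 -> has_inf [set norm2 (x - y) | y in I].
Proof.
move=> [y Iy]; split; first by exists (norm2 (x - y)), y.
by exists 0 => _ [z _ <-]; exact: norm2_ge0.
Qed.

Lemma dist_set_ge0 x I : 0 <= dist_set x I.
Proof.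
have [I0|/set0P/negP/negPn/eqP->] := pselect (I !=set0); last first.
  by rewrite /dist_set image_set0 inf0.
apply: lb_le_inf; first by have [] := dist_set_has_inf x I0.
by move=> _ [z _ <-]; exact: norm2_ge0.
Qed.

Lemma dist_set_le x y I : I y -> dist_set x I <= norm2 (x - y).
Proof.
by move=> Iy; apply: ge_inf; [exists 0 => _ [z _ <-]; exact: norm2_ge0|exists y].
Qed.

Lemma dist_set_adherent x I (e : R) : I !=set0 -> 0 < e ->
  exists2 y, I y & norm2 (x - y) < dist_set x I + e.
Proof.
move=> I0 e0; have [_ [y Iy <-] h] := inf_adherent e0 (dist_set_has_inf x I0).
by exists y.
Qed.

Lemma dist_set_lip x y I : I !=set0 -> dist_set x I <= dist_set y I + norm2 (x - y).
Proof.
move=> I0; apply/ler_addgt0Pr => e e0.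
have [z Iz yz] := dist_set_adherent y I0 e0.
apply: le_trans (dist_set_le x Iz) _; apply: le_trans (norm2B_le x y z) _; lra.
Qed.

Lemma dist_set_self x I : I x -> dist_set x I = 0.
Proof.
move=> Ix; apply/eqP; rewrite eq_le dist_set_ge0 andbT.
by rewrite (le_trans (dist_set_le x Ix))// subrr norm2_0.
Qed.

Lemma dist_setZ x I (a : R) : I !=set0 -> 0 < a ->
  (forall (b : R) y, 0 < b -> I y -> I (b *: y)) ->
  dist_set (a *: x) I = a * dist_set x I.
Proof.
move=> I0 a0 cI; apply/eqP; rewrite eq_le; apply/andP; split.
  rewrite -ler_pdivrMl//; apply: lb_le_inf; first by have [] := dist_set_has_inf x I0.
  move=> _ [z Iz <-]; rewrite ler_pdivrMl//.
  apply: le_trans (dist_set_le _ (cI _ _ a0 Iz)) _.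
  by rewrite -scalerBr norm2Z gtr0_norm.
apply: lb_le_inf; first by have [] := dist_set_has_inf (a *: x) I0.
move=> _ [z Iz <-]; rewrite -ler_pdivlMl//.
have ia : 0 < a^-1 by rewrite invr_gt0.
apply: le_trans (dist_set_le x (cI _ _ ia Iz)) _.
rewrite -[X in norm2 (X - _)](scalerK (lt0r_neq0 a0)) -scalerBr norm2Z gtr0_norm//.
Qed.

End Euclid.

Section Compactness.
Variables (R : realType) (n : nat).

Lemma coordT_continuous i : continuous (fun v : 'rV[R]_n => v^T i 0).
Proof.
move=> v; rewrite (_ : (fun _ => _) = (fun v : 'rV[R]_n => v 0 i)).
  exact: coord_continuous.
by apply/funext => u; rewrite mxE.
Qed.

Lemma sum_continuous (T : topologicalType) (J : Type) (s : seq J) (F : J -> T -> R) :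
  (forall j, continuous (F j)) -> continuous (fun x => \sum_(j <- s) F j x).
Proof.
move=> cF; elim: s => [|a s IH] x.
  by rewrite (_ : (fun _ => _) = cst 0)
    ; [exact: cvg_cst|apply/funext => y; rewrite big_nil].
rewrite (_ : (fun _ => _) = (fun y => F a y + \sum_(j <- s) F j y)); last first.
  by apply/funext => y; rewrite big_cons.
by apply: cvgD; [exact: cF|exact: IH].
Qed.

Lemma linear_continuous_col (c : 'I_n -> R) :
  continuous (fun v : 'rV[R]_n => \sum_i c i * v^T i 0).
Proof.
by apply: sum_continuous => i v; apply: continuousM;
  [exact: cst_continuous|exact: coordT_continuous].
Qed.

Lemma col_compact_min (A : set 'cV[R]_n) (F : 'cV[R]_n -> R) :
  A !=set0 -> (exists K : R, forall x, A x -> forall i, `|x i 0| <= K) ->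
  closed [set v : 'rV[R]_n | A v^T] ->
  continuous (fun v : 'rV[R]_n => F v^T) ->
  exists2 x, A x & forall y, A y -> F x <= F y.
Proof.
move=> [a Aa] [K AK] cA cF.
have [|||v vA vmin] := @EVT_min_rV R n (fun v => F v^T) [set v : 'rV[R]_n | A v^T].
- by exists a^T; rewrite /= trmxK.
- apply: bounded_closed_compact cA.
  exists `|K|; split; first exact: num_real.
  move=> M KM v /AK vK; rewrite /Num.norm/= mx_normrE.
  have M0 : 0 <= M by rewrite (le_trans _ (ltW KM)).
  apply/bigmax_leP; split=> [//|[i j] _ /=].
  rewrite (ord1 i); have := vK j; rewrite mxE => /le_trans; apply.
  by rewrite (le_trans (ler_norm K))// ltW.
- exact: continuous_subspaceT.
- exists v^T; first by move: vA; rewrite inE.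
  by move=> y Ay; have := vmin y^T; rewrite inE /= trmxK; apply.
Qed.

End Compactness.

(** * Convex hulls of service vectors *)

Section Hull.
Variables (R : realType) (n : nat).
Implicit Types (L S : seq 'cV[R]_n) (m mu nu q w lam : 'cV[R]_n) (Rm : 'M[R]_n).

(** Weights are functions of the vector, as are the [s] of [fluid_solution], so a point of
    [hull (undup S)] supplies them directly. *)
Definition hull L m : Prop :=
  exists s : 'cV[R]_n -> R, [/\ forall mu, 0 <= s mu, \sum_(mu <- L) s mu = 1 &
    \sum_(mu <- L) s mu *: mu = m].

Lemma hull_mem L m : uniq L -> m \in L -> hull L m.
Proof.
move=> uL mL; exists (fun mu => (mu == m)%:R); split.
- by move=> mu; rewrite ler0n.
- rewrite (bigD1_seq m)//= eqxx big1 ?addr0// => i /negbTE ->//.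
- rewrite (bigD1_seq m)//= eqxx scale1r big1 ?addr0// => i /negbTE ->.
  by rewrite scale0r.
Qed.

Lemma hull_comb L (J : eqType) (r : seq J) (s : J -> R) (F : J -> 'cV[R]_n) :
  (forall j, j \in r -> 0 <= s j) -> \sum_(j <- r) s j = 1 ->
  (forall j, j \in r -> hull L (F j)) -> hull L (\sum_(j <- r) s j *: F j).
Proof.
move=> s0 s1 HF.
have /choice [t tP] : forall j, exists t : 'cV[R]_n -> R, j \in r ->
    [/\ forall mu, 0 <= t mu, \sum_(mu <- L) t mu = 1 &
    \sum_(mu <- L) t mu *: mu = F j].
  move=> j; have [jr|jr] := boolP (j \in r); last by exists (fun=> 0).
  by have [t tP] := HF _ jr; exists t.
exists (fun mu => \sum_(j <- r | j \in r) s j * t j mu); split.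
- move=> mu; apply: sumr_ge0 => j jr; have [t0 _ _] := tP _ jr.
  by rewrite mulr_ge0 ?s0.
- rewrite exchange_big /= -[RHS]s1 big_seq_cond [RHS]big_seq_cond.
  apply: eq_big => [j|j /andP[jr _]]; first by rewrite !andbT andbb.
  by rewrite -mulr_sumr; have [_ -> _] := tP _ jr; rewrite mulr1.
- transitivity (\sum_(mu <- L) \sum_(j <- r | j \in r) (s j * t j mu) *: mu).
    by apply: eq_bigr => mu _; rewrite scaler_suml.
  rewrite exchange_big /= big_seq_cond [RHS]big_seq_cond.
  apply: eq_big => [j|j /andP[jr _]]; first by rewrite !andbT andbb.
  have [_ _ <-] := tP _ jr; rewrite scaler_sumr.
  by apply: eq_bigr => mu _; rewrite scalerA.
Qed.

Lemma hull_conv L m1 m2 (t : R) : hull L m1 -> hull L m2 -> 0 <= t <= 1 ->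
  hull L (t *: m1 + (1 - t) *: m2).
Proof.
move=> h1 h2 /andP[t0 t1].
have := @hull_comb L bool [:: true; false] (fun b => if b then t else 1 - t)
  (fun b => if b then m1 else m2).
rewrite !big_cons !big_nil !addr0 /=; apply.
- by case=> _ //; rewrite subr_ge0.
- by rewrite addrC subrK.
- by case.
Qed.

(** Indexing the weights by position exhibits the hull as the image of a finite-dimensional simplex,
    where compactness is available. *)
Lemma hull_idx L m : uniq L -> hull L m <->
  exists c : 'cV[R]_(size L), [/\ nonneg c, \sum_j c j 0 = 1 &
    \sum_j c j 0 *: L`_j = m].
Proof.
move=> uL; split => [[s [s0 s1 <-]]|[c [c0 c1 <-]]].
  exists (\col_j s L`_j); split.
  - by move=> j; rewrite mxE.
  - rewrite -s1 (big_nth 0) big_mkord; apply: eq_bigr => j _; by rewrite mxE.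
  - rewrite (big_nth 0) big_mkord; apply: eq_bigr => j _; by rewrite mxE.
pose s mu := if insub (index mu L) is Some j then c j 0 else 0.
have sE (j : 'I_(size L)) : s L`_j = c j 0.
  by rewrite /s index_uniq// valK.
exists s; split.
- by move=> mu; rewrite /s; case: insubP.
- by rewrite -c1 (big_nth 0) big_mkord; apply: eq_bigr => j _; rewrite sE.
- by rewrite (big_nth 0) big_mkord; apply: eq_bigr => j _; rewrite sE.
Qed.

Lemma simplex_compact_min N (F : 'cV[R]_N -> R) :
  (0 < N)%N -> continuous (fun v : 'rV[R]_N => F v^T) ->
  exists2 c : 'cV[R]_N, nonneg c /\ \sum_j c j 0 = 1 &
    forall c' : 'cV[R]_N, nonneg c' -> \sum_j c' j 0 = 1 -> F c <= F c'.
Proof.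
move=> N0 cF.
pose A : set 'cV[R]_N := [set c | nonneg c /\ \sum_j c j 0 = 1].
have [||||c Ac cmin] := @col_compact_min R N A F; last first.
- by exists c => // c' ? ?; apply: cmin.
- exact: cF.
- rewrite (_ : mkset _ = \bigcap_(j : 'I_N) (fun v : 'rV[R]_N => v^T j 0) @^-1` [set x | 0 <= x]
     `&` (fun v : 'rV[R]_N => \sum_j 1 * v^T j 0) @^-1` [set 1]); last first.
    apply/seteqP; split=> v /= [v0 v1]; split.
    + by move=> j _; exact: v0.
    + by rewrite -[RHS]v1; apply: eq_bigr => j _; rewrite mul1r.
    + by move=> j; exact: v0.
    + by rewrite -[RHS]v1; apply: eq_bigr => j _; rewrite mul1r.
  apply: closedI; last first.
    by apply: preimage_closed; [move=> v _; exact: linear_continuous_col|exact: closed_eq].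
  apply: closed_bigI => j _.
  by apply: preimage_closed; [move=> v _; exact: coordT_continuous|exact: closed_ge].
- exists 1 => x [x0 x1] i; rewrite ger0_norm// -x1 (bigD1 i)//= lerDl.
  by apply: sumr_ge0.
- exists (\col_j (j == Ordinal N0)%:R); split=> [j|]; rewrite ?mxE//.
  rewrite (bigD1 (Ordinal N0))//= mxE eqxx big1 ?addr0// => j /negbTE jN.
  by rewrite mxE jN.
Qed.

(** Two choices of [phi] matter: squares give the least-norm velocity, positive parts the excess of
    [lam] over what a mixture drains. *)
Lemma hull_min L (B : 'M[R]_n) (b : 'cV[R]_n) (phi : R -> R) :
  uniq L -> L != [::] -> continuous phi ->
  exists2 m, hull L m & forall m', hull L m' ->
    \sum_i phi ((b - B *m m) i 0) <= \sum_i phi ((b - B *m m') i 0).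
Proof.
move=> uL L0 cphi.
pose F (c : 'cV[R]_(size L)) := \sum_i phi ((b - B *m (\sum_j c j 0 *: L`_j)) i 0).
have [||c [c0 c1] cmin] := @simplex_compact_min (size L) F.
- by case: L L0 {uL F}.
- apply: sum_continuous => i v; apply: (@continuous_comp _ _ _ _ phi); last exact: cphi.
  rewrite (_ : (fun _ => _) = (fun v : 'rV[R]_(size L) =>
      b i 0 + \sum_(j < size L) (- (B *m L`_j) i 0) * v^T j 0)); last first.
    apply/funext => u; rewrite mxE; congr (_ + _).
    rewrite mulmx_sumr mxE summxE -sumrN; apply: eq_bigr => j _.
    by rewrite -scalemxAr mxE mulrC mulNr.
  apply: continuousD; [exact: cst_continuous|exact: linear_continuous_col].
- exists (\sum_j c j 0 *: L`_j); first by apply/hull_idx => //; exists c.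
  by move=> m' /(hull_idx _ uL)[c' [c'0 c'1 <-]]; apply: cmin.
Qed.

End Hull.

(** * The service objective on mixtures of service vectors *)

Section Network.
Variables (R : realType) (n : nat) (Rm : 'M[R]_n) (S : seq 'cV[R]_n).
Hypothesis net : network_ok Rm S.
Implicit Types (m mu nu p q w lam : 'cV[R]_n).

Let R0 : forall i j, 0 <= Rm i j := net.1.
Let S0 : forall mu, mu \in S -> nonneg mu := net.2.1.

Lemma wobjE w q mu : wobj Rm w q mu = dotw w q ((1%:M - Rm) *m mu).
Proof. by apply: eq_bigr => i _; rewrite (mulrC (q i 0)). Qed.

Lemma wobjDr w q m1 m2 : wobj Rm w q (m1 + m2) = wobj Rm w q m1 + wobj Rm w q m2.
Proof. by rewrite !wobjE mulmxDr dotwDr. Qed.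

Lemma wobjZr w q a m : wobj Rm w q (a *: m) = a * wobj Rm w q m.
Proof. by rewrite !wobjE -scalemxAr dotwZr. Qed.

Lemma wobjBr w q m1 m2 : wobj Rm w q (m1 - m2) = wobj Rm w q m1 - wobj Rm w q m2.
Proof. by rewrite wobjDr -scaleN1r wobjZr mulN1r. Qed.

Lemma wobjDl w q1 q2 m : wobj Rm w (q1 + q2) m = wobj Rm w q1 m + wobj Rm w q2 m.
Proof. by rewrite !wobjE dotwDl. Qed.

Lemma wobjZl w q a m : wobj Rm w (a *: q) m = a * wobj Rm w q m.
Proof. by rewrite !wobjE dotwZl. Qed.

Lemma wobj_sumr w q (J : Type) (r : seq J) (s : J -> R) (F : J -> 'cV[R]_n) :
  wobj Rm w q (\sum_(j <- r) s j *: F j) = \sum_(j <- r) s j * wobj Rm w q (F j).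
Proof.
elim: r => [|a r IH]; first by rewrite !big_nil wobjE mulmx0 dotw0r.
by rewrite !big_cons wobjDr wobjZr IH.
Qed.

Lemma wobj_coef w q m :
  wobj Rm w q m = \sum_j wobj Rm w q (delta_mx j 0) * m j 0.
Proof.
rewrite {1}(_ : m = \sum_j m j 0 *: delta_mx j 0); last first.
  apply/colP => i; rewrite summxE (bigD1 i)//= !mxE !eqxx mulr1 big1 ?addr0// => j ji.
  by rewrite !mxE eq_sym (negbTE ji) mulr0.
by rewrite wobj_sumr; apply: eq_bigr => j _; rewrite mulrC.
Qed.

Definition zero_set (N : pred 'I_n) mu : 'cV[R]_n := \col_j (if N j then 0 else mu j 0).

Lemma zero_set_in N mu : mu \in S -> zero_set N mu \in S.
Proof.
move=> muS.
suff h (r : seq 'I_n) : zero_set [pred j | j \in r] mu \in S.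
  rewrite (_ : zero_set N mu = zero_set [pred j | j \in enum N] mu)//.
  by apply/colP => j; rewrite !mxE /= mem_enum.
elim: r => [|i r IH].
  rewrite (_ : zero_set _ _ = mu)//; apply/colP => j; by rewrite !mxE.
rewrite (_ : zero_set _ _ = zero_comp (zero_set [pred j | j \in r] mu) i).
  exact: net.2.2.
by apply/colP => j; rewrite !mxE /= inE; case: eqP.
Qed.

(* A linear functional on the box [0, mu] is maximal at a vertex, and all the
   vertices of the box belong to S. *)
Lemma wobj_box w p mu m b : mu \in S -> (forall nu, nu \in S -> wobj Rm w p nu <= b) ->
  (forall i, 0 <= m i 0 <= mu i 0) -> wobj Rm w p m <= b.
Proof.
move=> muS Sb mmu.
pose c j := wobj Rm w p (delta_mx j 0).
apply: le_trans (Sb _ (zero_set_in [pred j | c j < 0] muS)).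
rewrite wobj_coef [leRHS]wobj_coef; apply: ler_sum => j _.
rewrite mxE /= -/(c j); have /andP[m0 m1] := mmu j.
by case: ltP => cj; [nra|rewrite ler_wpM2l].
Qed.

Lemma hull_nonneg L m : {subset L <= S} -> hull L m -> nonneg m.
Proof.
move=> LS [s [s0 _ <-]] i; rewrite summxE big_seq; apply: sumr_ge0 => mu /LS muS.
by rewrite mxE mulr_ge0// S0.
Qed.

Lemma hull_zero_set N m : hull (undup S) m -> hull (undup S) (zero_set N m).
Proof.
move=> [s [s0 s1 <-]].
rewrite (_ : zero_set _ _ = \sum_(mu <- undup S) s mu *: zero_set N mu).
  apply: hull_comb => // j jS; apply: hull_mem; rewrite ?undup_uniq//.
  by move: jS; rewrite !mem_undup; exact: zero_set_in.
apply/colP => j; rewrite mxE !summxE; case: ifPn => Nj.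
  by rewrite big1// => mu _; rewrite !mxE Nj mulr0.
by apply: eq_bigr => mu _; rewrite !mxE (negbTE Nj).
Qed.

(** Coordinates are lowered one at a time: lowering coordinate [k] of [x] is a convex combination of
    [x] and of [x] with [k] zeroed. *)
Lemma hull_down m m' : hull (undup S) m -> (forall i, 0 <= m' i 0 <= m i 0) ->
  hull (undup S) m'.
Proof.
move=> hm mm'.
suff h (r : seq 'I_n) : hull (undup S) (\col_i (if i \in r then m' i 0 else m i 0)).
  rewrite (_ : m' = \col_i (if i \in enum 'I_n then m' i 0 else m i 0))//.
  by apply/colP => j; rewrite mxE mem_enum.
elim: r => [|k r IH].
  by rewrite (_ : (\col__ _) = m)//; apply/colP => j; rewrite mxE.
set x : 'cV[R]_n := \col_i _ in IH.
have /andP[m'0 m'm] := mm' k.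
have xk0 : 0 <= x k 0 by rewrite mxE; case: ifP => _ //; exact: le_trans m'm.
have m'x : m' k 0 <= x k 0 by rewrite mxE; case: ifP.
(* If [x k 0 = 0] the quotient is 0 by convention, and [m' k 0] vanishes as well. *)
pose t := m' k 0 / x k 0.
have t01 : 0 <= t <= 1.
  have [x0|x0] := eqVneq (x k 0) 0; first by rewrite /t x0 invr0 mulr0 lexx ler01.
  have xp : 0 < x k 0 by rewrite lt0r x0.
  by rewrite /t divr_ge0//= ler_pdivrMr// mul1r.
rewrite (_ : (\col__ _) = t *: x + (1 - t) *: zero_set (pred1 k) x).
  by apply: hull_conv => //; exact: hull_zero_set.
have xE j : x j 0 = if j \in r then m' j 0 else m j 0 by rewrite mxE.
rewrite /t; clearbody x => {t t01}.
apply/colP => j; rewrite !mxE inE /=; case: eqVneq => [->|jk] /=.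
  rewrite mulr0 addr0; have [x0|x0] := eqVneq (x k 0) 0; last by rewrite divfK.
  by rewrite x0 mulr0; apply/eqP; rewrite eq_le m'0 andbT -x0.
by rewrite -mulrDl addrC subrK mul1r xE.
Qed.

(** Complementary slackness: the gaps between the value at [m] and at each service vector are
    nonnegative with [s]-average zero, so every gap carrying weight vanishes. *)
Lemma hull_support w q m (s : 'cV[R]_n -> R) L :
  {subset L <= S} -> (forall mu, 0 <= s mu) -> \sum_(mu <- L) s mu = 1 ->
  \sum_(mu <- L) s mu *: mu = m ->
  (forall nu, nu \in S -> wobj Rm w q nu <= wobj Rm w q m) ->
  forall mu, mu \in L -> s mu != 0 -> wmw_choice Rm S w q mu.
Proof.
move=> LS s0 s1 sm mmax mu muL smu.
have sum0 : \sum_(nu <- L) s nu * (wobj Rm w q m - wobj Rm w q nu) = 0.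
  transitivity (wobj Rm w q m * \sum_(nu <- L) s nu - \sum_(nu <- L) s nu * wobj Rm w q nu).
    by rewrite mulr_sumr -sumrB; apply: eq_bigr => nu _; ring.
  by rewrite s1 mulr1 -wobj_sumr sm subrr.
split; first exact: LS.
suff -> : wobj Rm w q mu = wobj Rm w q m by [].
have /eqP : s mu * (wobj Rm w q m - wobj Rm w q mu) = 0.
  move: sum0; rewrite big_seq => /eqP; rewrite psumr_eq0; last first.
    by move=> nu /LS nuS; rewrite mulr_ge0// subr_ge0 mmax.
  by move/allP => /(_ _ muL); rewrite muL /= => /eqP.
by rewrite mulf_eq0 (negbTE smu) /= subr_eq0 => /eqP.
Qed.

Lemma hull_wobj_le w q b m : (forall nu, nu \in S -> wobj Rm w q nu <= b) ->
  hull (undup S) m -> wobj Rm w q m <= b.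
Proof.
move=> Sb [s [s0 s1 <-]]; rewrite wobj_sumr -[leRHS]mul1r -s1 mulr_suml.
rewrite big_seq [leRHS]big_seq; apply: ler_sum => mu; rewrite mem_undup => muS.
by rewrite ler_wpM2l// Sb.
Qed.

Lemma hull_weight_le1 (s : 'cV[R]_n -> R) : (forall mu, 0 <= s mu) ->
   \sum_(mu <- undup S) s mu = 1 -> forall mu, mu \in S -> s mu <= 1.
Proof.
move=> s0 <- mu muS; rewrite (bigD1_seq mu) ?undup_uniq ?mem_undup//= lerDl.
exact: sumr_ge0.
Qed.

End Network.

(** * Invariant states *)

Section InvariantStates.
Variables (R : realType) (n : nat) (Rm : 'M[R]_n) (S : seq 'cV[R]_n).
Hypothesis net : network_ok Rm S.
Variable w : 'cV[R]_n.
Hypothesis w0 : pos_weights w.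
Implicit Types (m mu nu p q lam : 'cV[R]_n).

Lemma pos_weights_nonneg : nonneg w.
Proof. by move=> i; rewrite ltW. Qed.

(** A null set cannot cover []0, 1[]. For a constant trajectory, the fluid equations at one such
    time are enough. *)
Lemma ae_exists_pos (P : R -> Prop) :
  {ae (@lebesgue_measure R), forall t, P t} -> exists2 t, 0 < t & P t.
Proof.
move=> [N [mN N0 PN]].
have [//|nP] := pselect (exists2 t, 0 < t & P t).
have sub : (`]0, 1[ : set R) `<=` N.
  move=> t /=; rewrite in_itv /= => /andP[t0 _]; apply: PN => /= Pt.
  by apply: nP; exists t.
have : (@lebesgue_measure R `]0%R, 1%R[%classic <= 0)%E.
  by rewrite -N0; apply: le_measure => //; rewrite inE.
by rewrite lebesgue_measure_itv /= lte_fin ltr01 oppr0 adde0 lee_fin ler10.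
Qed.

(** The condition [Phi <= 0] is spelled out as finitely many linear inequalities, the form that
    Hoffman's bound takes. *)
Definition inv_cone lam : set 'cV[R]_n :=
  [set q | nonneg q /\ forall nu, nu \in S -> wobj Rm w q nu <= dotw w q lam].

(** Service is wasted only at empty queues, so [y] is orthogonal to [q] and only the nonpositive
    routing term remains. *)
Lemma wobj_unused q y : nonneg q -> nonneg y -> (forall i, 0 < q i 0 -> y i 0 = 0) ->
  wobj Rm w q y <= 0.
Proof.
move=> q0 y0 qy; rewrite wobjE mulmxBl mul1mx dotwBr.
rewrite (_ : dotw w q y = 0); last first.
  apply: big1 => i _; have := q0 i; rewrite le_eqVlt => /orP[/eqP<-|/qy->].
    by rewrite mulr0 mul0r.
  by rewrite mulr0.
rewrite sub0r oppr_le0; apply: dotw_ge0 => //; first exact: pos_weights_nonneg.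
by move=> i; rewrite mxE; apply: sumr_ge0 => j _; rewrite mulr_ge0//; exact: net.1.
Qed.

(** Zero velocity means [lam = (I - Rm)(sg - y)] with [sg] a mixture of maximizers. Wasted service
    contributes nonpositively, so the pairing of [q] with [lam] is at least the maximal
    objective. *)
Lemma invariant_states_sub_cone lam :
  invariant_states Rm S w lam `<=` inv_cone lam.
Proof.
move=> q [q0 [_ [_ [s [y [s01 [y0 /ae_exists_pos]]]]]]].
move=> [t t0 /(_ t0)[_ [dE [s1 [_ [qy smax]]]]]].
split=> // nu nuS.
set sg := \sum_(mu <- _) _ *: _ in dE.
have lamE : lam = (1%:M - Rm) *m (sg - y t).
  apply/colP => i; have := dE i; rewrite derive1_cst.
  move/esym; rewrite mxE => /eqP; rewrite addr_eq0 => /eqP ->.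
  by rewrite -[1%:M - Rm]opprB mulNmx [RHS]mxE.
rewrite lamE -wobjE wobjBr.
have yle : wobj Rm w q (y t) <= 0 by apply: wobj_unused => //; exact/y0/ltW.
suff : wobj Rm w q nu <= wobj Rm w q sg by lra.
rewrite /sg wobj_sumr -[leLHS]mul1r -s1 mulr_suml big_seq [leRHS]big_seq.
apply: ler_sum => mu; rewrite mem_undup => muS.
have [mumax|/smax -> //] := pselect (wmw_choice Rm S w q mu); last by rewrite !mul0r.
by rewrite ler_wpM2l//; [have /andP[] := s01 mu t (ltW t0)|exact: mumax.2].
Qed.

(** The weights of [rho], without idling, hold any state still. On the cone [rho] attains the
    maximal objective, so by [hull_support] these weights charge maximizers only. *)
Lemma cone_sub_invariant_states lam rho : hull (undup S) rho ->
  lam = (1%:M - Rm) *m rho -> inv_cone lam `<=` invariant_states Rm S w lam.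
Proof.
move=> [s [s0 s1 sm]] lamE q [q0 qS]; split=> //; split=> //; split.
  move=> i t t0 e e0; exists 1 => // k u v _ _ _.
  by rewrite big1// => j _; rewrite subrr normr0.
have s01 mu : mu \in S -> s mu <= 1 by move=> muS; exact: (hull_weight_le1 s0 s1).
(* Outside [S] the weights of a hull point are arbitrary nonnegative numbers; cutting them to 0
   keeps every weight in [[0, 1]]. *)
exists (fun mu _ => if mu \in S then s mu else 0), (fun _ => 0).
have sumE (V : lmodType R) (F : 'cV[R]_n -> V) :
    \sum_(mu <- undup S) (if mu \in S then s mu else 0) *: F mu =
    \sum_(mu <- undup S) s mu *: F mu.
  by rewrite big_seq [RHS]big_seq; apply: eq_bigr => mu; rewrite mem_undup => ->.
split; [|split].
- by move=> mu t _; case: ifP => muS; rewrite ?lexx ?ler01// s0 s01.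
- by move=> t _ i; rewrite mxE.
apply: aeW => t t0; split; [|split; [|split; [|split; [|split]]]] => //.
- move=> i; rewrite derive1_cst sumE sm subr0 lamE -mulmxDl.
  by rewrite addrA subrK subrr mul0mx mxE.
- by rewrite -s1 big_seq [RHS]big_seq; apply: eq_bigr => mu; rewrite mem_undup => ->.
- move=> i; rewrite sumE sm mxE; apply: (hull_nonneg net (L := undup S)).
    by move=> mu; rewrite mem_undup.
  by exists s.
- by move=> i _; rewrite mxE.
- move=> mu muS nmax; rewrite muS; apply/eqP/negPn/negP => smu; apply: nmax.
  apply: (hull_support _ s0 s1 sm _ _ smu); last by rewrite mem_undup.
    by move=> nu; rewrite mem_undup.
  by move=> nu nuS; rewrite [leRHS]wobjE -lamE qS.
Qed.

Lemma inv_coneZ lam a q : 0 <= a -> inv_cone lam q -> inv_cone lam (a *: q).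
Proof.
move=> a0 [q0 qS]; split=> [i|nu nuS]; first by rewrite mxE mulr_ge0.
by rewrite wobjZl dotwZl ler_wpM2l// qS.
Qed.

Lemma inv_cone0 lam : inv_cone lam 0.
Proof.
split=> [i|nu nuS]; first by rewrite mxE.
by rewrite wobjE !dotw0l.
Qed.

End InvariantStates.

(** * Hoffman's error bound *)

Section Hoffman.
Variables (R : realType) (n N : nat) (a : 'I_N -> 'cV[R]_n).
Implicit Types (x y p q u : 'cV[R]_n) (J : {set 'I_N}).
Local Notation dot := (dotw (ones R n)).

Lemma dot_continuousr y : continuous (fun v : 'rV[R]_n => dot y v^T).
Proof.
rewrite (_ : (fun _ => _) = (fun v : 'rV[R]_n => \sum_i y i 0 * v^T i 0)).
  exact: linear_continuous_col.
by apply/funext => v; apply: eq_bigr => i _; rewrite mxE mul1r.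
Qed.

Lemma norm2_sqr_continuous : continuous (fun v : 'rV[R]_n => norm2 v^T ^+ 2).
Proof.
rewrite (_ : (fun _ => _) = (fun v : 'rV[R]_n => \sum_i v^T i 0 * v^T i 0)); last first.
  by apply/funext => v; rewrite norm2_sqr; apply: eq_bigr => i _; rewrite mxE mul1r.
by apply: sum_continuous => i v; apply: continuousM; exact: coordT_continuous.
Qed.

Lemma norm2_subsqr_continuous q : continuous (fun v : 'rV[R]_n => norm2 (q - v^T) ^+ 2).
Proof.
rewrite (_ : (fun _ => _) =
  (fun v : 'rV[R]_n => (norm2 q ^+ 2 - 2 * dot q v^T) + norm2 v^T ^+ 2)); last first.
  by apply/funext => v; rewrite !norm2_sqr dotw_sqrD dotwNr dotwNl dotwNr; ring.
move=> v; apply: (@continuousD _ _ _ (fun v : 'rV[R]_n => norm2 q ^+ 2 - 2 * dot q v^T)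
  (fun v : 'rV[R]_n => norm2 v^T ^+ 2)); last exact: norm2_sqr_continuous.
apply: (@continuousB _ _ _ (cst _) (fun v : 'rV[R]_n => 2 * dot q v^T)).
  exact: cst_continuous.
apply: (@continuousM _ _ (cst 2) (fun v : 'rV[R]_n => dot q v^T)).
  exact: cst_continuous.
exact: dot_continuousr.
Qed.

Definition poly_cone : set 'cV[R]_n := [set x | forall j, dot (a j) x <= 0].

Lemma dot_le_closed y (b : R) : closed [set v : 'rV[R]_n | dot y v^T <= b].
Proof.
apply: (@preimage_closed _ _ (fun v : 'rV[R]_n => dot y v^T) [set x | x <= b]).
  by move=> v _; exact: dot_continuousr.
exact: closed_le.
Qed.

Lemma poly_cone_proj q : exists2 p, poly_cone p &
  forall y, poly_cone y -> norm2 (q - p) <= norm2 (q - y).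
Proof.
pose A : set 'cV[R]_n := poly_cone `&` [set y | norm2 (q - y) ^+ 2 <= norm2 q ^+ 2].
have A0 : A 0.
  by split=> [j|]; rewrite ?dotw0r//= subr0.
have [||||p [Kp _] pmin] := @col_compact_min R n A (fun y => norm2 (q - y) ^+ 2).
- by exists 0.
- exists (2 * norm2 q) => x [_ /=]; rewrite ler_pXn2r ?nnegrE ?norm2_ge0// => qx i.
  apply: le_trans (coord_le_norm2 x i) _.
  rewrite (_ : norm2 x = norm2 (q - (q - x))); last by rewrite opprB addrC subrK.
  apply: le_trans (norm2D _ _) _.
  by rewrite norm2N; lra.
- rewrite (_ : mkset _ = (\bigcap_(j : 'I_N) [set v : 'rV[R]_n | dot (a j) v^T <= 0]) `&`
    [set v : 'rV[R]_n | norm2 (q - v^T) ^+ 2 <= norm2 q ^+ 2]); last first.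
    by apply/seteqP; split=> v /= [vK vq]; split=> //; move=> j; [move=> _|]; exact: vK.
  apply: closedI; first by apply: closed_bigI => j _; exact: dot_le_closed.
  apply: (@preimage_closed _ _ (fun v : 'rV[R]_n => norm2 (q - v^T) ^+ 2)
    [set x | x <= norm2 q ^+ 2]).
    by move=> v _; exact: norm2_subsqr_continuous.
  exact: closed_le.
- exact: norm2_subsqr_continuous.
exists p => // y Ky.
have [yq|yq] := leP (norm2 (q - y) ^+ 2) (norm2 q ^+ 2).
  by have := pmin y (conj Ky yq); rewrite ler_pXn2r ?nnegrE ?norm2_ge0.
have := pmin 0 A0; rewrite subr0 => h.
by rewrite -(@ler_pXn2r _ 2%N) ?nnegrE ?norm2_ge0// (le_trans h)// ltW.
Qed.

(** On the unit sphere of the polar cone, the sum [h] of the positive parts of the constraints is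
    continuous. It is positive there: [h u = 0] would put [u] in the cone itself, and polarity would
    give [dot u u <= 0]. Compactness yields the constant. *)
Lemma polar_gap J : exists2 c : R, 0 < c & forall u (b : R),
  (forall x, (forall j, j \in J -> dot (a j) x <= 0) -> dot u x <= 0) ->
  0 <= b -> (forall j, j \in J -> dot (a j) u <= b) -> c * norm2 u <= b.
Proof.
pose polar := [set u | forall x, (forall j, j \in J -> dot (a j) x <= 0) -> dot u x <= 0].
pose A := polar `&` [set u | norm2 u ^+ 2 = 1].
pose h u := \sum_(j in J) Num.max 0 (dot (a j) u).
have unit u : polar u -> u != 0 -> A ((norm2 u)^-1 *: u).
  move=> pu u0; have nu : norm2 u != 0 by apply: contra u0 => /eqP/norm2_eq0 ->.
  split=> [x Jx|/=]; last by rewrite norm2Z normfV ger0_norm ?norm2_ge0// mulVf// expr1n.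
  by rewrite dotwZl mulr_ge0_le0 ?invr_ge0 ?norm2_ge0// pu.
have [Ane|A0] := pselect (A !=set0); last first.
  exists 1 => // u b pu b0 _; have [->|u0] := eqVneq u 0; first by rewrite norm2_0 mulr0.
  by exfalso; apply: A0; exists ((norm2 u)^-1 *: u); exact: unit.
have [||||u0 [pu0 nu0] umin] := @col_compact_min R n A h.
- exact: Ane.
- exists 1 => x [_ /= x1] i; apply: le_trans (coord_le_norm2 x i) _.
  by rewrite -(@ler_pXn2r _ 2%N) ?nnegrE ?norm2_ge0// expr1n x1.
- rewrite (_ : mkset _ =
    (\bigcap_(x in [set x | forall j, j \in J -> dot (a j) x <= 0])
       [set v : 'rV[R]_n | dot x v^T <= 0]) `&`
    [set v : 'rV[R]_n | norm2 v^T ^+ 2 = 1]); last first.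
    by apply/seteqP; split=> v /= [vK vq]; split=> //= x Jx /=;
      [rewrite dotwC|rewrite dotwC]; exact: vK.
  apply: closedI; first by apply: closed_bigI => j _; exact: dot_le_closed.
  apply: (@preimage_closed _ _ (fun v : 'rV[R]_n => norm2 v^T ^+ 2) [set x | x = 1]).
    by move=> v _; exact: norm2_sqr_continuous.
  exact: closed_eq.
- rewrite (_ : (fun _ => _) = (fun v : 'rV[R]_n => \sum_(j <- enum J) Num.max 0 (dot (a j) v^T))).
    apply: sum_continuous => j v.
    apply: (@continuous_comp _ _ _ (fun v : 'rV[R]_n => dot (a j) v^T) (Num.max 0)).
      exact: dot_continuousr.
    apply: (@continuous_max _ _ (cst 0) id); [exact: cst_continuous|exact: cvg_id].
  by apply/funext => v; rewrite /h big_enum.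
have h0 : 0 < h u0.
  rewrite lt0r; apply/andP; split; last first.
    by apply: sumr_ge0 => j _; rewrite le_max lexx.
  apply/negP; rewrite psumr_eq0; last by move=> j _; rewrite le_max lexx.
  move/allP => hz.
  suff : dot u0 u0 <= 0 by rewrite -norm2_sqr nu0 ler10.
  apply: pu0 => j jJ.
  by have := hz j; rewrite mem_index_enum jJ /= => /(_ isT)/eqP <-; rewrite le_max lexx orbT.
exists (h u0 / N.+1%:R); first by rewrite divr_gt0.
move=> u b pu b0 ub; have [->|un0] := eqVneq u 0; first by rewrite norm2_0 mulr0.
have nu : 0 < norm2 u.
  by rewrite lt0r norm2_ge0 andbT; apply: contra un0 => /eqP/norm2_eq0 ->.
have := umin _ (unit _ pu un0).
have -> : h ((norm2 u)^-1 *: u) = (norm2 u)^-1 * h u.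
  rewrite mulr_sumr; apply: eq_bigr => j _.
  by rewrite dotwZr maxr_pMr ?mulr0// invr_ge0 norm2_ge0.
rewrite ler_pdivlMl// => hu.
have hb : h u <= N.+1%:R * b.
  apply: (@le_trans _ _ (\sum_(j in J) b)).
    by apply: ler_sum => j jJ; rewrite ge_max b0 ub.
  rewrite sumr_const -[leLHS]mulr_natl ler_wpM2r// ler_nat.
  by rewrite (leq_trans (max_card _))// card_ord.
by rewrite mulrAC ler_pdivrMr// mulrC (mulrC b) (le_trans hu)// .
Qed.

(** For the projection [p] of [q], the residual [q - p] is polar to the cone of the constraints
    active at [p], and those take the same value at [q - p] as at [q]. There are finitely many
    active sets, so the least [polar_gap] constant serves for all. *)
Lemma hoffman : exists2 c : R, 0 < c & forall q, exists2 p, poly_cone p &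
  forall b : R, 0 <= b -> (forall j, dot (a j) q <= b) -> c * norm2 (q - p) <= b.
Proof.
have /choice [c cP] : forall J, exists c : R, 0 < c /\ forall u (b : R),
  (forall x, (forall j, j \in J -> dot (a j) x <= 0) -> dot u x <= 0) ->
  0 <= b -> (forall j, j \in J -> dot (a j) u <= b) -> c * norm2 u <= b.
  by move=> J; have [c c0 cP] := polar_gap J; exists c.
pose c0 := \big[Num.min/1]_(J : {set 'I_N}) c J.
exists c0; first by apply/bigmin_gtP; split=> // J _; exact: (cP J).1.
move=> q; have [p Kp pmin] := poly_cone_proj q; exists p => // b b0 qb.
pose J : {set 'I_N} := [set j | dot (a j) p == 0]%SET.
apply: (@le_trans _ _ (c J * norm2 (q - p))).
  by rewrite ler_wpM2r ?norm2_ge0//; exact: bigmin_le_cond.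
apply: (cP J).2 => //; last first.
  by move=> j; rewrite inE => /eqP jp; rewrite dotwBr jp subr0.
move=> x Jx.
(* Moving from [p] along [x] by at most [e0] keeps the inactive constraints satisfied. *)
pose e0 := \big[Num.min/1]_(j : 'I_N | j \notin J)
   ((- dot (a j) p) / (1 + `|dot (a j) x|)).
have e00 : 0 < e0.
  apply/bigmin_gtP; split=> // j; rewrite inE => jp.
  apply: divr_gt0; first by rewrite oppr_gt0 lt_neqAle jp Kp.
  by rewrite (lt_le_trans ltr01)// lerDl.
have step (t : R) : 0 < t -> t <= e0 -> poly_cone (p + t *: x).
  move=> t0 te j; rewrite dotwDr dotwZr; have [jJ|jJ] := boolP (j \in J).
    by have := jJ; rewrite inE => /eqP ->; rewrite add0r mulr_ge0_le0 ?Jx// ltW.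
  have : t <= (- dot (a j) p) / (1 + `|dot (a j) x|).
    by rewrite (le_trans te)//; exact: bigmin_le_cond.
  rewrite ler_pdivlMr => [h|]; last by rewrite (lt_le_trans ltr01)// lerDl.
  by have := ler_norm (dot (a j) x); nra.
have key (t : R) : 0 < t -> t <= e0 -> 2 * dot (q - p) x <= t * norm2 x ^+ 2.
  move=> t0 te; have := pmin _ (step t t0 te).
  rewrite -(@ler_pXn2r _ 2%N) ?nnegrE ?norm2_ge0// opprD addrA.
  have -> : norm2 (q - p - t *: x) ^+ 2 =
      norm2 (q - p) ^+ 2 - 2 * t * dot (q - p) x + t ^+ 2 * norm2 x ^+ 2.
    by rewrite !norm2_sqr dotw_sqrD !dotwNr !dotwNl dotwZr dotwZl dotwZr; ring.
  move=> h; rewrite -(ler_pM2l t0); nra.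
rewrite leNgt; apply/negP => d0.
have x0 : 0 <= norm2 x ^+ 2 by rewrite sqr_ge0.
(* For so short a step, [key] would bound twice the positive number [dot (q - p) x] by that number
   itself. *)
pose t := Num.min e0 (dot (q - p) x / (1 + norm2 x ^+ 2)).
have t0 : 0 < t by rewrite lt_min e00 divr_gt0// (lt_le_trans ltr01)// lerDl.
have te : t <= e0 by rewrite ge_min lexx.
have td : t * (1 + norm2 x ^+ 2) <= dot (q - p) x.
  by rewrite -ler_pdivlMr ?ge_min ?lexx ?orbT// (lt_le_trans ltr01)// lerDl.
have := key t t0 te; nra.
Qed.

End Hoffman.

(** * Lyapunov drift *)

Section Lyapunov.
Variables (R : realType) (n : nat) (Rm : 'M[R]_n) (S : seq 'cV[R]_n).
Hypothesis net : network_ok Rm S.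
Variables w lam rho : 'cV[R]_n.
Hypotheses (w0 : pos_weights w) (hrho : hull (undup S) rho)
  (lamE : lam = (1%:M - Rm) *m rho).
Implicit Types (m mu nu p q v x : 'cV[R]_n).
Local Notation K := (inv_cone Rm S w lam).
Let wnn : nonneg w := pos_weights_nonneg w0.

(** This is [Phi >= 0]: [lam] is the rate drained by the mixture [rho], and no mixture beats a
    maximizer. *)
Lemma wmw_slack_ge0 q mu : wmw_choice Rm S w q mu -> dotw w q lam <= wobj Rm w q mu.
Proof.
by move=> [_ mumax]; rewrite lamE -wobjE; exact: (hull_wobj_le mumax).
Qed.

(** Hoffman's bound with [b = Phi q], for the [n] sign constraints, which [q] satisfies, and one
    constraint per service vector, which [q] violates by at most [Phi q]. *)
Lemma inv_cone_error_bound : exists2 c : R, 0 < c & forall q mu, nonneg q ->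
  wmw_choice Rm S w q mu -> c * dist_set q K <= wobj Rm w q mu - dotw w q lam.
Proof.
pose a (j : 'I_(n + size S)) : 'cV[R]_n := match fintype.split j with
  | inl i => - delta_mx i 0
  | inr k => \col_i (w i 0 * (((1%:M - Rm) *m S`_k) i 0 - lam i 0)) end.
have aL i x : dotw (ones R n) (a (lshift _ i)) x = - x i 0.
  rewrite /a (unsplitK (inl i)) dotwNl; congr (- _).
  rewrite /dotw (bigD1 i)//= !mxE !eqxx !mul1r big1 ?addr0// => j /negbTE ji.
  by rewrite !mxE ji /= mulr0 mul0r.
have aR (k : 'I_(size S)) x : dotw (ones R n) (a (rshift _ k)) x =
    wobj Rm w x S`_k - dotw w x lam.
  rewrite /a (unsplitK (inr k)) wobjE -sumrB; apply: eq_bigr => i _.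
  by rewrite mxE [X in X * _]mul1r [X in X * _]mxE; ring.
have coneE x : poly_cone a x -> K x.
  move=> ax; split=> [i|nu nuS].
    by have := ax (lshift _ i); rewrite aL oppr_le0.
  have sz : (index nu S < size S)%N by rewrite index_mem.
  have := ax (rshift _ (Ordinal sz)); rewrite aR /= nth_index//.
  by rewrite subr_le0.
have [c c0 cP] := hoffman a; exists c => // q mu q0 qmu.
have [p Kp pP] := cP q.
apply: (@le_trans _ _ (c * norm2 (q - p))).
  by rewrite ler_wpM2l ?(ltW c0)//; apply: dist_set_le; exact: coneE.
have phi0 : 0 <= wobj Rm w q mu - dotw w q lam by rewrite subr_ge0 wmw_slack_ge0.
apply: pP => // j; case: (split_ordP j) => [i ->|k ->].
  by rewrite aL (le_trans _ phi0)// oppr_le0.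
by rewrite aR lerB//; apply: qmu.2; exact: mem_nth.
Qed.

Definition serv_max : R := \sum_(mu <- S) \sum_i mu i 0.

Lemma serv_max_ge0 : 0 <= serv_max.
Proof.
rewrite /serv_max big_seq; apply: sumr_ge0 => mu muS; apply: sumr_ge0 => i _.
exact: net.2.1.
Qed.

Lemma serv_le_max mu i : mu \in S -> mu i 0 <= serv_max.
Proof.
move=> muS; rewrite /serv_max big_seq (perm_big _ (perm_to_rem muS)) /= big_cons muS.
rewrite (bigD1 i)//= -addrA lerDl addr_ge0//.
  by apply: sumr_ge0 => j _; exact: net.2.1.
apply: sumr_ge0 => nu nuS; apply: sumr_ge0 => j _; exact: net.2.1.
Qed.

Lemma cmin_bounds mu q i : mu \in S -> nonneg q -> 0 <= cmin mu q i 0 <= mu i 0.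
Proof.
by move=> muS q0; rewrite mxE le_min q0 net.2.1//= ge_min lexx.
Qed.

Lemma qstep_nonneg q a mu : mu \in S -> nonneg q -> nonneg a -> nonneg (qstep Rm q a mu).
Proof.
move=> muS q0 a0 i; rewrite /qstep mulmxBl mul1mx !mxE.
have : 0 <= \sum_j Rm i j * cmin mu q j 0.
  apply: sumr_ge0 => j _; rewrite mulr_ge0//; first exact: net.1.
  by have /andP[] := cmin_bounds j muS q0.
have : Num.min (mu i 0) (q i 0) <= q i 0 by rewrite ge_min lexx orbT.
have := a0 i; lra.
Qed.

Lemma wmw_path_nonneg (A Q : nat -> 'cV[R]_n) : wmw_path Rm S w A Q ->
  (forall t, nonneg (A t)) -> nonneg (Q 0%N) -> forall t, nonneg (Q t).
Proof.
move=> path A0 Q0; elim=> // t IH.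
by have [mu [[muS _] ->]] := path t; exact: qstep_nonneg.
Qed.

Definition drift mu q := lam - (1%:M - Rm) *m cmin mu q.

(** The part paired with [p] is nonpositive, because the actual service lies in the box below [mu]
    and [p] is in the cone. The part paired with [q] is [- Phi q] up to a constant: actual and
    nominal service differ only where [q] is below [serv_max]. *)
Lemma drift_dot mu q p : wmw_choice Rm S w q mu -> nonneg q -> K p ->
  dotw w (drift mu q) (q - p) <=
  - (wobj Rm w q mu - dotw w q lam) + \sum_i w i 0 * serv_max ^+ 2.
Proof.
move=> [muS mumax] q0 [p0 pS].
have pm : wobj Rm w p (cmin mu q) <= dotw w p lam.
  by apply: (wobj_box net muS pS) => i; exact: cmin_bounds.
have qm : wobj Rm w q (mu - cmin mu q) <= \sum_i w i 0 * serv_max ^+ 2.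
  rewrite wobjE mulmxBl mul1mx dotwBr.
  have : 0 <= dotw w q (Rm *m (mu - cmin mu q)).
    apply: dotw_ge0 => // i; rewrite mxE; apply: sumr_ge0 => j _.
    rewrite mulr_ge0//; first exact: net.1.
    by rewrite !mxE subr_ge0 ge_min lexx.
  suff : dotw w q (mu - cmin mu q) <= \sum_i w i 0 * serv_max ^+ 2 by lra.
  apply: ler_sum => i _; rewrite -mulrA ler_wpM2l// !mxE.
  have := serv_le_max i muS; have := q0 i; have := net.2.1 _ muS i.
  have := serv_max_ge0; move: (mu i 0) (q i 0) serv_max => a b c c0 a0 b0 ac.
  case: (leP a b) => ab; first by rewrite subrr mulr0 sqr_ge0.
  nra.
move: qm; rewrite wobjBr /drift dotwBr !dotwBl ![dotw w (_ *m _) _]dotwC -!wobjE.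
rewrite ![dotw w lam _]dotwC; lra.
Qed.

Definition drift_bound : R :=
  \sum_i (`|lam i 0| + serv_max + \sum_j Rm i j * serv_max).

Lemma drift_le mu q i : mu \in S -> nonneg q -> `|drift mu q i 0| <= drift_bound.
Proof.
move=> muS q0.
have sm := serv_max_ge0.
have pos j : 0 <= `|lam j 0| + serv_max + \sum_k Rm j k * serv_max.
  rewrite !addr_ge0//; apply: sumr_ge0 => k _; rewrite mulr_ge0//; exact: net.1.
apply: (@le_trans _ _ (`|lam i 0| + serv_max + \sum_j Rm i j * serv_max)); last first.
  by rewrite /drift_bound [leRHS](bigD1 i)//= lerDl; apply: sumr_ge0.
have cb j : 0 <= cmin mu q j 0 <= serv_max.
  have /andP[-> h] /= := cmin_bounds j muS q0; apply: le_trans h _.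
  exact: serv_le_max.
rewrite /drift mulmxBl mul1mx opprB mxE -addrA.
apply: le_trans (ler_normD _ _) _; rewrite lerD2l mxE [(Rm *m _) _ _]mxE addrC.
rewrite mxE; apply: le_trans (ler_normD _ _) _; rewrite normrN lerD//.
  by have /andP[c0 c1] := cb i; rewrite ger0_norm.
apply: le_trans (ler_norm_sum _ _ _) _; apply: ler_sum => j _.
have /andP[c0 c1] := cb j; rewrite ger0_norm ?mulr_ge0//; last exact: net.1.
by rewrite ler_wpM2l//; exact: net.1.
Qed.

Lemma dotw_norm_le (V : R) v x : (forall i, `|v i 0| <= V) ->
  `|dotw w v x| <= (\sum_i w i 0) * V * norm2 x.
Proof.
move=> vV; apply: le_trans (ler_norm_sum _ _ _) _.
rewrite -mulrA mulr_suml; apply: ler_sum => i _.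
rewrite !normrM (ger0_norm (wnn i)) -mulrA ler_wpM2l// ler_pM//.
exact: coord_le_norm2.
Qed.

Definition cumdev (A : nat -> 'cV[R]_n) k := \sum_(t < k) (A t - lam).

(** Subtracting [cumdev] cancels the arrivals, so the increment is the bounded vector [drift], whose
    square goes into [B]. In the cross term, replacing [Q - cumdev - p] by [Q - p] costs the [M]
    term. *)
Lemma lyapunov_step : exists c M B : R, [/\ 0 < c, 0 <= M, 0 <= B &
  forall (A Q : nat -> 'cV[R]_n) p, wmw_path Rm S w A Q -> (forall t, nonneg (Q t)) -> K p ->
  forall k, dotw w (Q k.+1 - cumdev A k.+1 - p) (Q k.+1 - cumdev A k.+1 - p) <=
    dotw w (Q k - cumdev A k - p) (Q k - cumdev A k - p)
    - 2 * c * dist_set (Q k) K + M * norm2 (cumdev A k) + B].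
Proof.
have [c c0 cP] := inv_cone_error_bound.
have wsum : 0 <= \sum_i w i 0 by apply: sumr_ge0.
have sm := serv_max_ge0.
have db : 0 <= drift_bound.
  apply: sumr_ge0 => i _; rewrite !addr_ge0//; apply: sumr_ge0 => k _.
  by rewrite mulr_ge0//; exact: net.1.
pose B0 := \sum_i w i 0 * serv_max ^+ 2.
have B00 : 0 <= B0 by apply: sumr_ge0 => i _; rewrite mulr_ge0// sqr_ge0.
exists c, (2 * ((\sum_i w i 0) * drift_bound)), (2 * B0 + (\sum_i w i 0) * drift_bound * (n%:R * drift_bound)).
split=> //; first by rewrite !mulr_ge0.
  by rewrite addr_ge0 ?mulr_ge0.
move=> A Q p path Q0 Kp k; have [mu [qmu QE]] := path k.
set U := cumdev A k; set v := drift mu (Q k).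
have -> : Q k.+1 - cumdev A k.+1 - p = (Q k - U - p) + v.
  rewrite /cumdev big_ord_recr /= -/(cumdev A k) -/U QE /qstep /v /drift.
  rewrite -(opprB 1%:M Rm) mulNmx; apply/colP => i; rewrite !mxE; ring.
rewrite dotw_sqrD; set z := Q k - U - p.
have vle i : `|v i 0| <= drift_bound by apply: drift_le => //; exact: qmu.1.
have h1 := drift_dot qmu (Q0 k) Kp.
have h2 := cP _ _ (Q0 k) qmu.
have h3 := dotw_norm_le U vle.
have h4 := dotw_norm_le v vle.
have h5 : norm2 v <= n%:R * drift_bound by apply: norm2_le_coord.
have h6 : dotw w z v = dotw w v (Q k - p) - dotw w v U.
  by rewrite -dotwBr dotwC /z (addrAC (Q k)).
have h7 : dotw w v v <= (\sum_i w i 0) * drift_bound * (n%:R * drift_bound).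
  apply: le_trans (le_trans (ler_norm _) h4) _.
  by rewrite ler_wpM2l// mulr_ge0.
move: h3; rewrite ler_norml => /andP[h3 _].
move: h1; rewrite -/v -/B0 => h1.
rewrite h6; lra.
Qed.

(** The unit terms keep [wmin] and [wtot] positive when [n = 0]. *)
Definition wmin : R := \big[Num.min/1]_i w i 0.
Definition wtot : R := 1 + \sum_i w i 0.

Lemma wmin_gt0 : 0 < wmin.
Proof. by apply/bigmin_gtP; split. Qed.

Lemma wtot_gt0 : 0 < wtot.
Proof. by rewrite (lt_le_trans ltr01)// lerDl; apply: sumr_ge0. Qed.

Lemma dotw_ge_norm x : wmin * norm2 x ^+ 2 <= dotw w x x.
Proof.
rewrite norm2_sqr mulr_sumr; apply: ler_sum => i _.
by rewrite mxE mul1r -mulrA ler_wpM2r -?expr2 ?sqr_ge0//; exact: bigmin_le_cond.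
Qed.

Lemma dotw_le_norm x : dotw w x x <= wtot * norm2 x ^+ 2.
Proof.
rewrite norm2_sqr mulr_sumr; apply: ler_sum => i _.
rewrite mxE mul1r -mulrA ler_wpM2r -?expr2 ?sqr_ge0// /wtot (bigD1 i)//=.
by rewrite addrCA lerDl addr_ge0//; apply: sumr_ge0.
Qed.

Lemma cumdev_shift A s k : cumdev (fun t => A (s + t)%N) k = cumdev A (s + k) - cumdev A s.
Proof.
rewrite /cumdev -(big_mkord xpredT (fun t => A t - lam)) -(big_mkord xpredT (fun t => A t - lam)).
rewrite [X in X - _](@big_cat_nat _ _ _ s) ?leq_addr//=.
rewrite addrAC subrr add0r.
have -> : \sum_(s <= i < s + k) (A i - lam) = \sum_(0 + s <= i < s + k) (A i - lam).
  by rewrite add0n.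
by rewrite big_addn addKn big_mkord; apply: eq_bigr => t _; rewrite addnC.
Qed.

End Lyapunov.

(** * Lyapunov estimates over one window of [r] steps *)

Section Window.
Variables (R : realType) (n : nat) (Rm : 'M[R]_n) (S : seq 'cV[R]_n).
Hypothesis net : network_ok Rm S.
Variables w lam rho : 'cV[R]_n.
Hypotheses (w0 : pos_weights w) (hrho : hull (undup S) rho)
  (lamE : lam = (1%:M - Rm) *m rho).
Local Notation K := (inv_cone Rm S w lam).

Lemma inv_cone_neq0 : K !=set0.
Proof. by exists 0; exact: inv_cone0. Qed.

Lemma lyapunov_sum : exists c M B : R, [/\ 0 < c, 0 <= M, 0 <= B &
  forall (A Q : nat -> 'cV[R]_n) p, wmw_path Rm S w A Q -> (forall t, nonneg (Q t)) -> K p ->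
  forall (a : R) (k : nat), (forall l, (l <= k)%N -> norm2 (cumdev lam A l) <= a) ->
    dotw w (Q k - cumdev lam A k - p) (Q k - cumdev lam A k - p) <=
    dotw w (Q 0%N - p) (Q 0%N - p)
    - 2 * c * (\sum_(l < k) dist_set (Q l) K) + k%:R * (M * a + B)].
Proof.
have [c [M [B [c0 M0 B0 step]]]] := lyapunov_step net w0 hrho lamE.
exists c, M, B; split=> // A Q p path Q0 Kp a k.
elim: k => [|k IH] Ua.
  by rewrite /cumdev !big_ord0 !subr0 mulr0 mul0r subr0 addr0.
have := step _ _ _ path Q0 Kp k.
have {}IH := IH (fun l lk => Ua l (leqW lk)).
have Uk : M * norm2 (cumdev lam A k) <= M * a by rewrite ler_wpM2l// Ua.
rewrite big_ord_recr /= -natr1 mulrDl mul1r; lra.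
Qed.

(* Lengths are measured in units of [r]: [eta] at the start of the window,
   [th] inside it, [e] for the cumulative deviation of the arrivals. *)
Lemma window_stay : exists c M B s : R, [/\ 0 < c, 0 <= M, 0 <= B, 0 < s <= 1 &
  forall (A Q : nat -> 'cV[R]_n), wmw_path Rm S w A Q -> (forall t, nonneg (Q t)) ->
  forall (th eta e r : R) (k : nat), 0 < r -> 0 < th -> 0 < eta ->
    k%:R <= r -> dist_set (Q 0%N) K <= eta * r ->
    (forall l, (l <= k)%N -> norm2 (cumdev lam A l) <= e * r) ->
    (2 * c * (\sum_(l < k) dist_set (Q l) K) <=
       r * (r * (4 * wtot w * eta ^+ 2 + M * e) + B)) /\
    (eta <= s * th -> e <= th / 2 -> M * e <= wmin w * th ^+ 2 / 12 ->
     B <= wmin w * th ^+ 2 / 12 * r -> dist_set (Q k) K <= th * r)].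
Proof.
have [c [M [B [c0 M0 B0 lyap]]]] := lyapunov_sum.
have wm := wmin_gt0 w0; have wt := wtot_gt0 w0.
(* Initial energy, deviation and constant drift are each allotted [wmin w * th ^+ 2 / 12]. Together
   they give [norm2 z <= th * r / 2], and the other half of [th] is left for [cumdev]. The factor 48
   is [4 * 12], with 4 from starting at most [2 * eta * r] from [p]. *)
pose s := Num.min 1 (wmin w / (48 * wtot w)).
have s0 : 0 < s by rewrite lt_min ltr01 divr_gt0// mulr_gt0.
have s1 : s <= 1 by rewrite ge_min lexx.
have sw : 48 * wtot w * s ^+ 2 <= wmin w.
  have : s <= wmin w / (48 * wtot w) by rewrite ge_min lexx orbT.
  rewrite ler_pdivlMr ?mulr_gt0// => h; apply: le_trans h.
  by rewrite mulrC ler_pM2r ?mulr_gt0// expr2 ler_piMr// ltW.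
exists c, M, B, s; split=> //; first by rewrite s0.
move=> A Q path Q0 th eta e r k r0 th0 eta0 kr dQ Ue.
have [p Kp pd] := dist_set_adherent (Q 0%N) inv_cone_neq0 (mulr_gt0 eta0 r0).
have e0 : 0 <= e * r.
  by apply: le_trans (Ue 0%N (leq0n _)); exact: norm2_ge0.
have L0 : dotw w (Q 0%N - p) (Q 0%N - p) <= wtot w * (4 * eta ^+ 2 * r ^+ 2).
  apply: le_trans (dotw_le_norm w0 _) _; rewrite ler_pM2l//.
  have := norm2_ge0 (Q 0%N - p).
  have : norm2 (Q 0%N - p) <= 2 * eta * r by lra.
  have := mulr_gt0 eta0 r0; nra.
have MeB : 0 <= M * (e * r) + B by rewrite addr_ge0// mulr_ge0.
have L1 := lyap _ _ _ path Q0 Kp (e * r) k Ue.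
have L2 : k%:R * (M * (e * r) + B) <= r * (M * (e * r) + B) by rewrite ler_wpM2r.
set z := Q k - cumdev lam A k - p in L1 *.
have z0 : 0 <= dotw w z z.
  by apply: le_trans (dotw_ge_norm w z); rewrite mulr_ge0 ?sqr_ge0// ltW.
split; first by nra.
move=> etas eth Meth Bth.
have sumd : 0 <= 2 * c * (\sum_(l < k) dist_set (Q l) K).
  by rewrite !mulr_ge0 ?(ltW c0)//; apply: sumr_ge0 => l _; exact: dist_set_ge0.
have etas2 : 4 * wtot w * eta ^+ 2 <= wmin w * th ^+ 2 / 12.
  have : eta ^+ 2 <= s ^+ 2 * th ^+ 2.
    by rewrite -exprMn ler_pXn2r ?nnegrE ?mulr_ge0// ltW.
  have : 0 <= th ^+ 2 by rewrite sqr_ge0.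
  nra.
have zb : wmin w * norm2 z ^+ 2 <= wmin w * (th * r / 2) ^+ 2.
  apply: le_trans (dotw_ge_norm w z) _; apply: le_trans L1 _.
  have : r * B <= r * (wmin w * th ^+ 2 / 12 * r) by rewrite ler_pM2l.
  have : r ^+ 2 * (M * e) <= r ^+ 2 * (wmin w * th ^+ 2 / 12).
    by rewrite ler_pM2l// exprn_gt0.
  have : r ^+ 2 * (4 * wtot w * eta ^+ 2) <= r ^+ 2 * (wmin w * th ^+ 2 / 12).
    by rewrite ler_pM2l// exprn_gt0.
  nra.
have {}zb : norm2 z <= th * r / 2.
  move: zb; rewrite ler_pM2l// ler_pXn2r ?nnegrE ?norm2_ge0//.
  by rewrite divr_ge0// mulr_ge0// ltW.
apply: le_trans (dist_set_le _ Kp) _.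
have -> : Q k - p = z + cumdev lam A k.
  by rewrite /z addrAC subrK.
apply: le_trans (norm2D _ _) _.
have := Ue k (leqnn k).
have : e * r <= th / 2 * r by rewrite ler_pM2r.
lra.
Qed.

(** If the queue comes within [s * d' * r] of the cone, restarting there keeps it within [d' * r]
    until the end. Otherwise its distance exceeds [s * d' * r] at every step, and the accumulated
    decrease is more than the energy available. *)
Lemma window_return (delta : R) : 0 < delta -> exists d' e r0 : R,
  [/\ 0 < d', d' <= delta, 0 < e & forall (A Q : nat -> 'cV[R]_n),
    wmw_path Rm S w A Q -> (forall t, nonneg (Q t)) ->
    forall r : nat, r0 <= r%:R -> (0 < r)%N -> dist_set (Q 0%N) K <= d' * r%:R ->
    (forall l, (l <= r)%N -> norm2 (cumdev lam A l) <= e * r%:R) ->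
    (forall k, (k <= r)%N -> dist_set (Q k) K <= delta * r%:R) /\
    dist_set (Q r) K <= d' * r%:R].
Proof.
move=> del0; have [c [M [B [s [c0 M0 B0 /andP[s0 s1] stay]]]]] := window_stay.
have wm := wmin_gt0 w0; have wt := wtot_gt0 w0.
have cs : 0 < c * s / (4 * wtot w) by rewrite divr_gt0 ?mulr_gt0.
(* The first bound keeps the window within [delta]; the second makes the initial energy
   [4 * wtot w * d' ^+ 2] at most half of the decrease [2 * c * s * d']. *)
pose d' := Num.min (s * delta) (c * s / (4 * wtot w)).
have d'0 : 0 < d' by rewrite lt_min cs mulr_gt0.
have d's : d' <= s * delta by rewrite ge_min lexx.
have d'd : d' <= delta by rewrite (le_trans d's)// ler_piMl// ltW.
have d'c : 4 * wtot w * d' ^+ 2 <= c * s * d'.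
  have : d' <= c * s / (4 * wtot w) by rewrite ge_min lexx orbT.
  rewrite ler_pdivlMr ?mulr_gt0// => h.
  by rewrite expr2 mulrA ler_wpM2r ?(ltW d'0)// mulrC.
(* Common budget for [M * e] and for [B / r]: the first entry meets the requirements of
   [window_stay], the second gives [c * s * d' + 2 * x < 2 * c * s * d']. *)
pose x := Num.min (wmin w * d' ^+ 2 / 12) (c * s * d' / 3).
have x0 : 0 < x.
  by rewrite lt_min !divr_gt0// !mulr_gt0// exprn_gt0.
have x1 : x <= wmin w * d' ^+ 2 / 12 by rewrite ge_min lexx.
have x2 : x <= c * s * d' / 3 by rewrite ge_min lexx orbT.
have x3 : x <= wmin w * delta ^+ 2 / 12.
  apply: le_trans x1 _; rewrite ler_pM2r// ler_pM2l//.
  by rewrite ler_pXn2r ?nnegrE// ltW.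
pose e := Num.min (d' / 4) (x / (2 * M + 1)).
have M1 : 0 < 2 * M + 1 by lra.
have e0 : 0 < e by rewrite lt_min !divr_gt0.
have ed : e <= d' / 4 by rewrite ge_min lexx.
have eM : M * (2 * e) <= x.
  have : e <= x / (2 * M + 1) by rewrite ge_min lexx orbT.
  rewrite ler_pdivlMr// => h; nra.
exists d', e, (B / x); split=> // A Q path Q0 r Br r0 dQ Ue.
have r0R : 0 < r%:R :> R by rewrite ltr0n.
have Bx : B <= x * r%:R by move: Br; rewrite ler_pdivrMr// mulrC.
have eM' : M * e <= x by nra.
have Bx1 : B <= wmin w * d' ^+ 2 / 12 * r%:R by rewrite (le_trans Bx)// ler_pM2r.
have Bx3 : B <= wmin w * delta ^+ 2 / 12 * r%:R by rewrite (le_trans Bx)// ler_pM2r.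
have [small|big] := pselect (exists2 k, (k < r)%N & dist_set (Q k) K <= s * d' * r%:R).
  split=> [k kr|].
    have krR : k%:R <= r%:R :> R by rewrite ler_nat.
    have Uk l : (l <= k)%N -> norm2 (cumdev lam A l) <= e * r%:R.
      by move=> lk; apply: Ue; exact: leq_trans kr.
    have [_ h] := stay _ _ path Q0 delta d' e r%:R k r0R del0 d'0 krR dQ Uk.
    apply: h => //; lra.
  have [k kr dk] := small.
  have path' : wmw_path Rm S w (fun t => A (k + t)%N) (fun t => Q (k + t)%N).
    by move=> t; have := path (k + t)%N; rewrite addnS.
  have krR : (r - k)%:R <= r%:R :> R by rewrite ler_nat leq_subr.
  (* Counted from the restart at [k], the deviation is a difference of two cumulative sums, hence
     the factor 2. *)
  have Uk l : (l <= r - k)%N -> norm2 (cumdev lam (fun t => A (k + t)%N) l) <= 2 * e * r%:R.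
    move=> lk; rewrite cumdev_shift.
    apply: le_trans (norm2D _ _) _; rewrite norm2N.
    have h2 := Ue k (ltnW kr).
    have h1 : norm2 (cumdev lam A (k + l)) <= e * r%:R.
      by apply: Ue; rewrite -leq_subRL// ltnW.
    lra.
  have dk' : dist_set (Q (k + 0)%N) K <= s * d' * r%:R by rewrite addn0.
  have [_] := stay _ _ path' (fun t => Q0 (k + t)%N) d' (s * d') (2 * e) r%:R (r - k)%N r0R d'0
    (mulr_gt0 s0 d'0) krR dk' Uk.
  rewrite subnKC ?(ltnW kr)//; apply => //; lra.
exfalso.
have [h _] := stay _ _ path Q0 d' d' e r%:R r r0R d'0 d'0 (lexx _) dQ Ue.
have : r%:R * (s * d' * r%:R) <= \sum_(l < r) dist_set (Q l) K.
  have -> : r%:R * (s * d' * r%:R) = \sum_(l < r) (s * d' * r%:R).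
    by rewrite sumr_const card_ord mulr_natl.
  apply: ler_sum => l _.
  by rewrite ltW// ltNge; apply/negP => dl; apply: big; exists l.
move=> h1.
have h2 : 2 * c * (r%:R * (s * d' * r%:R)) <= 2 * c * \sum_(l < r) dist_set (Q l) K.
  by rewrite ler_pM2l// mulr_gt0.
have h3 : 2 * c * (s * d') * r%:R ^+ 2 <= (c * s * d' + x + x) * r%:R ^+ 2.
  have : r%:R ^+ 2 * (4 * wtot w * d' ^+ 2 + M * e) <= r%:R ^+ 2 * (c * s * d' + x).
    by rewrite ler_pM2l ?exprn_gt0// lerD.
  have : r%:R * B <= r%:R * (x * r%:R) by rewrite ler_pM2l.
  nra.
move: h3; rewrite ler_pM2r ?exprn_gt0//.
have : 0 < c * (s * d') by rewrite !mulr_gt0.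
nra.
Qed.

End Window.

(** * Existence of fluid solutions *)

Section FluidExistence.
Variables (R : realType) (n : nat) (Rm : 'M[R]_n) (S : seq 'cV[R]_n).
Hypothesis net : network_ok Rm S.
Variable lam : 'cV[R]_n.
Hypotheses (lam0 : nonneg lam) (S0 : S != [::]).
Implicit Types (m mu nu q v : 'cV[R]_n).
Local Notation e1 := (ones R n).
Local Notation choice_at := (wmw_choice Rm S e1).

Lemma ones_pos : pos_weights e1.
Proof. by move=> i; rewrite mxE. Qed.

Lemma wmw_choice_exists w q : exists mu, wmw_choice Rm S w q mu.
Proof.
have sz : (0 < size S)%N by rewrite lt0n size_eq0.
pose F (i : 'I_(size S)) := wobj Rm w q S`_i.
case: (@Order.TotalTheory.arg_maxP _ _ _ (Ordinal sz) xpredT F isT) => i _ imax.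
exists S`_i; split; first exact: mem_nth.
move=> nu nuS; have iS : (index nu S < size S)%N by rewrite index_mem.
by have := imax (Ordinal iS) isT; rewrite /F /= nth_index.
Qed.

Local Notation N := (size (undup S)).

(** Subsets are coded by sets of positions, a finite type, so that the least speeds can be
    ranked. *)
Definition sub_serv (J : {set 'I_N}) : seq 'cV[R]_n := [seq (undup S)`_i | i : 'I_N <- enum J].

Definition argmax_set q : {set 'I_N} := [set i : 'I_N | `[< choice_at q (undup S)`_i >]]%SET.

Lemma sub_serv_uniq J : uniq (sub_serv J).
Proof.
rewrite map_inj_in_uniq ?enum_uniq// => i j _ _ /eqP.
by rewrite nth_uniq ?undup_uniq// => /eqP/val_inj.
Qed.

Lemma sub_serv_sub J : {subset sub_serv J <= S}.
Proof. by move=> mu /mapP[i _ ->]; rewrite -mem_undup mem_nth. Qed.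

Lemma mem_argmax q mu : reflect (choice_at q mu) (mu \in sub_serv (argmax_set q)).
Proof.
apply: (iffP mapP) => [[i]|qmu].
  by rewrite mem_enum inE => /asboolP qi ->.
have muS : mu \in undup S by rewrite mem_undup; exact: qmu.1.
have iS : (index mu (undup S) < N)%N by rewrite index_mem.
exists (Ordinal iS); last by rewrite /= nth_index.
by rewrite mem_enum inE /= nth_index//; apply/asboolP.
Qed.

Lemma argmax_nonempty q : sub_serv (argmax_set q) != [::].
Proof.
have [mu /mem_argmax] := wmw_choice_exists e1 q.
by case: (sub_serv _).
Qed.

(** The fluid velocity under the mixture [m] with [y = 0]; the solutions constructed below never
    idle. *)
Definition veloc m := lam - (1%:M - Rm) *m m.

Definition min_speed L m := hull L m /\
  forall m', hull L m' -> norm2 (veloc m) ^+ 2 <= norm2 (veloc m') ^+ 2.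

Lemma min_speed_exists L : uniq L -> L != [::] -> exists m, min_speed L m.
Proof.
move=> uL L0.
have [|m hm mmin] := @hull_min R n L (1%:M - Rm) lam (fun x => x ^+ 2) uL L0.
  exact: exprn_continuous.
have nE x : norm2 (veloc x) ^+ 2 = \sum_i (lam - (1%:M - Rm) *m x) i 0 ^+ 2.
  by rewrite sqr_sqrtr ?sumsq_ge0.
by exists m; split=> // m' hm'; rewrite !nE; exact: mmin.
Qed.

(** The variational inequality for the point of least norm in the convex set of velocities, obtained
    by moving slightly from [m] towards [m']. *)
Lemma min_speed_dot L m m' : min_speed L m -> hull L m' ->
  wobj Rm e1 (veloc m) m' <= wobj Rm e1 (veloc m) m.
Proof.
move=> [hm mmin] hm'; rewrite -subr_ge0 -wobjBr wobjE leNgt; apply/negP.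
set d := (1%:M - Rm) *m (m - m') => dneg.
have key (t : R) : 0 < t -> t <= 1 -> 0 <= 2 * dotw e1 (veloc m) d + t * norm2 d ^+ 2.
  move=> t0 t1.
  have hc : hull L (t *: m' + (1 - t) *: m) by apply: hull_conv => //; rewrite ltW.
  have := mmin _ hc.
  have -> : veloc (t *: m' + (1 - t) *: m) = veloc m + t *: d.
    rewrite /veloc /d mulmxDr !mulmxBr -!scalemxAr; apply/colP => i; rewrite !mxE; ring.
  rewrite [X in _ <= X]norm2_sqr dotw_sqrD dotwZr dotwZl dotwZr -!norm2_sqr => h.
  by rewrite -(ler_pM2l t0); nra.
set x := dotw _ _ _ in dneg key.
have n0 : 0 <= norm2 d ^+ 2 by rewrite sqr_ge0.
have p1 : 0 < 1 + norm2 d ^+ 2 by lra.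
pose t := Num.min 1 (- x / (1 + norm2 d ^+ 2)).
have t0 : 0 < t by rewrite lt_min ltr01 divr_gt0// oppr_gt0.
have t1 : t <= 1 by rewrite ge_min lexx.
have td : t * (1 + norm2 d ^+ 2) <= - x by rewrite -ler_pdivlMr// ge_min lexx orbT.
have := key t t0 t1; nra.
Qed.

Lemma hull_argmax_max q m : hull (sub_serv (argmax_set q)) m ->
  forall nu, nu \in S -> wobj Rm e1 q nu <= wobj Rm e1 q m.
Proof.
move=> [s [s0 s1 <-]] nu nuS; rewrite wobj_sumr -[leLHS]mul1r -s1 mulr_suml.
rewrite big_seq [leRHS]big_seq; apply: ler_sum => mu /mem_argmax[_ mumax].
by rewrite ler_wpM2l// mumax.
Qed.

(** Along the least-norm velocity no tied service vector overtakes [m], so [m] remains optimal for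
    some time. *)
Lemma min_speed_tight q m nu : min_speed (sub_serv (argmax_set q)) m ->
  nu \in S -> wobj Rm e1 q nu = wobj Rm e1 q m ->
  wobj Rm e1 (veloc m) nu <= wobj Rm e1 (veloc m) m.
Proof.
move=> mm nuS nuE; apply: (min_speed_dot mm); apply: hull_mem; first exact: sub_serv_uniq.
apply/mem_argmax; split=> // nu' nu'S; rewrite nuE; exact: (hull_argmax_max mm.1).
Qed.

(* Where the queue is empty the least-norm velocity points inward: zeroing the
   services of the queues that would decrease keeps the service optimal, and
   would otherwise shorten the velocity. *)
Lemma min_speed_inward q m i : nonneg q -> min_speed (sub_serv (argmax_set q)) m ->
  q i 0 = 0 -> 0 <= veloc m i 0.
Proof.
move=> q0 mm qi; rewrite leNgt; apply/negP => vi.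
have m0 : nonneg m by apply: hull_nonneg mm.1; [exact: net|exact: sub_serv_sub].
pose Z := [pred j : 'I_n | (q j 0 == 0) && (veloc m j 0 < 0)].
pose m' := zero_set Z m; pose y := m - m'.
have yE j : y j 0 = if Z j then m j 0 else 0.
  by rewrite !mxE; case: ifP => _; rewrite ?subr0 ?subrr.
have hm' : hull (sub_serv (argmax_set q)) m'.
  have [s [s0 s1 sm]] := mm.1.
  rewrite (_ : m' = \sum_(mu <- sub_serv (argmax_set q)) s mu *: zero_set Z mu).
    apply: hull_comb => // mu muJ; apply: hull_mem; first exact: sub_serv_uniq.
    have /mem_argmax qmu := muJ.
    have zS : zero_set Z mu \in S by apply: (zero_set_in net); exact: qmu.1.
    apply/mem_argmax; split=> // nu nuS; apply: le_trans (qmu.2 _ nuS) _.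
    have := @wobj_unused R n Rm S net e1 ones_pos q (mu - zero_set Z mu) q0.
    rewrite wobjBr subr_le0; apply.
      move=> j; rewrite !mxE; case: ifP => _; rewrite ?subr0 ?subrr//.
      by apply: net.2.1; exact: qmu.1.
    move=> j qj; rewrite !mxE /= gt_eqF//= subrr//.
  rewrite /m' -sm; apply/colP => j; rewrite mxE !summxE; case: ifPn => Zj.
    by rewrite big1// => mu _; rewrite !mxE Zj mulr0.
  by apply: eq_bigr => mu _; rewrite !mxE (negbTE Zj).
have y0 : nonneg y by move=> j; rewrite yE; case: ifP.
have Ry0 : nonneg (Rm *m y).
  by move=> j; rewrite mxE; apply: sumr_ge0 => k _; rewrite mulr_ge0//; exact: net.1.
have Rym j : (Rm *m y) j 0 <= (Rm *m m) j 0.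
  rewrite !mxE; apply: ler_sum => k _; rewrite ler_wpM2l//; first exact: net.1.
  by rewrite yE; case: ifP.
(* [m] is optimal and the removed service [y] sits at empty queues, so the routing term of [y] must
   vanish: [y] sends nothing to a nonempty queue. *)
have qRy : dotw e1 q (Rm *m y) <= 0.
  have : wobj Rm e1 q m' <= wobj Rm e1 q m.
    have [s [s0 s1 <-]] := hm'; rewrite wobj_sumr -[leRHS]mul1r -s1 mulr_suml.
    rewrite big_seq [leRHS]big_seq; apply: ler_sum => mu /sub_serv_sub muS.
    by rewrite ler_wpM2l//; exact: hull_argmax_max mm.1 _ muS.
  rewrite -subr_ge0 -wobjBr -/y wobjE mulmxBl mul1mx dotwBr.
  rewrite (_ : dotw e1 q y = 0) ?sub0r ?oppr_ge0//.
  apply: big1 => j _; rewrite yE /=; case: ifP => [/andP[/eqP-> _]|_].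
    by rewrite mulr0 mul0r.
  by rewrite mulr0.
have qRy0 j : q j 0 != 0 -> (Rm *m y) j 0 = 0.
  move=> qj.
  have : dotw e1 q (Rm *m y) == 0.
    by rewrite eq_le qRy; apply: dotw_ge0 => //; move=> k; rewrite mxE.
  rewrite /dotw psumr_eq0; last first.
    by move=> k _; apply: mulr_ge0 => //; apply: mulr_ge0 => //; rewrite mxE.
  move/allP => /(_ j); rewrite mem_index_enum => /(_ isT) /=.
  by rewrite !mulf_eq0 (negbTE qj) mxE oner_eq0 /= => /eqP.
(* On [Z] the velocity is negative while [y - Rm y] is at least [lam - veloc m], hence positive;
   elsewhere the terms are nonpositive. The term at [i] is negative, against the variational
   inequality. *)
have := min_speed_dot mm hm'; rewrite -subr_ge0 -wobjBr -/y wobjE mulmxBl mul1mx.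
apply/negP; rewrite -ltNge /dotw.
have term j : e1 j 0 * veloc m j 0 * (y - Rm *m y) j 0 <= 0.
  rewrite [e1 j 0]mxE mul1r [X in _ * X]mxE [X in _ + X]mxE yE; case: ifPn => Zj.
    have /andP[_ vj] := Zj.
    have vE : veloc m j 0 = lam j 0 - m j 0 + (Rm *m m) j 0.
      by rewrite /veloc mulmxBl mul1mx !mxE; ring.
    have := Rym j; have := lam0 j; rewrite vE in vj *; nra.
  have [qj|qj] := eqVneq (q j 0) 0; last by rewrite qRy0// subrr mulr0.
  move: Zj; rewrite inE qj eqxx /= -leNgt => vj.
  by have := Ry0 j; nra.
rewrite (bigD1 i)//= -[ltRHS]addr0 ltr_leD//; last by apply: sumr_le0 => j _.
have Zi : Z i by rewrite /= qi eqxx vi.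
rewrite [e1 i 0]mxE mul1r [X in _ * X]mxE [X in _ + X]mxE yE Zi.
have vE : veloc m i 0 = lam i 0 - m i 0 + (Rm *m m) i 0.
  by rewrite /veloc mulmxBl mul1mx !mxE; ring.
have := Rym i; have := lam0 i; rewrite vE in vi *; nra.
Qed.

(** The ratio test: the first exit is the least [a j / (- b j)] over decreasing constraints,
    positive because a constraint starting at 0 does not decrease. *)
Lemma affine_exit (T : finType) (a b : T -> R) :
  (forall j, 0 <= a j) -> (forall j, a j = 0 -> 0 <= b j) ->
  (forall j, 0 <= b j) \/ exists2 t : R, 0 < t &
    (forall j s, 0 <= s <= t -> 0 <= a j + s * b j) /\
    exists2 j, a j + t * b j = 0 & b j < 0.
Proof.
move=> a0 ab.
have [b0|/existsNP[j0 /negP]] := pselect (forall j, 0 <= b j); first by left.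
rewrite -ltNge => bj0; right.
case: (@Order.TotalTheory.arg_minP _ _ _ j0 (fun j => b j < 0) (fun j => a j / (- b j)) bj0).
move=> j bj jmin; exists (a j / (- b j)).
  rewrite divr_gt0 ?oppr_gt0// lt0r a0 andbT; apply/negP => /eqP/ab.
  by rewrite leNgt bj.
split=> [k s /andP[s0 sj]|].
  have [bk|bk] := leP 0 (b k); first by rewrite addr_ge0// mulr_ge0.
  have := le_trans sj (jmin k bk); rewrite ler_pdivlMr ?oppr_gt0//; lra.
exists j => //; rewrite invrN mulrN mulNr divfK ?subrr//.
by rewrite lt_eqF.
Qed.

Definition pl_fluid (q : R -> 'cV[R]_n) : Prop :=
  [/\ forall t, 0 <= t -> nonneg (q t),
    exists C : R, 0 <= C /\ forall i s t, 0 <= s -> s <= t -> `|q t i 0 - q s i 0| <= C * (t - s) &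
    exists E : seq R, forall t, 0 < t -> t \notin E ->
      exists2 m, exists s : 'cV[R]_n -> R, [/\ forall mu, 0 <= s mu,
           \sum_(mu <- undup S) s mu = 1, \sum_(mu <- undup S) s mu *: mu = m
           & forall mu, mu \in S -> s mu != 0 -> choice_at (q t) mu]
        & exists2 e : R, 0 < e & forall u, `|u - t| < e -> q u = q t + (u - t) *: veloc m].

Lemma hull_sub_undup L m : uniq L -> {subset L <= S} -> hull L m -> hull (undup S) m.
Proof.
move=> uL LS [s [s0 s1 <-]]; apply: hull_comb => // mu muL.
by apply: hull_mem; rewrite ?undup_uniq// mem_undup LS.
Qed.

Lemma hull_max_weights q m : hull (undup S) m ->
  (forall nu, nu \in S -> wobj Rm e1 q nu <= wobj Rm e1 q m) ->
  exists s : 'cV[R]_n -> R, [/\ forall mu, 0 <= s mu,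
     \sum_(mu <- undup S) s mu = 1, \sum_(mu <- undup S) s mu *: mu = m
     & forall mu, mu \in S -> s mu != 0 -> choice_at q mu].
Proof.
move=> [s [s0 s1 sm]] mmax; exists s; split=> // mu muS smu.
apply: (hull_support _ s0 s1 sm mmax _ smu); rewrite ?mem_undup//.
by move=> nu; rewrite mem_undup.
Qed.

Lemma hull_max_argmax q m : hull (undup S) m ->
  (forall nu, nu \in S -> wobj Rm e1 q nu <= wobj Rm e1 q m) ->
  hull (sub_serv (argmax_set q)) m.
Proof.
move=> hm mmax; have [s [s0 s1 sm sch]] := hull_max_weights hm mmax.
have filt (V : lmodType R) (F : 'cV[R]_n -> V) :
    \sum_(mu <- undup S) s mu *: F mu = \sum_(mu <- [seq mu <- undup S | s mu != 0]) s mu *: F mu.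
  rewrite big_filter [LHS](bigID (fun mu => s mu != 0)) /= [X in _ + X]big1 ?addr0//.
  by move=> mu /negPn/eqP->; rewrite scale0r.
rewrite -sm filt; apply: hull_comb => //.
  rewrite -s1 big_filter [RHS](bigID (fun mu => s mu != 0)) /= [X in _ + X]big1 ?addr0//.
  by move=> mu /negPn/eqP->.
move=> mu; rewrite mem_filter mem_undup => /andP[smu muS].
by apply: hull_mem; [exact: sub_serv_uniq|apply/mem_argmax; exact: sch].
Qed.

Lemma pl_fluid_exists q0 : nonneg q0 -> exists2 q, pl_fluid q & q 0 = q0.
Proof.
have /choice [mJ mJP] : forall J : {set 'I_N}, exists m, sub_serv J != [::] -> min_speed (sub_serv J) m.
  move=> J; have [J0|J0] := boolP (sub_serv J != [::]); last by exists 0.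
  by have [m ?] := min_speed_exists (sub_serv_uniq J) J0; exists m.
pose F J := norm2 (veloc (mJ J)) ^+ 2.
pose rk x := #|[set J : {set 'I_N} | F J < x]%SET|.
have [k] := ubnP (rk (F (argmax_set q0))); elim: k q0 => // k IH q0 rkk q00.
set J := argmax_set q0 in rkk; pose m := mJ J; pose v := veloc m.
have mm : min_speed (sub_serv J) m by apply: mJP; exact: argmax_nonempty.
have hm : hull (undup S) m.
  exact: hull_sub_undup (sub_serv_uniq J) (@sub_serv_sub J) mm.1.
(* The constraints along the ray are nonnegativity of each queue and optimality of [m] against each
   service vector; [a] holds their slacks at [q0], [b] their rates. *)
pose a (j : 'I_n + 'I_(size S)) := match j with
  | inl i => q0 i 0 | inr i => wobj Rm e1 q0 m - wobj Rm e1 q0 S`_i end.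
pose b (j : 'I_n + 'I_(size S)) := match j with
  | inl i => v i 0 | inr i => wobj Rm e1 v m - wobj Rm e1 v S`_i end.
have a0 j : 0 <= a j.
  case: j => i //=; rewrite subr_ge0; apply: (hull_argmax_max mm.1); exact: mem_nth.
have ab j : a j = 0 -> 0 <= b j.
  case: j => i /=; first exact: (min_speed_inward q00 mm).
  move/eqP; rewrite subr_eq0 eq_sym => /eqP qE; rewrite subr_ge0.
  by apply: (min_speed_tight mm _ qE); exact: mem_nth.
have vE : v = veloc m by [].
clearbody v.
have linE t i : (q0 + t *: v) i 0 = q0 i 0 + t * v i 0.
  by rewrite mxE [X in _ + X]mxE.
have nng t : (forall j, 0 <= a j + t * b j) -> nonneg (q0 + t *: v).
  by move=> h i; rewrite linE; exact: (h (inl i)).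
have maxt t : (forall j, 0 <= a j + t * b j) ->
    forall nu, nu \in S -> wobj Rm e1 (q0 + t *: v) nu <= wobj Rm e1 (q0 + t *: v) m.
  move=> h nu nuS; have iS : (index nu S < size S)%N by rewrite index_mem.
  have := h (inr (Ordinal iS)); rewrite /a /b /= nth_index//.
  by rewrite !wobjDl !wobjZl mulrBr addrACA -opprD subr_ge0.
have lip1 i s t : s <= t -> `|(q0 + t *: v) i 0 - (q0 + s *: v) i 0| <= norm2 v * (t - s).
  move=> st; rewrite !linE opprD addrACA subrr add0r -mulrBl normrM.
  by rewrite (@ger0_norm _ (t - s)) ?subr_ge0// mulrC ler_wpM2r ?subr_ge0// coord_le_norm2.
have [b0|[T T0 [Tok [j jT bj]]]] := affine_exit a0 ab.
  exists (fun t => q0 + t *: v); last by rewrite scale0r addr0.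
  have ok t j : 0 <= t -> 0 <= a j + t * b j.
    by move=> t0; rewrite addr_ge0// mulr_ge0.
  split.
  - by move=> t t0; apply: nng => j; exact: ok.
  - exists (norm2 v); split; first exact: norm2_ge0.
    by move=> i s t _; exact: lip1.
  - exists [::] => t t0 _; exists m.
      apply: hull_max_weights => //; apply: maxt => j; apply: ok; exact: ltW.
    by exists 1 => // u _; rewrite -vE -addrA -scalerDl (addrC t) subrK.
pose q1 := q0 + T *: v.
have okT : forall j, 0 <= a j + T * b j by move=> j'; apply: Tok; rewrite lexx ltW.
have q10 : nonneg q1 := nng _ okT.
have hm1 : hull (sub_serv (argmax_set q1)) m.
  by apply: hull_max_argmax hm _; exact: maxt.
(* [m] is still optimal at [q1], so the least speed cannot increase. If it were equal, [m] would be
   of least speed at [q1], and the constraint just hit could not be decreasing. *)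
have FJ : F (argmax_set q1) < F J.
  have mm1 : min_speed (sub_serv (argmax_set q1)) (mJ (argmax_set q1)).
    by apply: mJP; exact: argmax_nonempty.
  have := mm1.2 _ hm1; rewrite -/(F _) -/(F _) le_eqVlt => /orP[/eqP FE|//].
  have mm' : min_speed (sub_serv (argmax_set q1)) m.
    by split=> // m' hm'; rewrite -/(F J) -FE; exact: mm1.2.
  move: bj; rewrite ltNge => /negP; case; case: j jT => i /= jT.
    by rewrite vE; apply: (min_speed_inward q10 mm'); rewrite linE.
  rewrite subr_ge0 vE; apply: (min_speed_tight mm'); first exact: mem_nth.
  rewrite /q1 !wobjDl !wobjZl; move: jT; lra.
have [|q' [q'0 [C [C0 q'lip]] [E q'E]] q'q1] := IH q1 _ q10.
  rewrite -ltnS (leq_trans _ rkk)// ltnS; apply: proper_card; apply/properP; split.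
    by apply/fintype.subsetP => J'; rewrite !inE => /lt_trans; exact.
  by exists (argmax_set q1); rewrite !inE ?ltxx.
exists (fun t => if t <= T then q0 + t *: v else q' (t - T)); last first.
  by rewrite (ltW T0) scale0r addr0.
split.
- move=> t t0; case: leP => tT; last by apply: q'0; rewrite subr_ge0 ltW.
  by apply: nng => j'; apply: Tok; rewrite t0.
- exists (norm2 v + C); split; first by rewrite addr_ge0 ?norm2_ge0.
  move=> i s t s0 st; have v0 := norm2_ge0 v.
  case: (leP t T) => tT; case: (leP s T) => sT.
  + by apply: le_trans (lip1 _ _ _ st) _; rewrite ler_wpM2r ?subr_ge0// lerDl.
  + by exfalso; have := le_lt_trans (le_trans st tT) sT; rewrite ltxx.
  + have -> : q' (t - T) i 0 - (q0 + s *: v) i 0 =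
        (q' (t - T) i 0 - q' 0 i 0) + ((q0 + T *: v) i 0 - (q0 + s *: v) i 0).
      by rewrite q'q1 /q1; ring.
    apply: le_trans (ler_normD _ _) _.
    have h1 := lip1 i _ _ sT.
    have h2 := q'lip i 0 (t - T) (lexx _); rewrite subr0 subr_ge0 in h2.
    have {}h2 := h2 (ltW tT).
    have := ltW tT; nra.
  + have := q'lip i (s - T) (t - T); rewrite subr_ge0 lerD2r => h.
    apply: le_trans (h (ltW sT) st) _.
    have -> : t - T - (s - T) = t - s by ring.
    by rewrite ler_wpM2r ?subr_ge0// lerDr.
- exists (T :: [seq x + T | x <- E]) => t t0; rewrite inE negb_or => /andP[tT tE].
  case: leP => tT'.
    have {}tT : t < T by rewrite lt_neqAle tT.
    exists m.
      apply: hull_max_weights => //; apply: maxt => j'.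
      by apply: Tok; rewrite !ltW.
    exists (T - t); first by rewrite subr_gt0.
    move=> u ut; have -> : u <= T.
      by rewrite -(lerD2r (- t)) (le_trans (ler_norm _))// ltW.
    by rewrite -vE -addrA -scalerDl (addrC t) subrK.
  have tT0 : 0 < t - T by rewrite subr_gt0.
  have tTE : t - T \notin E.
    by apply: contra tE => tE; apply/mapP; exists (t - T) => //; rewrite subrK.
  have [m2 m2P [e e0 eP]] := q'E _ tT0 tTE.
  exists m2 => //; exists (Num.min e (t - T)); first by rewrite lt_min e0 subr_gt0.
  move=> u; rewrite lt_min => /andP[ue uT].
  have -> : (u <= T) = false.
    by apply/negbTE; rewrite -ltNge; move: uT; rewrite ltr_norml => /andP[]; lra.
  have := eP (u - T); have -> : u - T - (t - T) = u - t by ring.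
  by move=> /(_ ue).
Qed.

End FluidExistence.

(** * Decrease from one-sided derivatives *)

Section Dini.
Variable R : realType.
Implicit Types (f phi : R -> R) (a b t L alpha : R).

Lemma local_affine_is_derive f t (c : R) :
  (exists2 e : R, 0 < e & forall u, `|u - t| < e -> f u = f t + (u - t) * c) ->
  is_derive t 1 f c.
Proof.
move=> [e e0 fE].
have cv : (h^-1 *: (f (h *: 1 + t) - f t)) @[h --> 0^'] --> c.
  apply: cvg_near_cst.
  near=> h.
  have h0 : h != 0 by near: h; exact: nbhs_dnbhs_neq.
  rewrite fE; last first.
    rewrite addrK /GRing.scale /= mulr1.
    near: h; apply: dnbhs0_lt => //.
  by rewrite addrK addrAC subrr add0r /GRing.scale /= mulr1 mulKf.
by apply: DeriveDef; [apply/cvg_ex; exists c|apply/cvg_lim].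
Unshelve. all: end_near. Qed.

(** Take the supremum of the times up to which the bound holds: the Lipschitz bound carries the
    inequality to it, and the strict derivative bound would push beyond it if it were less than
    [b]. *)
Lemma dini_decrease phi L alpha a b : a <= b ->
  (forall s t, a <= s -> s <= t -> `|phi t - phi s| <= L * (t - s)) ->
  (forall u, a <= u -> u < b -> exists2 D, D < - alpha &
      (fun s => (phi (u + s) - phi u) / s) @ 0^'+ --> D) ->
  phi b <= phi a - alpha * (b - a).
Proof.
move=> ab lip der.
pose X := [set u | a <= u <= b /\ phi u <= phi a - alpha * (u - a)].
have Xa : X a by split; rewrite ?lexx ?ab// subrr mulr0 subr0.
have supX : has_sup X by split; [exists a|exists b => u [/andP[]]].
pose s := sup X.
have sa : a <= s by exact: sup_upper_bound.
have sb : s <= b by apply: ge_sup; [exists a|move=> u [/andP[]]].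
have Xs : phi s <= phi a - alpha * (s - a).
  apply/ler_addgt0Pr => e e0.
  pose eta := e / (`|L| + `|alpha| + 1).
  have den : 0 < `|L| + `|alpha| + 1 by rewrite ltr_pwDr// addr_ge0.
  have eta0 : 0 < eta by rewrite divr_gt0.
  have [u [/andP[ua ub] Xu] us] := sup_adherent eta0 supX.
  have us' : u <= s by apply: sup_upper_bound => //; split; rewrite ?ua.
  have := lip u s ua us'; rewrite ler_norml => /andP[_].
  have : L * (s - u) <= `|L| * eta.
    have := ler_norm L; have := normr_ge0 L; have : s - u <= eta by rewrite /s; lra.
    have : 0 <= s - u by rewrite subr_ge0.
    nra.
  have : - alpha * (u - s) <= `|alpha| * eta.
    have := ler_norm alpha; have := normr_ge0 alpha; have : s - u <= eta by rewrite /s; lra.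
    have : 0 <= s - u by rewrite subr_ge0.
    nra.
  have : (`|L| + `|alpha|) * eta <= e.
    rewrite /eta mulrA ler_pdivrMr// mulrC ler_pM2l//; lra.
  lra.
have [sltb|] := ltP s b; last first.
  by move=> bs; have <- : s = b by apply/eqP; rewrite eq_le sb.
have [D Da cv] := der s sa sltb.
have Da' : nbhs D [set x | x < - alpha] by exact: lt_nbhsl.
have /= nr : \forall h \near (0:R)^'+, (phi (s + h) - phi s) / h < - alpha by exact: cv Da'.
suff [h [h0 hb hd]] : exists h, [/\ 0 < h, s + h <= b & (phi (s + h) - phi s) / h < - alpha].
  have : s + h <= s.
    apply: sup_upper_bound => //; split; first by rewrite hb andbT; lra.
    move: hd; rewrite ltr_pdivrMr//; lra.
  by rewrite gerDl leNgt h0.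
have : \forall h \near (0:R)^'+, [/\ 0 < h, s + h <= b & (phi (s + h) - phi s) / h < - alpha].
  near=> h; split.
  - by near: h; exact: nbhs_right_gt.
  - rewrite -lerBrDl; near: h; apply: nbhs_right_le; by rewrite subr_gt0.
  - by near: h.
by move/filter_ex.
Unshelve. all: end_near. Qed.

Lemma dini_attraction phi L alpha t : 0 < alpha -> 0 <= t ->
  (forall s t, 0 <= s -> s <= t -> `|phi t - phi s| <= L * (t - s)) ->
  (forall u, 0 <= u -> 0 < phi u -> exists2 D, D <= - alpha &
      (fun s => (phi (u + s) - phi u) / s) @ 0^'+ --> D) ->
  phi t <= Num.max (phi 0 - alpha * t) 0.
Proof.
move=> al0 t0 lip der; rewrite le_max.
have [_|pt] := leP (phi t) 0; first by rewrite orbT.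
rewrite orbF.
pose Z := [set u | 0 <= u <= t /\ phi u <= 0].
have [Zne|Z0] := pselect (Z !=set0).
  exfalso.
  have supZ : has_sup Z by split=> //; exists t => u [/andP[]].
  pose s := sup Z.
  have [z Zz] := Zne.
  have s0 : 0 <= s.
    by apply: le_trans (sup_upper_bound supZ Zz); case: Zz => /andP[].
  have st : s <= t by apply: ge_sup => // u [/andP[]].
  have L0 : 0 <= L * (t + 1 - t) by apply: le_trans (lip t (t + 1) t0 _); rewrite // lerDl.
  have {}L0 : 0 <= L by move: L0; rewrite addrAC subrr add0r mulr1.
  have Zs : phi s <= 0.
    apply/ler_addgt0Pr => e e0; rewrite add0r.
    have den : 0 < L + 1 by rewrite ltr_wpDl.
    have [u [/andP[ua ub] Zu] us] := sup_adherent (divr_gt0 e0 den) supZ.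
    have us' : u <= s by apply: sup_upper_bound => //; split; rewrite ?ua.
    have := lip u s ua us'; rewrite ler_norml => /andP[_].
    have : L * (s - u) <= L * (e / (L + 1)).
      by rewrite ler_wpM2l//; rewrite /s; lra.
    have : L * (e / (L + 1)) <= e.
      by rewrite mulrCA ler_piMr ?(ltW e0)// ler_pdivrMr// mul1r lerDl.
    lra.
  have slt : s < t by rewrite lt_neqAle st andbT; apply/eqP => sE; move: pt; rewrite -sE ltNge Zs.
  (* After the last zero [s], [phi] is positive and so nonincreasing up to [t]. At [u] the Lipschitz
     bound gives at most [phi t / 2], a contradiction. *)
  pose u := s + Num.min ((t - s) / 2) (phi t / (2 * (L + 1))).
  have den : 0 < 2 * (L + 1) by rewrite mulr_gt0// ltr_wpDl.
  have us : s < u by rewrite ltrDl lt_min !divr_gt0// subr_gt0.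
  have ut : u < t.
    have : u <= s + (t - s) / 2 by rewrite lerD2l ge_min lexx.
    lra.
  have ul : u - s <= phi t / (2 * (L + 1)).
    by rewrite /u addrAC subrr add0r ge_min lexx orbT.
  have := @dini_decrease phi L 0 u t (ltW ut).
  rewrite mul0r subr0.
  have h1 s' t' : u <= s' -> s' <= t' -> `|phi t' - phi s'| <= L * (t' - s').
    by move=> us' s't'; apply: lip => //; apply: le_trans us'; apply: le_trans (ltW us).
  have h2 x : u <= x -> x < t -> exists2 D : R, D < - 0 &
      (fun s => (phi (x + s) - phi x) / s) @ 0^'+ --> D.
    move=> ux xt; have x0 : 0 <= x by apply: le_trans ux; apply: le_trans (ltW us).
    have px : 0 < phi x.
      rewrite ltNge; apply/negP => px.
      have : x <= s by apply: sup_upper_bound => //; split; rewrite ?x0 ?(ltW xt).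
      by rewrite leNgt (lt_le_trans us ux).
    have [D Da cv] := der x x0 px; exists D => //.
    by rewrite oppr0 (le_lt_trans Da)// oppr_lt0.
  move/(_ h1 h2).
  have := lip s u s0 (ltW us); rewrite ler_norml => /andP[_].
  have : L * (u - s) <= phi t / 2.
    apply: le_trans (ler_wpM2l L0 ul) _.
    have -> : phi t / (2 * (L + 1)) = phi t / 2 / (L + 1) by rewrite invfM mulrA.
    rewrite mulrCA ler_piMr//; first by rewrite divr_ge0// ltW.
    by rewrite ler_pdivrMr ?ltr_wpDl// mul1r lerDl.
  lra.
apply/ler_addgt0Pr => e e0.
(* [dini_decrease] wants a strict slope; the loss over [[0, t]] is at most [e]. *)
pose al' := alpha - e / (t + 1).
have t1 : 0 < t + 1 by rewrite ltr_wpDl.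
have al'a : al' < alpha by rewrite /al' ltrBlDr ltrDl divr_gt0.
have := @dini_decrease phi L al' 0 t t0 lip; rewrite subr0 => h.
have {}h : phi t <= phi 0 - al' * t.
  apply: h => u u0 ut.
  have pu : 0 < phi u.
    by rewrite ltNge; apply/negP => pu; apply: Z0; exists u; split=> //; rewrite u0 (ltW ut).
  by have [D Da cv] := der u u0 pu; exists D => //; rewrite (le_lt_trans Da)// ltrN2.
have : e / (t + 1) * t <= e.
  by rewrite mulrAC ler_pdivrMr// ler_pM2l// lerDl.
move: h; rewrite /al'; lra.
Qed.

End Dini.

(** * Comparison of an MW queue with a fluid solution *)

Section MaxWeightWindow.
Variables (R : realType) (n : nat) (Rm : 'M[R]_n) (S : seq 'cV[R]_n).
Hypothesis net : network_ok Rm S.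
Variable lam : 'cV[R]_n.
Hypotheses (lam0 : nonneg lam) (S0 : S != [::]).
Local Notation e1 := (ones R n).

Lemma pl_fluid_solution q : pl_fluid Rm S lam q -> fluid_solution Rm S e1 lam q.
Proof.
move=> [q0 [C [C0 qlip]] [E qE]]; split=> //; split.
  move=> i t t0 e e0; have C1 : 0 < C + 1 by rewrite ltr_wpDl.
  exists (e / (C + 1)); first by rewrite divr_gt0.
  move=> k u v uv _ sd.
  apply: (@le_lt_trans _ _ (C * \sum_j (v j - u j))).
    rewrite mulr_sumr; apply: ler_sum => j _; have [? [? ?]] := uv j.
    exact: qlip.
  move: sd; rewrite ltr_pdivlMr// => sd; apply: le_lt_trans sd.
  rewrite mulrC ler_wpM2l ?lerDl//; apply: sumr_ge0 => j _.
  by have [_ [? _]] := uv j; rewrite subr_ge0.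
have /choice [s sP] : forall t, exists s : 'cV[R]_n -> R, 0 < t -> t \notin E ->
    [/\ forall mu, 0 <= s mu,
        \sum_(mu <- undup S) s mu = 1,
        forall mu, mu \in S -> s mu != 0 -> wmw_choice Rm S e1 (q t) mu &
        forall i, is_derive t 1 (fun u => q u i 0)
          (veloc Rm lam (\sum_(mu <- undup S) s mu *: mu) i 0)].
  move=> t; have [/andP[t0 tE]|tE] := boolP ((0 < t) && (t \notin E)); last first.
    by exists (fun=> 0) => t0 tE'; rewrite t0 tE' in tE.
  have [m [s [s0 s1 sm smax]] [e e0 eP]] := qE _ t0 tE.
  exists s => _ _; split=> // i; apply: local_affine_is_derive.
  by exists e => // u ue; rewrite eP// mxE [X in _ + X]mxE sm.
pose ok t := (0 < t) && (t \notin E).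
exists (fun mu t => if ok t && (mu \in S) then s t mu else 0), (fun _ => 0).
split; [|split].
- move=> mu t _; case: ifP; rewrite ?lexx ?ler01// => /andP[/andP[t0 tE] muS].
  have [s0 s1 _ _] := sP t t0 tE.
  by rewrite s0 (hull_weight_le1 s0 s1).
- by move=> t _ i; rewrite mxE.
exists [set` E]; split.
- apply: countable_measurable; last by apply: finite_set_countable; exact: finite_seq.
  by move=> t; exact: measurable_set1.
- by apply: countable_lebesgue_measure0; apply: finite_set_countable; exact: finite_seq.
move=> t /= nP; apply: contrapT => /negP tE; apply: nP => t0.
have okt : ok t by rewrite /ok t0.
have [s0 s1 smax sd] := sP t t0 tE.
have sumE (V : lmodType R) (F : 'cV[R]_n -> V) :
    \sum_(mu <- undup S) (if ok t && (mu \in S) then s t mu else 0) *: F mu =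
    \sum_(mu <- undup S) s t mu *: F mu.
  rewrite big_seq [RHS]big_seq; apply: eq_bigr => mu.
  by rewrite mem_undup okt => ->.
split; [|split; [|split; [|split; [|split]]]].
- by move=> i; have := sd i => -[].
- move=> i; rewrite derive1E; have := sd i => -[_ ->].
  by rewrite sumE subr0 /veloc -(opprB 1%:M Rm) mulNmx.
- by rewrite -s1 big_seq [RHS]big_seq; apply: eq_bigr => mu; rewrite mem_undup okt => ->.
- move=> i; rewrite sumE mxE; apply: (hull_nonneg net (L := undup S)).
    by move=> mu; rewrite mem_undup.
  by exists (s t).
- by move=> i _; rewrite mxE.
- move=> mu muS nmax; rewrite okt muS /=; apply/eqP/negPn/negP => smu.
  by apply: nmax; exact: smax.
Qed.

Lemma mw_distance_bound (C alpha : R) (A Q : nat -> 'cV[R]_n) :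
  sensitivity_const Rm S C -> attraction_const Rm S lam alpha ->
  invariant_states Rm S e1 lam !=set0 ->
  wmw_path Rm S e1 A Q -> (forall t, nonneg (A t)) -> nonneg (Q 0%N) ->
  forall k : nat, dist_set (Q k) (invariant_states Rm S e1 lam) <=
    Num.max (dist_set (Q 0%N) (invariant_states Rm S e1 lam) - alpha * k%:R) 0 +
    C * (1 + norm2 lam + max_dev A lam k).
Proof.
move=> [C0 sens] [al0 attr]; set I := invariant_states _ _ _ _ => Ine path A0 Q0 k.
have [q plq q0] := pl_fluid_exists net lam0 S0 Q0.
have fq := pl_fluid_solution plq.
have qQ := sens A lam Q q A0 lam0 Q0 path fq q0 k.
apply: le_trans (dist_set_lip _ (q k%:R) Ine) _; rewrite lerD//.
rewrite -q0.
have [_ [L [L0 qlip]] _] := plq.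
apply: (@dini_attraction R (fun t => dist_set (q t) I) (n%:R * L)) => //.
  move=> s t s0 st.
  have nlip : norm2 (q t - q s) <= n%:R * L * (t - s).
    rewrite -mulrA; apply: norm2_le_coord; first by rewrite mulr_ge0// subr_ge0.
    by move=> i; rewrite !mxE; exact: qlip.
  apply: le_trans nlip; rewrite ler_norml; apply/andP; split.
    have := dist_set_lip (q s) (q t) Ine; rewrite norm2_distC; lra.
  have := dist_set_lip (q t) (q s) Ine; lra.
move=> u u0 du; apply: attr => // Iu.
by move: du; rewrite dist_set_self// ltxx.
Qed.

End MaxWeightWindow.

(** * Measurability and stationarity *)

Section Floor.
Variable R : realType.
Implicit Types x y : R.

Lemma absz_floor x : 0 <= x -> `|Num.floor x|%N = Num.trunc x.
Proof. by move=> x0; rewrite truncn_floor x0. Qed.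

Lemma absz_floor_le x : 0 <= x -> (`|Num.floor x|%N)%:R <= x.
Proof. by move=> x0; rewrite absz_floor// truncn_le. Qed.

Lemma absz_floor_gt x : 0 <= x -> x < (`|Num.floor x|%N).+1%:R.
Proof. by move=> x0; rewrite absz_floor//; have /andP[] := truncn_itv x0. Qed.

Lemma absz_floor_nat (k : nat) : `|Num.floor (k%:R : R)|%N = k.
Proof. by rewrite absz_floor// natrK. Qed.

Lemma absz_floor_mono x y : 0 <= x -> x <= y -> (`|Num.floor x| <= `|Num.floor y|)%N.
Proof.
move=> x0 xy; have y0 := le_trans x0 xy; rewrite -ltnS -(ltr_nat R).
exact: le_lt_trans (le_trans (absz_floor_le x0) xy) (absz_floor_gt y0).
Qed.

End Floor.

Section MeasurableNorm.
Variables (R : realType) (n : nat) (d : measure_display) (T : measurableType d).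
Implicit Types (X : T -> 'cV[R]_n).

Lemma measurable_fun_lt_cst (f : T -> R) (c : R) : measurable_fun setT f ->
  measurable [set om | f om < c].
Proof.
move=> mf; rewrite (_ : mkset _ = setT `&` f @^-1` `]-oo, c[%classic); first exact: mf.
by rewrite setTI; apply/seteqP; split=> om /=; rewrite in_itv.
Qed.

Lemma measurable_fun_gt_cst (f : T -> R) (c : R) : measurable_fun setT f ->
  measurable [set om | c < f om].
Proof.
move=> mf; rewrite (_ : mkset _ = setT `&` f @^-1` `]c, +oo[%classic); first exact: mf.
by rewrite setTI; apply/seteqP; split=> om /=; rewrite in_itv /= andbT.
Qed.

Lemma measurable_norm2 X : (forall i, measurable_fun setT (fun om => X om i 0)) ->
  measurable_fun setT (fun om => norm2 (X om)).
Proof.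
move=> mX; apply: (measurableT_comp (f := @Num.sqrt R)).
  exact: continuous_measurable_fun (@sqrt_continuous R).
by apply: measurable_sum => i; exact: measurable_funX.
Qed.

Lemma measurable_bigmax (F : nat -> T -> R) k : (forall t, measurable_fun setT (F t)) ->
  measurable_fun setT (fun om => \big[Num.max/0]_(t < k) F t om).
Proof.
elim: k F => [|k IH] F mF.
  rewrite (_ : (fun _ => _) = cst 0); first exact: measurable_cst.
  by apply/funext => om; rewrite big_ord0.
rewrite (_ : (fun _ => _) = F 0%N \max (fun om => \big[Num.max/0]_(t < k) F t.+1 om)).
  by apply: measurable_maxr => //; exact: (IH (fun t => F t.+1)).
by apply/funext => om; rewrite big_ord_recl.
Qed.

Lemma measurable_max_dev (A : nat -> T -> 'cV[R]_n) lam k :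
  (forall t i, measurable_fun setT (fun om => A t om i 0)) ->
  measurable_fun setT (fun om => max_dev (A^~ om) lam k).
Proof.
move=> mA.
apply: (@measurable_bigmax (fun t om => norm2 (\sum_(tau < t.+1) (A tau om - lam)))) => t.
apply: measurable_norm2 => i.
rewrite (_ : (fun _ => _) = (fun om => \sum_(tau < t.+1) (A tau om i 0 - lam i 0))).
  by apply: measurable_sum => tau; apply: measurable_funB => //; exact: measurable_cst.
by apply/funext => om; rewrite summxE; apply: eq_bigr => tau _; rewrite !mxE.
Qed.

Lemma rat_col_dense (x : 'cV[R]_n) (e : R) : 0 < e ->
  exists z : 'cV[rat]_n, norm2 (x - map_mx ratr z) < e.
Proof.
move=> e0; have e1 : 0 < e / n.+1%:R by rewrite divr_gt0.
have /choice [z zP] : forall i : 'I_n, exists q : rat, `|x i 0 - ratr q| <= e / n.+1%:R.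
  move=> i; have [|q] := @rat_in_itvoo R (x i 0 - e / n.+1%:R) (x i 0); first by rewrite ltrBlDr ltrDl.
  rewrite in_itv /= => /andP[q1 q2]; exists q.
  rewrite ger0_norm; last by rewrite subr_ge0 ltW.
  by rewrite lerBlDr -lerBlDl ltW.
exists (\col_i z i).
apply: le_lt_trans (norm2_le_coord (ltW e1) _) _; first by move=> i; rewrite !mxE.
by rewrite mulrCA gtr_pMr// ltr_pdivrMr// mul1r ltr_nat.
Qed.

(** The distance is 1-Lipschitz, so exceeding [a] is witnessed by a rational point near [X om]; this
    replaces an infimum over an arbitrary set by a countable union. *)
Lemma measurable_dist_set_gt X (I : set 'cV[R]_n) (a : R) : I !=set0 ->
  (forall i, measurable_fun setT (fun om => X om i 0)) ->
  measurable [set om | a < dist_set (X om) I].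
Proof.
move=> I0 mX.
rewrite (_ : mkset _ = \bigcup_(z : 'cV[rat]_n)
    [set om | norm2 (X om - map_mx ratr z) < dist_set (map_mx ratr z) I - a]).
  apply: countable_bigcupT_measurable => [|z]; first exact: countableP.
  have mN : measurable_fun setT (fun om => norm2 (X om - map_mx ratr z)).
    apply: measurable_norm2 => i.
    rewrite (_ : (fun _ => _) = (fun om => X om i 0 - (map_mx ratr z) i 0)).
      by apply: measurable_funB => //; exact: measurable_cst.
    by apply/funext => om; rewrite !mxE.
  exact: (measurable_fun_lt_cst _ mN).
apply/seteqP; split=> om /=.
  move=> aX; have e0 : 0 < (dist_set (X om) I - a) / 2 by rewrite divr_gt0// subr_gt0.
  have [z zP] := rat_col_dense (X om) e0; exists z => //=.
  have := dist_set_lip (X om) (map_mx ratr z) I0; lra.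
move=> [z _ /=]; have := dist_set_lip (map_mx ratr z) (X om) I0.
by rewrite norm2_distC; lra.
Qed.

End MeasurableNorm.

(** * Shift invariance for events beyond rectangles *)

Section Stationarity.
Variables (R : realType) (n : nat) (d : measure_display) (T : measurableType d).
Variable P : probability T R.

(** Dynkin's argument, with measurability of both preimages carried along with the equality of
    laws. *)
Lemma pi_system_law_eq (X : Type) (G : set (set X)) (a b : T -> X) : setI_closed G ->
  (forall E, G E -> [/\ measurable (a @^-1` E), measurable (b @^-1` E) &
     P (a @^-1` E) = P (b @^-1` E)]) ->
  forall E, <<s G >> E -> [/\ measurable (a @^-1` E), measurable (b @^-1` E) &
     P (a @^-1` E) = P (b @^-1` E)].
Proof.
move=> GI GH.
apply: (lambda_system_subset GI _ GH) => //.
apply/dynkin_lambda_system; split.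
- by rewrite !preimage_setT.
- move=> E [ma mb ab].
  have -> : a @^-1` (~` E) = ~` (a @^-1` E) by [].
  have -> : b @^-1` (~` E) = ~` (b @^-1` E) by [].
  split; [exact: measurableC..|].
  by rewrite !probability_setC// ab.
- move=> F tF HF.
  have tpre (c : T -> X) : trivIset setT (fun k => c @^-1` F k).
    apply/trivIsetP => i j _ _ ij; rewrite -preimage_setI.
    by move/trivIsetP : tF => /(_ _ _ _ _ ij) ->//; rewrite preimage_set0.
  have -> : a @^-1` (\bigcup_k F k) = \bigcup_k (a @^-1` F k) by rewrite preimage_bigcup.
  have -> : b @^-1` (\bigcup_k F k) = \bigcup_k (b @^-1` F k) by rewrite preimage_bigcup.
  split.
  + by apply: bigcupT_measurable => k; have [] := HF k.
  + by apply: bigcupT_measurable => k; have [] := HF k.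
  + rewrite (measure_bigcup P setT (fun k => a @^-1` F k)); [|by move=> k _; have [] := HF k|exact: tpre].
    rewrite (measure_bigcup P setT (fun k => b @^-1` F k)); [|by move=> k _; have [] := HF k|exact: tpre].
    by apply: eq_eseriesr => k _; have [] := HF k.
Qed.

Definition cylinder (B : nat -> 'I_n -> set R) (m : nat) : set (nat -> 'cV[R]_n) :=
  [set a | forall t i, (t < m)%N -> B t i (a t i 0)].

Definition cylinders : set (set (nat -> 'cV[R]_n)) :=
  [set E | exists B m, (forall t i, measurable (B t i)) /\ E = cylinder B m].

Lemma cylinders_setI : setI_closed cylinders.
Proof.
move=> _ _ [B [m [mB ->]]] [B' [m' [mB' ->]]].
exists (fun t i => (if (t < m)%N then B t i else setT) `&` (if (t < m')%N then B' t i else setT)).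
exists (maxn m m'); split.
  by move=> t i; apply: measurableI; case: ifP.
apply/seteqP; split=> a.
  move=> [h h'] t i _; split; case: ifP => // tm; [exact: h|exact: h'].
move=> h; split=> t i tm; have := h t i.
  by rewrite leq_max tm => /(_ isT)[].
by rewrite leq_max tm orbT => /(_ isT)[_].
Qed.

Lemma measurable_cylinder (A : nat -> T -> 'cV[R]_n) B m :
  (forall t i, measurable_fun setT (fun om => A t om i 0)) ->
  (forall t i, measurable (B t i)) ->
  measurable ((fun om t => A t om) @^-1` cylinder B m).
Proof.
move=> mA mB.
rewrite (_ : _ @^-1` _ = \bigcap_t \bigcap_(i : 'I_n)
   (if (t < m)%N then (fun om => A t om i 0) @^-1` B t i else setT)).
  apply: bigcapT_measurable => t.
  apply: fin_bigcap_measurable => [|i _]; first exact: finite_finset.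
  by case: ifP => // _; rewrite -[X in measurable X]setTI; exact: mA.
apply/seteqP; split=> om /=.
  by move=> h t _ i _; case: ifP => // tm; exact: h.
by move=> h t i tm; have := h t Logic.I i Logic.I; rewrite tm.
Qed.

(** [stationary] speaks of Borel rectangles only. They form a pi-system, and the event about
    [max_dev] lies in the sigma-algebra they generate on path space. *)
Lemma stationary_max_dev (A : nat -> T -> 'cV[R]_n) lam (k m : nat) (c : R) :
  arrival_process A -> stationary P A ->
  measurable [set om | c < max_dev (fun t => A (k + t)%N om) lam m] /\
  P [set om | c < max_dev (fun t => A (k + t)%N om) lam m] =
  P [set om | c < max_dev (A^~ om) lam m].
Proof.
move=> [mA _] stat.
pose Path := g_sigma_algebraType cylinders.
pose E : set Path := [set a | c < max_dev a lam m].
have mE : <<s cylinders >> E.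
  have mcoord t i : measurable_fun setT (fun a : Path => a t i 0).
    move=> _ B mB; rewrite setTI; apply: sub_sigma_algebra.
    exists (fun t' i' => if (t' == t) && (i' == i) then B else setT), t.+1; split.
      by move=> t' i'; case: ifP.
    apply/seteqP; split=> a /=.
      by move=> Ba t' i' _; case: ifP => // /andP[/eqP-> /eqP->].
    by move=> h; have := h t i (ltnSn t); rewrite !eqxx.
  have := @measurable_max_dev R n _ Path (fun t a => a t) lam m mcoord.
  exact: measurable_fun_gt_cst.
have := @pi_system_law_eq _ cylinders (fun om t => A (k + t)%N om) (fun om t => A t om)
  cylinders_setI _ _ mE.
case=> [_ [B [m' [mB ->]]]|? _ ?]; last by [].
split.
- exact: (@measurable_cylinder (fun t => A (k + t)%N)).
- exact: measurable_cylinder.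
have := stat k m' B mB.
rewrite (_ : [set om | _] = (fun om t => A (k + t)%N om) @^-1` cylinder B m')//.
by apply/seteqP; split=> om /= h t i tm; have := h t i tm; rewrite addnC.
Qed.

End Stationarity.

(** * The exit event and the union bound *)

Section FarEvent.
Variables (R : realType) (n : nat).

(** The scaled path is a step function, so the supremum runs over finitely many values; step [k] is
    reached at time [k / g r]. *)
Lemma far_eventP (d : measure_display) (Om : measurableType d) (g : nat -> R) (r : nat)
    (Q : nat -> Om -> 'cV[R]_n) (I : set 'cV[R]_n) (Tend delta : R) om :
  0 < g r -> 0 <= Tend ->
  far_event g r Q I Tend delta om <->
  exists2 k, (k <= `|Num.floor (g r * Tend)|)%N & delta < dist_set ((r%:R)^-1 *: Q k om) I.
Proof.
move=> g0 T0; rewrite /far_event /=; set D := [set _ | _ in _].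
pose M := `|Num.floor (g r * Tend)|%N.
have T0' : 0 <= g r * Tend by rewrite mulr_ge0// ltW.
have DE x : D x <-> exists2 k, (k <= M)%N & x = dist_set ((r%:R)^-1 *: Q k om) I.
  split=> [[t] /=|[k kM ->]].
    rewrite in_itv /= => /andP[t0 tT] <-; exists `|Num.floor (g r * t)|%N => //.
    by apply: absz_floor_mono; rewrite ?mulr_ge0 ?ler_pM2l// ltW.
  exists (k%:R / g r) => /=; last first.
    by rewrite /scaled mulrCA divff ?gt_eqF// mulr1 absz_floor_nat.
  rewrite in_itv /= divr_ge0 ?(ltW g0)//= ler_pdivrMr// mulrC.
  by rewrite (le_trans _ (absz_floor_le T0'))// ler_nat.
have D0 : D !=set0.
  by exists (dist_set ((r%:R)^-1 *: Q 0%N om) I); apply/DE; exists 0%N.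
split=> [/(sup_gt D0)[x /DE[k kM ->] dx]|[k kM dk]]; first by exists k.
apply: lt_le_trans dk _; apply: sup_upper_bound; last by apply/DE; exists k.
split=> //; exists (\sum_(l < M.+1) dist_set ((r%:R)^-1 *: Q l om) I) => x /DE[l lM ->].
rewrite (bigD1 (Ordinal (lM : (l < M.+1)%N)))//= lerDl.
by apply: sumr_ge0 => j _; exact: dist_set_ge0.
Qed.

Lemma measurable_far_event (d : measure_display) (Om : measurableType d) (g : nat -> R) (r : nat)
    (Q : nat -> Om -> 'cV[R]_n) (I : set 'cV[R]_n) (Tend delta : R) :
  I !=set0 -> 0 < g r -> 0 <= Tend ->
  (forall t i, measurable_fun setT (fun om => Q t om i 0)) ->
  measurable (far_event g r Q I Tend delta).
Proof.
move=> I0 g0 T0 mQ.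
rewrite (_ : far_event _ _ _ _ _ _ = \bigcup_(k in `I_(`|Num.floor (g r * Tend)|%N).+1)
   [set om | delta < dist_set ((r%:R)^-1 *: Q k om) I]).
  apply: fin_bigcup_measurable => [|k _]; first exact: finite_II.
  apply: measurable_dist_set_gt => // i.
  rewrite (_ : (fun _ => _) = (fun om => (r%:R)^-1 * Q k om i 0)).
    by apply: measurable_funM => //; exact: measurable_cst.
  by apply/funext => om; rewrite mxE.
apply/seteqP; split=> om.
  by move/(far_eventP _ _ _ _ g0 T0) => [k kM dk]; exists k.
by move=> [k kM dk]; apply/far_eventP => //; exists k.
Qed.

(** Union bound over windows starting at multiples of [h], all equally likely to be bad by
    stationarity. The spacing [h] may be shorter than [r], which allows overlap. *)
Lemma far_event_prob_le (d : measure_display) (Om : measurableType d) (P : probability Om R)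
    (g : nat -> R) (r h : nat) (A Q : nat -> Om -> 'cV[R]_n) (I : set 'cV[R]_n)
    (lamr : 'cV[R]_n) (Tend delta e : R) :
  I !=set0 -> 0 < g r -> 0 <= Tend -> (0 < r)%N ->
  (forall t i, measurable_fun setT (fun om => Q t om i 0)) ->
  arrival_process A -> stationary P A ->
  (forall om, (forall j, max_dev (fun t => A (j * h + t)%N om) lamr r.+1 <= e * r%:R \/
       (`|Num.floor (g r * Tend)| < j * h)%N) ->
     forall k, (k <= `|Num.floor (g r * Tend)|)%N -> dist_set ((r%:R)^-1 *: Q k om) I <= delta) ->
  (0 < h)%N ->
  fine (P (far_event g r Q I Tend delta)) <=
  (`|Num.floor (g r * Tend)| %/ h).+1%:R *
    fine (P [set om | (r%:R)^-1 * max_dev (A ^~ om) lamr r.+1 > e]).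
Proof.
move=> I0 g0 T0 r0 mQ arrA statA good h0.
set M := `|Num.floor (g r * Tend)|%N.
have badE (a : nat -> 'cV[R]_n) : (e < (r%:R)^-1 * max_dev a lamr r.+1) =
    (e * r%:R < max_dev a lamr r.+1).
  by rewrite mulrC ltr_pdivlMr// ltr0n.
have -> : [set om | e < (r%:R)^-1 * max_dev (A^~ om) lamr r.+1] =
    [set om | e * r%:R < max_dev (A^~ om) lamr r.+1].
  by apply/seteqP; split=> om /=; rewrite badE.
pose bad j := [set om | e * r%:R < max_dev (fun t => A (j * h + t)%N om) lamr r.+1].
have sm j := stationary_max_dev lamr (j * h)%N r.+1 (e * r%:R) arrA statA.
have mfar := measurable_far_event delta I0 g0 T0 mQ.
have : (P (far_event g r Q I Tend delta) <= \sum_(j < (M %/ h).+1) P (bad j))%E.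
  apply: (@content_subadditive _ _ _ P _ bad) => //.
    by move=> j _; exact: (sm j).1.
  move=> om /(far_eventP _ _ _ _ g0 T0)[k kM dk].
  apply: contrapT => nb.
  move: dk; rewrite ltNge => /negP; apply; apply: good => // j.
  have [jM|jM] := leqP (j * h) M; last by right.
  left; rewrite leNgt; apply/negP => jb; apply: nb.
  rewrite -bigcup_mkord; exists j => //=.
  by rewrite ltnS leq_divRL.
rewrite (eq_bigr (fun=> P [set om | e * r%:R < max_dev (A^~ om) lamr r.+1])); last first.
  by move=> j _; exact: (sm j).2.
have finP E : measurable E -> P E = (fine (P E))%:E.
  by move=> mE; rewrite fineK// fin_num_measure.
have m0 : measurable [set om | e * r%:R < max_dev (A^~ om) lamr r.+1].
  by have [] := stationary_max_dev lamr 0%N r.+1 (e * r%:R) arrA statA.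
rewrite (finP _ m0) (finP _ mfar) sumEFin lee_fin sumr_const card_ord.
by rewrite mulr_natl.
Qed.

End FarEvent.

Section Asymptotics.
Variable R : realType.

Lemma limn_einf_gt0_near (u : nat -> R) : (0 < limn_einf (fun r => (u r)%:E))%E ->
  exists2 c : R, 0 < c & \forall r \near \oo, c <= u r.
Proof.
rewrite limn_einf_lim (cvg_lim _ (@cvg_einfs_sup _ _))// => /ereal_sup_gt[_ [m _ <-]] /= m0.
have inf_le k : (m <= k)%N -> (ereal_inf (sdrop (fun r => (u r)%:E) m) <= (u k)%:E)%E.
  by move=> mk; apply: ereal_inf_lbound; exists k.
have {}m0 : (0 < ereal_inf (sdrop (fun r => (u r)%:E) m))%E := m0.
move: (ereal_inf (sdrop (fun r => (u r)%:E) m)) m0 inf_le => [c| |] //.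
  rewrite lte_fin => c0 h; by exists c => //; exists m.
by move=> _ h; have := h m (leqnn m); rewrite leye_eq.
Qed.

(** [r / g r] times the number of windows is at most [4 * Tend + c^-1]; the condition [r <= 4 * h r]
    covers both disjoint and quarter-spaced windows. *)
Lemma far_prob_cvg (f : nat -> R) (g : nat -> R) (h : nat -> nat) (F p : nat -> R) (Tend : R) :
  0 <= Tend -> (forall r, 0 <= f r) -> (forall r, 0 <= p r) -> (forall r, 0 <= F r) ->
  (exists2 c : R, 0 < c & \forall r \near \oo, c <= g r / r%:R) ->
  (forall r, (0 < h r)%N /\ (r <= 4 * h r)%N) ->
  (\forall r \near \oo, F r <= (`|Num.floor (g r * Tend)| %/ h r).+1%:R * p r) ->
  (fun r => f r * p r) @ \oo --> (0 : R) ->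
  (fun r => r%:R * f r / g r * F r) @ \oo --> (0 : R).
Proof.
move=> T0 f0 p0 F0 [c c0 gc] hh FF fp.
have fp' : (fun r => (4 * Tend + c^-1) * (f r * p r)) @ \oo --> (0 : R).
  by rewrite -(mulr0 (4 * Tend + c^-1)); apply: cvgMl_tmp fp.
apply: squeeze_cvgr (cvg_cst 0) fp'.
near=> r.
have r0 : (0 < r)%N by near: r; exact: nbhs_infty_gt.
have r0R : 0 < r%:R :> R by rewrite ltr0n.
have gcr : c <= g r / r%:R by near: r.
have gcr' : c * r%:R <= g r by rewrite -ler_pdivlMr.
have g0 : 0 < g r by rewrite (lt_le_trans _ gcr')// mulr_gt0.
have Fr : F r <= (`|Num.floor (g r * Tend)| %/ h r).+1%:R * p r by near: r.
have [h0 rh] := hh r.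
have h0R : 0 < (h r)%:R :> R by rewrite ltr0n.
have rg0 : 0 <= r%:R * f r / g r by rewrite divr_ge0 ?mulr_ge0// ltW.
apply/andP; split; first by rewrite mulr_ge0.
apply: le_trans (ler_wpM2l rg0 Fr) _.
have K1 : (`|Num.floor (g r * Tend)| %/ h r)%:R <= g r * Tend / (h r)%:R.
  rewrite ler_pdivlMr// -natrM.
  apply: le_trans (absz_floor_le _); last by rewrite mulr_ge0// ltW.
  by rewrite ler_nat leq_divM.
have K2 : g r * Tend / (h r)%:R <= g r * Tend * 4 / r%:R.
  rewrite -!mulrA ler_wpM2l ?(ltW g0)// ler_wpM2l// ler_pdivlMr// mulrC ler_pdivrMr//.
  by rewrite -natrM ler_nat.
rewrite -natr1.
have -> : r%:R * f r / g r * (((`|Num.floor (g r * Tend)| %/ h r)%:R + 1) * p r) =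
   (r%:R / g r * ((`|Num.floor (g r * Tend)| %/ h r)%:R + 1)) * (f r * p r) by ring.
rewrite ler_wpM2r ?mulr_ge0//.
rewrite mulrDr mulr1 lerD//.
  apply: (@le_trans _ _ (r%:R / g r * (g r * Tend * 4 / r%:R))).
    by rewrite ler_wpM2l ?(le_trans K1)// divr_ge0// ltW.
  have -> : r%:R / g r * (g r * Tend * 4 / r%:R) = (r%:R / r%:R) * (g r / g r) * (4 * Tend).
    by ring.
  by rewrite !divff ?gt_eqF// !mul1r.
by rewrite ler_pdivrMr// -ler_pdivrMl ?invr_gt0// invrK.
Unshelve. all: end_near. Qed.

End Asymptotics.

(** * Upper bounds *)

Section UpperBound.
Variables (R : realType) (n : nat).
Implicit Types (lam : 'cV[R]_n) (A Q : nat -> 'cV[R]_n).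

Lemma max_dev_ge0 A lam k : 0 <= max_dev A lam k.
Proof. by apply/bigmax_geP; left. Qed.

Lemma cumdev_le_max_dev A lam lam' l m : (l <= m)%N ->
  norm2 (cumdev lam A l) <= max_dev A lam' m + l%:R * norm2 (lam' - lam).
Proof.
case: l => [|l] lm.
  by rewrite /cumdev big_ord0 norm2_0 mul0r addr0 max_dev_ge0.
have -> : cumdev lam A l.+1 = \sum_(t < l.+1) (A t - lam') + l.+1%:R *: (lam' - lam).
  rewrite scaler_nat -[X in _ *+ X]card_ord -sumr_const -big_split /=.
  by apply: eq_bigr => t _; rewrite addrA subrK.
apply: le_trans (norm2D _ _) _; rewrite norm2Z normr_nat lerD2r.
by apply/bigmax_geP; right; exists (Ordinal lm).
Qed.

Lemma max_dev_change A lam lam' k m : (k <= m)%N ->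
  max_dev A lam k <= max_dev A lam' m + m%:R * norm2 (lam' - lam).
Proof.
move=> km; apply/bigmax_leP; split=> [|t _].
  by rewrite addr_ge0 ?max_dev_ge0// mulr_ge0// norm2_ge0.
have tm : (t < m)%N by exact: leq_trans km.
apply: le_trans (@cumdev_le_max_dev A lam lam' t.+1 m tm) _.
by rewrite lerD2l ler_wpM2r ?norm2_ge0// ler_nat.
Qed.

Lemma norm2_cvg (lamr : nat -> 'cV[R]_n) lam (e : R) : 0 < e ->
  (forall i, (fun r => lamr r i 0) @ \oo --> lam i 0) ->
  \forall r \near \oo, norm2 (lamr r - lam) <= e.
Proof.
move=> e0 cv; have e1 : 0 < e / n.+1%:R by rewrite divr_gt0.
have : \forall r \near \oo, forall i : 'I_n, `|lam i 0 - lamr r i 0| < e / n.+1%:R.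
  by apply: filter_forall => i; move/cvgrPdist_lt : (cv i) => /(_ _ e1).
apply: filterS => r h.
apply: (@le_trans _ _ (n%:R * (e / n.+1%:R))).
  by apply: norm2_le_coord (ltW e1) _ => i; rewrite !mxE distrC ltW.
by rewrite mulrCA ger_pMr// ler_pdivrMr// mul1r ler_nat.
Qed.

Variables (Rm : 'M[R]_n) (S : seq 'cV[R]_n).
Hypothesis net : network_ok Rm S.
Variables w lam rho : 'cV[R]_n.
Hypotheses (w0 : pos_weights w) (hrho : hull (undup S) rho)
  (lamE : lam = (1%:M - Rm) *m rho) (lam0 : nonneg lam).
Local Notation I := (invariant_states Rm S w lam).

Lemma invariant_statesE : I = inv_cone Rm S w lam.
Proof.
apply/seteqP; split; first exact: invariant_states_sub_cone.
exact: cone_sub_invariant_states hrho lamE.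
Qed.

Lemma invariant_states_neq0 : I !=set0.
Proof. by rewrite invariant_statesE; exact: inv_cone_neq0. Qed.

Lemma invariant_states_scale x (a : R) : 0 < a ->
  dist_set (a *: x) I = a * dist_set x I.
Proof.
move=> a0; apply: dist_setZ => //; first exact: invariant_states_neq0.
by rewrite invariant_statesE => b y b0; apply: inv_coneZ; exact: ltW.
Qed.

Lemma windows_stay_close (delta : R) : 0 < delta -> exists d' e r0 : R,
  [/\ 0 < d', 0 < e & forall A Q (r : nat) M (lamr : 'cV[R]_n),
    wmw_path Rm S w A Q -> (forall t, nonneg (A t)) -> nonneg (Q 0%N) ->
    r0 <= r%:R -> (0 < r)%N -> norm2 (lamr - lam) <= e ->
    dist_set (Q 0%N) I <= d' * r%:R ->
    (forall j, max_dev (fun t => A (j * r + t)%N) lamr r.+1 <= e * r%:R \/ (M < j * r)%N) ->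
    forall k, (k <= M)%N -> dist_set (Q k) I <= delta * r%:R].
Proof.
move=> del0; rewrite invariant_statesE.
have [d' [e [r0 [d'0 d'd e0 ret]]]] := window_return net w0 hrho lamE del0.
(* Half of [e] is for the deviation from [lamr], half for replacing [lamr] by [lam]. *)
exists d', (e / 2), r0; split=> //; first by rewrite divr_gt0.
move=> A Q r M lamr path A0 Q0 rr0 r_gt0 lamre dQ good.
have Qnn := wmw_path_nonneg net path A0 Q0.
have step j : (j * r <= M)%N -> dist_set (Q (j * r)%N) (inv_cone Rm S w lam) <= d' * r%:R ->
   (forall k, (k <= r)%N -> dist_set (Q (j * r + k)%N) (inv_cone Rm S w lam) <= delta * r%:R) /\
    dist_set (Q (j.+1 * r)%N) (inv_cone Rm S w lam) <= d' * r%:R.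
  move=> jM dj.
  have path' : wmw_path Rm S w (fun t => A (j * r + t)%N) (fun t => Q (j * r + t)%N).
    by move=> t; have := path (j * r + t)%N; rewrite addnS.
  rewrite mulSn addnC.
  apply: (ret _ _ path') => //; first by rewrite addn0.
  move=> l lr; apply: le_trans (@cumdev_le_max_dev _ lam lamr l r.+1 (leqW lr)) _.
  have [gj|] := good j; last by rewrite ltnNge jM.
  have : l%:R * norm2 (lamr - lam) <= r%:R * (e / 2).
    by rewrite ler_pM// ?norm2_ge0// ler_nat.
  lra.
have starts j : (j * r <= M)%N -> dist_set (Q (j * r)%N) (inv_cone Rm S w lam) <= d' * r%:R.
  elim: j => [|j IH]; first by rewrite mul0n.
  move=> jM; have jM' : (j * r <= M)%N by apply: leq_trans jM; rewrite leq_mul2r leqnSn orbT.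
  exact: (step j jM' (IH jM')).2.
move=> k kM; rewrite (divn_eq k r).
have jM : (k %/ r * r <= M)%N by apply: leq_trans kM; exact: leq_divM.
by apply: (step _ jM (starts _ jM)).1; rewrite ltnW// ltn_pmod.
Qed.

Lemma mw_windows_stay_close (C alpha delta e eta : R) A Q (r : nat) M (lamr : 'cV[R]_n) :
  w = ones R n -> S != [::] -> sensitivity_const Rm S C -> attraction_const Rm S lam alpha ->
  0 < delta -> 0 < e -> e <= Num.min delta alpha / (2 * C) ->
  0 < eta -> eta <= delta / 4 -> eta <= alpha / 4 ->
  wmw_path Rm S w A Q -> (forall t, nonneg (A t)) -> nonneg (Q 0%N) ->
  (4 <= r)%N -> C * (1 + norm2 lam + r.+1%:R * norm2 (lamr - lam)) <= eta * r%:R ->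
  dist_set (Q 0%N) I <= eta * r%:R ->
  (forall j, max_dev (fun t => A (j * (r %/ 4).+1 + t)%N) lamr r.+1 <= e * r%:R \/
     (M < j * (r %/ 4).+1)%N) ->
  forall k, (k <= M)%N -> dist_set (Q k) I <= delta * r%:R.
Proof.
move=> wE S0 sens attr del0 e0 eC eta0 etad etaa path A0 Q0 r4 Cr dQ good.
have C0 := sens.1; have al0 := attr.1.
have [eCd eCa] : C * e <= delta / 2 /\ C * e <= alpha / 2.
  move: eC; rewrite ler_pdivlMr ?mulr_gt0// le_min => /andP[? ?].
  by split; lra.
have r0 : 0 < r%:R :> R by rewrite ltr0n (leq_trans _ r4).
have Qnn := wmw_path_nonneg net path A0 Q0.
have bound j l : (j * (r %/ 4).+1 <= M)%N -> (l <= r)%N ->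
    dist_set (Q (j * (r %/ 4).+1 + l)%N) I <=
    Num.max (dist_set (Q (j * (r %/ 4).+1)%N) I - alpha * l%:R) 0 + (C * e + eta) * r%:R.
  move=> jM lr; set s := (j * _)%N.
  have path' : wmw_path Rm S w (fun t => A (s + t)%N) (fun t => Q (s + t)%N).
    by move=> t; have := path (s + t)%N; rewrite addnS.
  have := @mw_distance_bound R n Rm S net lam lam0 S0 C alpha
    (fun t => A (s + t)%N) (fun t => Q (s + t)%N) sens attr.
  rewrite -wE addn0 => h.
  have {}h := h invariant_states_neq0 path' (fun t => A0 _) (Qnn _) l.
  apply: le_trans h _; rewrite lerD2l.
  have [gj|] := good j; last by rewrite ltnNge jM.
  have mc := @max_dev_change (fun t => A (s + t)%N) lam lamr l r.+1 (leqW lr).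
  have : C * (1 + norm2 lam + max_dev (fun t => A (s + t)%N) lam l) <=
     C * (1 + norm2 lam + (e * r%:R + r.+1%:R * norm2 (lamr - lam))).
    rewrite ler_pM2l// lerD2l; apply: le_trans mc _; by rewrite lerD2r.
  lra.
elim/ltn_ind => k IH kM.
have [kr|kr] := leqP k r.
  have := bound 0%N k (leq0n _) kr; rewrite !mul0n add0n.
  move/le_trans; apply.
  have : Num.max (dist_set (Q 0%N) I - alpha * k%:R) 0 <= eta * r%:R.
    rewrite ge_max mulr_ge0 ?(ltW eta0) ?(ltW r0)// andbT.
    apply: le_trans dQ; rewrite gerBl mulr_ge0// ltW//.
  have : (C * e + eta) * r%:R <= (delta / 2 + delta / 4) * r%:R by rewrite ler_pM2r// lerD.
  have : eta * r%:R <= delta / 4 * r%:R by rewrite ler_pM2r.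
  lra.
(* The first window start not before [k - r]. Rounding up costs at most [r %/ 4], so [k] is between
   [3r/4] and [r] steps after it. *)
have [j [jk lr l3]] : exists j, [/\ (j * (r %/ 4).+1 < k)%N, (k - j * (r %/ 4).+1 <= r)%N &
    (3 * r <= 4 * (k - j * (r %/ 4).+1))%N].
  have hr4 : (4 * (r %/ 4) <= r)%N by rewrite mulnC leq_divM.
  exists ((k - r + (r %/ 4)) %/ (r %/ 4).+1)%N.
  have := divn_eq (k - r + (r %/ 4)) (r %/ 4).+1.
  have : ((k - r + (r %/ 4)) %% (r %/ 4).+1 < (r %/ 4).+1)%N by rewrite ltn_pmod.
  move: (_ %% _)%N (_ * _)%N => md x.
  move: (r %/ 4)%N hr4 => a hr4; clear -r4 kr hr4 => mda E.
  by split; lia.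
have jM : (j * (r %/ 4).+1 <= M)%N by rewrite ltnW// (leq_trans jk).
have := bound j (k - j * (r %/ 4).+1)%N jM lr; rewrite subnKC; last exact: ltnW.
move/le_trans; apply.
have dj := IH _ jk jM.
have lR : 3 / 4 * r%:R <= (k - j * (r %/ 4).+1)%:R :> R.
  by move: l3; rewrite -(ler_nat R) !natrM; lra.
move: (_ - _)%N lR {jk lr l3} => l lR.
have : (C * e + eta) * r%:R <= (delta / 2 + delta / 4) * r%:R by rewrite ler_pM2r// lerD.
have : (C * e + eta) * r%:R <= (alpha / 2 + alpha / 4) * r%:R by rewrite ler_pM2r// lerD.
have : alpha * (3 / 4 * r%:R) <= alpha * l%:R by rewrite ler_pM2l.
have : 0 < delta * r%:R by rewrite mulr_gt0.
move: dj; rewrite /Num.max; case: ifP => _; lra.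
Qed.

End UpperBound.

(** * A lower law of large numbers *)

Section BoundedExpectation.
Variables (R : realType) (d : measure_display) (T : measurableType d).
Variable P : probability T R.
Implicit Types (f g : T -> R).

Definition bounded_mfun f : Prop :=
  measurable_fun setT f /\ exists K : R, forall x, `|f x| <= K.

Definition mean f : R := (\int[P]_x f x)%R.

Lemma bounded_mfun_integrable f : bounded_mfun f -> P.-integrable setT (EFin \o f).
Proof.
move=> [mf [K fK]]; apply: measurable_bounded_integrable => //.
  by rewrite (le_lt_trans (probability_le1 P measurableT))// ltry.
exists K; split; first exact: num_real.
by move=> M KM x _ /=; rewrite (le_trans (fK x))// ltW.
Qed.

Lemma bounded_mfun_cst (c : R) : bounded_mfun (fun=> c).
Proof. by split; [exact: measurable_cst|exists `|c|]. Qed.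

Lemma bounded_mfunD f g : bounded_mfun f -> bounded_mfun g -> bounded_mfun (fun x => f x + g x).
Proof.
move=> [mf [K fK]] [mg [L gL]]; split; first exact: measurable_funD.
by exists (K + L) => x; rewrite (le_trans (ler_normD _ _))// lerD.
Qed.

Lemma bounded_mfunM f g : bounded_mfun f -> bounded_mfun g -> bounded_mfun (fun x => f x * g x).
Proof.
move=> [mf [K fK]] [mg [L gL]]; split; first exact: measurable_funM.
by exists (K * L) => x; rewrite normrM ler_pM.
Qed.

Lemma bounded_mfun_sum (J : Type) (s : seq J) (F : J -> T -> R) :
  (forall j, bounded_mfun (F j)) -> bounded_mfun (fun x => \sum_(j <- s) F j x).
Proof.
move=> bF; elim: s => [|a s IH].
  rewrite (_ : (fun _ => _) = (fun=> 0)); first exact: bounded_mfun_cst.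
  by apply/funext => x; rewrite big_nil.
rewrite (_ : (fun _ => _) = (fun x => F a x + \sum_(j <- s) F j x)).
  exact: bounded_mfunD.
by apply/funext => x; rewrite big_cons.
Qed.

Lemma bounded_mfun_indic (B : set T) : measurable B -> bounded_mfun (\1_B : T -> R).
Proof.
move=> mB; split; first exact: measurable_indic.
by exists 1 => x; rewrite indicE; case: (_ \in _); rewrite ?normr1 ?normr0.
Qed.

Lemma meanD f g : bounded_mfun f -> bounded_mfun g ->
  mean (fun x => f x + g x) = mean f + mean g.
Proof. by move=> bf bg; rewrite /mean RintegralD//; exact: bounded_mfun_integrable. Qed.

Lemma meanZ (c : R) f : bounded_mfun f -> mean (fun x => c * f x) = c * mean f.
Proof. by move=> bf; rewrite /mean RintegralZl//; exact: bounded_mfun_integrable. Qed.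

Lemma mean_cst (c : R) : mean (fun=> c) = c.
Proof.
by rewrite /mean /Rintegral integral_cst//= (probability_setT P) mule1.
Qed.

Lemma mean_sum (J : Type) (s : seq J) (F : J -> T -> R) :
  (forall j, bounded_mfun (F j)) ->
  mean (fun x => \sum_(j <- s) F j x) = \sum_(j <- s) mean (F j).
Proof.
move=> bF; elim: s => [|a s IH].
  rewrite big_nil -[RHS](mean_cst 0); congr mean.
  by apply/funext => x; rewrite big_nil.
rewrite big_cons -IH -meanD//; last exact: bounded_mfun_sum.
by congr mean; apply/funext => x; rewrite big_cons.
Qed.

Lemma mean_indic (B : set T) : measurable B -> mean (\1_B : T -> R) = fine (P B).
Proof. by move=> mB; rewrite /mean /Rintegral integral_indic// setIT. Qed.

Lemma mean_le f g : bounded_mfun f -> bounded_mfun g -> (forall x, f x <= g x) ->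
  mean f <= mean g.
Proof.
by move=> bf bg fg; apply: le_Rintegral => //; exact: bounded_mfun_integrable.
Qed.

Lemma chebyshev_sqr f (a : R) : 0 < a -> bounded_mfun f ->
  fine (P [set x | f x < - a]) <= mean (fun x => f x * f x) / a ^+ 2.
Proof.
move=> a0 bf.
have mB : measurable [set x | f x < - a] by apply: measurable_fun_lt_cst; exact: bf.1.
rewrite ler_pdivlMr ?exprn_gt0// -mean_indic// mulrC -meanZ; last exact: bounded_mfun_indic.
apply: mean_le => [||x].
- by apply: bounded_mfunM; [exact: bounded_mfun_cst|exact: bounded_mfun_indic].
- exact: bounded_mfunM.
rewrite indicE; case: (boolP (_ \in _)) => [|_]; last by rewrite mulr0 -expr2 sqr_ge0.
rewrite inE /= mulr1 => fa; nra.
Qed.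

End BoundedExpectation.

Section LowerLaw.
Variables (R : realType) (d : measure_display) (T : measurableType d).
Variable P : probability T R.
Variables (X : nat -> T -> R) (lam : R).
Hypotheses (mX : forall t, measurable_fun setT (X t)) (X0 : forall t x, 0 <= X t x).
Hypothesis meanX : (\int[P]_x (X 0%N x)%:E = lam%:E)%E.
Hypothesis identX : forall t (B : set R), measurable B ->
  P (X t @^-1` B) = P (X 0%N @^-1` B).
Hypothesis indepX : forall s t (B C : set R), s <> t -> measurable B -> measurable C ->
  (P ((X s @^-1` B) `&` (X t @^-1` C)) = P (X s @^-1` B) * P (X t @^-1` C))%E.

Lemma truncated_mean (eta : R) : 0 < eta ->
  exists L : R, 0 < L /\ lam - eta <= mean P (fun x => Num.min (X 0%N x) L).
Proof.
move=> eta0.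
have bmin L : 0 <= L -> bounded_mfun (fun x => Num.min (X 0%N x) L).
  move=> L0; split; first by apply: measurable_minr => //; exact: measurable_cst.
  by exists L => x; rewrite ger0_norm ?le_min ?X0// ge_min lexx orbT.
have cv : (\int[P]_x (Num.min (X 0%N x) k%:R)%:E)%E @[k --> \oo] --> lam%:E.
  rewrite -meanX.
  have -> : (\int[P]_x (X 0%N x)%:E = \int[P]_x (limn (fun k => (Num.min (X 0%N x) k%:R)%:E)))%E.
    apply: eq_integral => x _; apply/esym/cvg_lim => //.
    apply: cvg_near_cst; near=> k; congr EFin; apply/min_idPl.
    near: k; exact: nbhs_infty_ger.
  apply: cvg_monotone_convergence => //.
  - move=> k; apply/measurable_EFinP; exact: (bmin k%:R (ler0n _ _)).1.
  - by move=> k x _; rewrite lee_fin le_min X0 ler0n.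
  - move=> x _ k l kl; rewrite lee_fin le_min ge_min lexx /= ge_min.
    by rewrite ler_nat kl orbT.
have {}cv : (fun k => mean P (fun x => Num.min (X 0%N x) k%:R)) @ \oo --> lam.
  by move/fine_cvgP : cv => [_].
have : \forall k \near \oo, lam - eta <= mean P (fun x => Num.min (X 0%N x) k%:R).
  apply: (cvgr_ge lam) => //.
  by rewrite ltrBlDr ltrDl.
move=> [N _ hN]; exists N.+1%:R; split; first by rewrite ltr0n.
by apply: hN => /=.
Unshelve. all: end_near. Qed.


Section Layers.
Variables (h : R) (J : nat).
Hypothesis h0 : 0 < h.

(** Stacking these events with height [h] gives a staircase below [X t]. Covariances of staircases
    need only independence of events, as the hypotheses provide. *)
Definition layer (j t : nat) : set T := X t @^-1` `[j.+1%:R * h, +oo[%classic.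
Definition layer_prob j : R := fine (P (layer j 0)).
Definition layered t x : R := \sum_(j < J) h * \1_(layer j t) x.
Definition centered t x : R := \sum_(j < J) h * (\1_(layer j t) x - layer_prob j).
Definition layer_mean : R := \sum_(j < J) h * layer_prob j.

Lemma measurable_layer j t : measurable (layer j t).
Proof. by rewrite -[X in measurable X]setTI; apply: mX. Qed.

Lemma layer_probE j t : fine (P (layer j t)) = layer_prob j.
Proof. by rewrite /layer_prob identX. Qed.

Lemma layered_bounds t x : [/\ layered t x <= X t x, layered t x <= J%:R * h &
  Num.min (X t x) (J%:R * h) <= layered t x + h].
Proof.
suff [? ? ? _] : [/\ layered t x <= X t x, layered t x <= J%:R * h,
  Num.min (X t x) (J%:R * h) <= layered t x + h &
  (J%:R * h <= X t x -> layered t x = J%:R * h)] by [].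
rewrite /layered; elim: J => [|k [IH1 IH2 IH3 IH4]].
  by rewrite big_ord0 mul0r; split=> //; rewrite add0r ge_min (ltW h0) orbT.
rewrite big_ord_recr /= indicE.
have xl : (x \in layer k t) = (k.+1%:R * h <= X t x).
  by apply/idP/idP; rewrite inE /layer /= in_itv /= andbT.
rewrite xl; have kS : k.+1%:R * h = k%:R * h + h by rewrite -natr1 mulrDl mul1r.
have [kx|kx] := leP (k.+1%:R * h) (X t x).
  have kx' : k%:R * h <= X t x by apply: le_trans kx; rewrite kS lerDl ltW.
  rewrite (IH4 kx') mulr1 -kS; split=> //.
  by rewrite lerDl ltW.
rewrite mulr0 addr0; split=> //; first by rewrite kS (le_trans IH2)// lerDl ltW.
have [xk|xk] := leP (X t x) (k%:R * h).
  by move: IH3; rewrite (min_idPl xk).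
by rewrite (IH4 (ltW xk)) -kS; exact: ltW.
Qed.

Lemma layered_ge0 t x : 0 <= layered t x.
Proof.
by apply: sumr_ge0 => j _; rewrite mulr_ge0 ?(ltW h0)// indicE.
Qed.

Lemma centeredE t x : centered t x = layered t x - layer_mean.
Proof. by rewrite /layer_mean -sumrB; apply: eq_bigr => j _; rewrite mulrBr. Qed.

Lemma layer_term_bounded j t : bounded_mfun (fun x => h * (\1_(layer j t) x - layer_prob j)).
Proof.
apply: bounded_mfunM; first exact: bounded_mfun_cst.
apply: bounded_mfunD; last exact: bounded_mfun_cst.
by apply: bounded_mfun_indic; exact: measurable_layer.
Qed.

Lemma centered_bounded t : bounded_mfun (centered t).
Proof. by apply: bounded_mfun_sum => j; exact: layer_term_bounded. Qed.

Lemma layered_bounded t : bounded_mfun (layered t).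
Proof.
apply: bounded_mfun_sum => j; apply: bounded_mfunM; first exact: bounded_mfun_cst.
by apply: bounded_mfun_indic; exact: measurable_layer.
Qed.

Lemma mean_layered t : mean P (layered t) = layer_mean.
Proof.
rewrite /layered mean_sum; last first.
  move=> j; apply: bounded_mfunM; first exact: bounded_mfun_cst.
  by apply: bounded_mfun_indic; exact: measurable_layer.
apply: eq_bigr => j _; rewrite meanZ; last first.
  by apply: bounded_mfun_indic; exact: measurable_layer.
by rewrite mean_indic ?layer_probE//; exact: measurable_layer.
Qed.

Lemma layer_uncorrelated j k s t : s <> t ->
  mean P (fun x => (h * (\1_(layer j s) x - layer_prob j)) *
                   (h * (\1_(layer k t) x - layer_prob k))) = 0.
Proof.
move=> st; have mj := measurable_layer j s; have mk := measurable_layer k t.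
have mjk : measurable (layer j s `&` layer k t) by exact: measurableI.
have bj := bounded_mfun_indic R mj; have bk := bounded_mfun_indic R mk.
have bjk := bounded_mfun_indic R mjk.
have bZ (c : R) (f : T -> R) : bounded_mfun f -> bounded_mfun (fun x => c * f x).
  by move=> bf; apply: bounded_mfunM => //; exact: bounded_mfun_cst.
have -> : (fun x => (h * (\1_(layer j s) x - layer_prob j)) *
                   (h * (\1_(layer k t) x - layer_prob k))) =
  (fun x => h ^+ 2 * \1_(layer j s `&` layer k t) x +
     ((- (h ^+ 2 * layer_prob k)) * \1_(layer j s) x +
      ((- (h ^+ 2 * layer_prob j)) * \1_(layer k t) x + h ^+ 2 * layer_prob j * layer_prob k))).
  by apply/funext => x; rewrite indicI /=; ring.
rewrite meanD; [|exact: bZ|]; last first.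
  by do 2! (apply: bounded_mfunD; first exact: bZ); exact: bounded_mfun_cst.
rewrite meanD; [|exact: bZ|]; last first.
  by apply: bounded_mfunD; [exact: bZ|exact: bounded_mfun_cst].
rewrite meanD; [|exact: bZ|exact: bounded_mfun_cst].
rewrite mean_cst !meanZ// !mean_indic// !layer_probE indepX// fineM.
- by rewrite !layer_probE; ring.
- by rewrite fin_num_measure.
- by rewrite fin_num_measure.
Qed.

Lemma centered_uncorrelated s t : s <> t ->
  mean P (fun x => centered s x * centered t x) = 0.
Proof.
move=> st.
have -> : (fun x => centered s x * centered t x) = (fun x => \sum_(j < J) \sum_(k < J)
    (h * (\1_(layer j s) x - layer_prob j)) * (h * (\1_(layer k t) x - layer_prob k))).
  apply/funext => x; rewrite /centered mulr_suml; apply: eq_bigr => j _.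
  by rewrite mulr_sumr.
rewrite mean_sum; last first.
  by move=> j; apply: bounded_mfun_sum => k; apply: bounded_mfunM; exact: layer_term_bounded.
apply: big1 => j _; rewrite mean_sum; last first.
  by move=> k; apply: bounded_mfunM; exact: layer_term_bounded.
by apply: big1 => k _; exact: layer_uncorrelated.
Qed.

Lemma centered_variance t : mean P (fun x => centered t x * centered t x) <= (J%:R * h) ^+ 2.
Proof.
rewrite -[leRHS](mean_cst P); apply: mean_le.
- by apply: bounded_mfunM; exact: centered_bounded.
- exact: bounded_mfun_cst.
move=> x; rewrite centeredE.
have [_ h1 _] := layered_bounds t x; have h2 := layered_ge0 t x.
have [m1 m2] : 0 <= layer_mean /\ layer_mean <= J%:R * h.
  rewrite -(mean_layered 0) -[X in X <= _](mean_cst P) -[X in _ /\ _ <= X](mean_cst P).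
  split; apply: mean_le => //; [exact: bounded_mfun_cst|exact: layered_bounded| |exact: layered_bounded|exact: bounded_mfun_cst|].
    by move=> y; exact: layered_ge0.
  by move=> y; have [] := layered_bounds 0 y.
nra.
Qed.

Lemma centered_sum_variance m :
  mean P (fun x => (\sum_(t < m) centered t x) * (\sum_(t < m) centered t x)) <=
  m%:R * (J%:R * h) ^+ 2.
Proof.
have bS k : bounded_mfun (fun x => \sum_(t < k) centered t x).
  by apply: bounded_mfun_sum => t; exact: centered_bounded.
elim: m => [|m IH].
  rewrite mul0r -[leRHS](mean_cst P) (_ : (fun _ => _) = (fun=> 0))//.
  by apply/funext => x; rewrite big_ord0 mul0r.
have -> : (fun x => (\sum_(t < m.+1) centered t x) * (\sum_(t < m.+1) centered t x)) =
  (fun x => (\sum_(t < m) centered t x) * (\sum_(t < m) centered t x) +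
    (2 * (\sum_(t < m) centered t x * centered m x) + centered m x * centered m x)).
  by apply/funext => x; rewrite big_ord_recr /= -mulr_suml; ring.
have bSm : bounded_mfun (fun x => \sum_(t < m) centered t x * centered m x).
  by apply: bounded_mfun_sum => t; apply: bounded_mfunM; exact: centered_bounded.
have b2 : bounded_mfun (fun x => 2 * (\sum_(t < m) centered t x * centered m x)).
  by apply: bounded_mfunM => //; exact: bounded_mfun_cst.
have bm : bounded_mfun (fun x => centered m x * centered m x).
  by apply: bounded_mfunM; exact: centered_bounded.
rewrite meanD; [|exact: bounded_mfunM|exact: bounded_mfunD].
rewrite meanD// meanZ// mean_sum; last first.
  by move=> t; apply: bounded_mfunM; exact: centered_bounded.
rewrite big1; last by move=> t _; apply: centered_uncorrelated => tm; have := ltn_ord t; rewrite tm ltnn.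
rewrite mulr0 add0r -natr1 mulrDl mul1r lerD//; exact: centered_variance.
Qed.

End Layers.

Lemma lam_ge0 : 0 <= lam.
Proof. by rewrite -lee_fin -meanX; apply: integral_ge0 => x _; rewrite lee_fin. Qed.

Lemma square_interval t : exists k, (k * k <= t < k.+1 * k.+1)%N.
Proof.
elim: t => [|t [k /andP[k1 k2]]]; first by exists 0%N.
have [tk|tk] := ltnP t.+1 (k.+1 * k.+1); first by exists k; rewrite (leqW k1) tk.
exists k.+1; rewrite tk /=; nia.
Qed.

Lemma inv_square_sum (q : nat) (N : nat) : (0 < q)%N ->
  \sum_(0 <= k < N) ((q + k).+1%:R ^+ 2)^-1 <= q%:R^-1 - (q + N)%:R^-1 :> R.
Proof.
move=> q0; elim: N => [|N IH]; first by rewrite big_nil addn0 subrr.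
rewrite big_nat_recr //= addnS.
set a : R := (q + N)%:R in IH *.
have a0 : 0 < a by rewrite ltr0n addn_gt0 q0.
have -> : (q + N).+1%:R = a + 1 :> R by rewrite -natr1.
suff : ((a + 1) ^+ 2)^-1 <= a^-1 - (a + 1)^-1 by lra.
have a1 : 0 < a + 1 by rewrite ltr_wpDr// ltW.
clearbody a.
have -> : a^-1 - (a + 1)^-1 = (a * (a + 1))^-1.
  by field; rewrite !gt_eqF.
rewrite lef_pV2 ?posrE ?mulr_gt0 ?exprn_gt0//; nra.
Qed.

(* Chebyshev along the squares [k ^ 2]; between consecutive squares the sums
   are controlled by monotonicity, since [X] is nonnegative. *)
Lemma lower_law (eta kappa : R) : 0 < eta -> 0 < kappa ->
  exists K : R, exists G : set T, [/\ 0 <= K, measurable G, (P (~` G) <= kappa%:E)%E &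
    forall x, G x -> forall t : nat, (lam - eta) * t%:R - K <= \sum_(s < t) X s x].
Proof.
move=> eta0 kap0; have lam0 := lam_ge0.
(* Truncation, staircase and Chebyshev each lose [e] per step; the fourth share absorbs the gap
   between consecutive squares. *)
pose e := eta / 4; have e0 : 0 < e by rewrite divr_gt0.
have [L [L0 Lm]] := truncated_mean e0.
pose J := (Num.trunc (L / e)).+1.
have JL : L <= J%:R * e.
  rewrite -ler_pdivrMr// ltW//.
  by have /andP[] := truncn_itv (ltW (divr_gt0 L0 e0)).
have mu_ge : lam - 2 * e <= layer_mean e J.
  have : mean P (fun x => Num.min (X 0%N x) L) <= mean P (fun x => layered e J 0 x + e).
    apply: mean_le.
    - split; first by apply: measurable_minr => //; exact: measurable_cst.
      by exists L => x; rewrite ger0_norm ?le_min ?X0 ?(ltW L0)// ge_min lexx orbT.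
    - by apply: bounded_mfunD; [exact: layered_bounded|exact: bounded_mfun_cst].
    move=> x; have [_ _ h3] := layered_bounds J e0 0 x; apply: le_trans h3.
    by rewrite le_min ge_min lexx /= ge_min JL orbT.
  rewrite meanD; [|exact: layered_bounded|exact: bounded_mfun_cst].
  rewrite mean_cst mean_layered; lra.
pose S m x := \sum_(t < m) centered e J t x.
have bS m : bounded_mfun (S m).
  by apply: bounded_mfun_sum => t; exact: centered_bounded.
pose c := (J%:R * e) ^+ 2 / e ^+ 2.
have c0 : 0 <= c by rewrite divr_ge0 ?sqr_ge0.
(* Squares up to [q] are left out so that the remaining failure probabilities sum to at most
   [c / q <= kappa]; times before them are covered by the second term of the constant [K]. *)
pose q := (Num.trunc (c / kappa)).+1.
have q0 : 0 < q%:R :> R by rewrite ltr0n.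
have cq : c / q%:R <= kappa.
  rewrite ler_pdivrMr// mulrC -ler_pdivrMr// ltW//.
  by have /andP[] := truncn_itv (divr_ge0 c0 (ltW kap0)).
pose bad k := [set x | S ((q + k).+1 * (q + k).+1)%N x < - (((q + k).+1 * (q + k).+1)%:R * e)].
have mbad k : measurable (bad k) by apply: measurable_fun_lt_cst; exact: (bS _).1.
have Pbad k : (P (bad k) <= (c * ((q + k).+1%:R ^+ 2)^-1)%:E)%E.
  rewrite -[P _]fineK ?fin_num_measure// lee_fin.
  set m := ((q + k).+1 * (q + k).+1)%N.
  have m0 : 0 < m%:R :> R by rewrite ltr0n.
  apply: le_trans (chebyshev_sqr P (mulr_gt0 m0 e0) (bS m)) _.
  apply: (@le_trans _ _ (m%:R * (J%:R * e) ^+ 2 / (m%:R * e) ^+ 2)).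
    by rewrite ler_pM2r ?invr_gt0 ?exprn_gt0 ?mulr_gt0//; exact: centered_sum_variance.
  have -> : (q + k).+1%:R ^+ 2 = m%:R :> R by rewrite /m natrM expr2.
  have scale (a b x : R) : 0 < x -> 0 < b -> x * a / (x * b) ^+ 2 = a / b ^+ 2 * x^-1.
    by move=> x0 b0; field; rewrite !gt_eqF.
  by rewrite scale.
pose G := ~` (\bigcup_k bad k).
have mU : measurable (\bigcup_k bad k) by apply: bigcupT_measurable.
exists (lam ^+ 2 / e + lam * (q.+1 * q.+1)%:R), G; split.
- apply: addr_ge0; last by rewrite mulr_ge0.
  by rewrite divr_ge0 ?sqr_ge0// ltW.
- exact: measurableC.
- rewrite setCK; apply: le_trans (generalized_Boole_inequality P mbad mU) _.
  apply: lime_le; first by apply: is_cvg_nneseries => k _ _; exact: measure_ge0.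
  apply: nearW => N.
  apply: (@le_trans _ _ (\sum_(0 <= k < N) (c * ((q + k).+1%:R ^+ 2)^-1)%:E)%E).
    by apply: lee_sum => k _; exact: Pbad.
  rewrite sumEFin lee_fin -mulr_sumr; apply: le_trans cq.
  rewrite ler_wpM2l//; apply: le_trans (@inv_square_sum q N _) _ => //.
  by rewrite gerBl invr_ge0.
move=> x Gx t; have [k /andP[kt tk]] := square_interval t.
have Xsum (a b : nat) : (a <= b)%N -> \sum_(s < a) X s x <= \sum_(s < b) X s x.
  move=> ab; rewrite -!(big_mkord xpredT (fun s => X s x)).
  by rewrite [leRHS](@big_cat_nat _ _ _ a)//= lerDl; apply: sumr_ge0.
have sum0 : 0 <= \sum_(s < t) X s x by apply: sumr_ge0.
have tk2 : t%:R <= k%:R ^+ 2 + 2 * k%:R :> R.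
  have : (t <= k * k + 2 * k)%N by lia.
  by rewrite -(ler_nat R) natrD !natrM expr2.
have kt2 : k%:R ^+ 2 <= t%:R :> R by rewrite expr2 -natrM ler_nat.
have le0 : 0 <= lam ^+ 2 / e by rewrite divr_ge0 ?sqr_ge0// ltW.
have k0 : 0 <= k%:R :> R by [].
have t0 : 0 <= t%:R :> R by [].
have [kq|kq] := leqP k q.
  have : t%:R <= (q.+1 * q.+1)%:R :> R.
    by rewrite ler_nat ltnW// (leq_trans tk)// leq_mul.
  move=> tq; have : lam * t%:R <= lam * (q.+1 * q.+1)%:R by rewrite ler_wpM2l.
  have : 0 <= eta * t%:R by rewrite mulr_ge0// ltW.
  lra.
have [k' kE] : exists k', k = (q + k').+1 by exists (k - q.+1)%N; rewrite -addSn subnKC.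
have nb : - (((k * k)%:R) * e) <= S (k * k)%N x.
  rewrite leNgt; apply/negP => hb; apply: Gx; exists k' => //.
  by move: hb; rewrite kE.
have SX : S (k * k)%N x <= \sum_(s < k * k) X s x - (k * k)%:R * layer_mean e J.
  have -> : (k * k)%:R * layer_mean e J = \sum_(s < k * k) layer_mean e J.
    by rewrite sumr_const card_ord mulr_natl.
  rewrite /S -sumrB.
  apply: ler_sum => s _; rewrite centeredE lerD2r.
  by have [] := layered_bounds J e0 s x.
have := Xsum _ _ kt.
have : (k * k)%:R * (lam - 2 * e) <= (k * k)%:R * layer_mean e J by rewrite ler_wpM2l.
(* The gap after [k ^ 2] costs [2 * lam * k]; completing the square bounds it by
   [e * k ^ 2 + lam ^ 2 / e], the source of the first term of [K]. *)
have sq : 0 <= e * k%:R ^+ 2 - 2 * lam * k%:R + lam ^+ 2 / e.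
  have complete (a y : R) : 0 < a ->
      a * y ^+ 2 - 2 * lam * y + lam ^+ 2 / a = (a * y - lam) ^+ 2 / a.
    by move=> a0; field; rewrite gt_eqF.
  by rewrite complete// divr_ge0 ?sqr_ge0// ltW.
have lt1 : lam * t%:R <= lam * (k%:R ^+ 2 + 2 * k%:R) by rewrite ler_wpM2l.
have lt2 : eta * k%:R ^+ 2 <= eta * t%:R by rewrite ler_wpM2l// ltW.
have etaE : eta = 4 * e by rewrite /e mulrCA divff ?mulr1.
have lq : 0 <= lam * (q.+1 * q.+1)%:R by rewrite mulr_ge0.
move: nb SX; rewrite natrM -expr2 etaE in lt2 *.
lra.
Qed.

End LowerLaw.

(** * The capacity region *)

Section Capacity.
Variable R : realType.

(** The integral of a nonnegative function is a supremum over simple functions below it, here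
    including every multiple of the indicator of [G]; return times thus fit without
    measurability. *)
Lemma integral_pinfty_on (d : measure_display) (T : measurableType d) (P : probability T R)
    (f : T -> \bar R) (G : set T) : measurable G -> (0 < P G)%E ->
  (forall x, 0 <= f x)%E -> (forall x, G x -> f x = +oo%E) -> (\int[P]_x f x = +oo)%E.
Proof.
move=> mG PG f0 fG.
have PGfin : P G = (fine (P G))%:E by rewrite fineK// fin_num_measure.
have pG : 0 < fine (P G) by rewrite -lte_fin -PGfin.
have lb (k : R) : 0 <= k -> ((k * fine (P G))%:E <= \int[P]_x f x)%E.
  move=> k0; rewrite ge0_integralTE//; apply: ereal_sup_ubound.
  exists (scale_nnsfun (indic_nnsfun R mG) k0) => /=.
    move=> x; rewrite mindicE; have [xG|xG] := boolP (x \in G).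
      by rewrite (fG x) ?leey//; move: xG; rewrite inE.
    by rewrite mulr0 f0.
  rewrite EFinM -PGfin -[P G]sintegral_indic -(sintegralrM P k (indic_nnsfun R mG)).
  by [].
have : forall k : nat, (k%:R%:E <= \int[P]_x f x)%E.
  move=> k; apply: le_trans (lb (k%:R / fine (P G)) _); last by rewrite divr_ge0// ltW.
  by rewrite divfK ?gt_eqF.
case: (\int[P]_x f x)%E => [r| |] // h.
  have := h (Num.trunc `|r|).+1; rewrite lee_fin leNgt.
  have /andP[_ h1] := truncn_itv (normr_ge0 r).
  by rewrite (le_lt_trans (ler_norm r) h1).
by have := h 0%N.
Qed.

Variable n : nat.
Implicit Types (x y rho lam : 'cV[R]_n).

(* Knaster-Tarski for the monotone map [y |-> lam + Rm y] on the box [0, rho]. *)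
Lemma routing_fixpoint (Rm : 'M[R]_n) lam rho : (forall i j, 0 <= Rm i j) ->
  nonneg lam -> nonneg rho -> (forall i, lam i 0 <= ((1%:M - Rm) *m rho) i 0) ->
  exists2 y, lam = (1%:M - Rm) *m y & forall i, 0 <= y i 0 <= rho i 0.
Proof.
move=> R0 lam0 rho0 lamrho.
pose F y := lam + Rm *m y.
have Fmono (y z : 'cV[R]_n) : (forall i, y i 0 <= z i 0) -> forall i, F y i 0 <= F z i 0.
  move=> yz i; rewrite !mxE lerD2l; apply: ler_sum => j _; exact: ler_wpM2l.
pose D : set 'cV[R]_n := [set y | [/\ nonneg y, (forall i, y i 0 <= rho i 0) &
   forall i, F y i 0 <= y i 0]].
have Drho : D rho.
  split=> // i; have := lamrho i; rewrite /F mulmxBl mul1mx !mxE; lra.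
pose l : 'cV[R]_n := \col_i inf [set y i 0 | y in D].
have hinf i : has_inf [set y i 0 | y in D].
  by split; [exists (rho i 0), rho|exists 0 => _ [y [y0 _ _] <-]].
have l_le y i : D y -> l i 0 <= y i 0.
  by move=> Dy; rewrite mxE; apply: ge_inf; [case: (hinf i)|exists y].
have l_ge (z : R) i : (forall y, D y -> z <= y i 0) -> z <= l i 0.
  move=> zy; rewrite mxE; apply: lb_le_inf; first by case: (hinf i).
  by move=> _ [y Dy <-]; exact: zy.
have Fl i : F l i 0 <= l i 0.
  apply: l_ge => y Dy; have [_ _ Fy] := Dy; apply: le_trans (Fy i).
  by apply: Fmono => j; exact: l_le.
have l0 : nonneg l by move=> i; apply: l_ge => y [].
have lrho i : l i 0 <= rho i 0 by exact: l_le.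
have DFl : D (F l).
  split=> [i|i|i].
  - rewrite !mxE addr_ge0//; apply: sumr_ge0 => j _; exact: mulr_ge0.
  - exact: le_trans (Fl i) (lrho i).
  - exact: Fmono.
have lE : l = F l.
  by apply/colP => i; apply/eqP; rewrite eq_le Fl l_le.
exists l; last by move=> i; rewrite l0 lrho.
by rewrite mulmxBl mul1mx {1}lE /F addrK.
Qed.

Variables (Rm : 'M[R]_n) (S : seq 'cV[R]_n).
Hypothesis net : network_ok Rm S.

Lemma pol_queue_nonneg pi (A : nat -> 'cV[R]_n) x t : (forall x, pi x \in S) ->
  (forall t, nonneg (A t)) -> nonneg x -> nonneg (pol_queue Rm pi A x t).
Proof.
move=> piS A0 x0; elim: t => //= t IH; exact: (qstep_nonneg net).
Qed.

Lemma pol_queueE pi (A : nat -> 'cV[R]_n) x t :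
  pol_queue Rm pi A x t = x + \sum_(s < t) A s -
    (1%:M - Rm) *m \sum_(s < t) cmin (pi (pol_queue Rm pi A x s)) (pol_queue Rm pi A x s).
Proof.
elim: t => [|t IH]; first by rewrite !big_ord0 mulmx0 subr0 addr0.
rewrite /= !big_ord_recr /= /qstep; set q := pol_queue _ _ _ _ t in IH *.
rewrite {1}IH -(opprB 1%:M Rm) mulNmx mulmxDr; apply/colP => i; rewrite !mxE; ring.
Qed.

(* The policy is not assumed measurable, so a return time need not be a
   stopping time and Wald's identity is not available; the argument is pathwise,
   on one sample path that returns and obeys the lower law of large numbers. *)
Lemma supportable_hull_le lam (eta : R) : supportable Rm S lam -> 0 < eta ->
  exists2 rho, hull (undup S) rho &
    forall i, lam i 0 <= ((1%:M - Rm) *m rho) i 0 + eta.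
Proof.
move=> [d [T [P [A [pi [[mA A0] [[ind ident] [meanA [piS [mQ [M ret]]]]]]]]]]] eta0.
have P1 : P setT = 1%E := probability_setT P.
pose kap : R := (2 * n.+1%:R)^-1.
have kap0 : 0 < kap by rewrite invr_gt0 mulr_gt0.
have /choice [KG KGP] : forall i : 'I_n, exists KG : R * set T,
    [/\ 0 <= KG.1, measurable KG.2, (P (~` KG.2) <= kap%:E)%E &
    forall om, KG.2 om -> forall t : nat,
      (lam i 0 - eta) * t%:R - KG.1 <= \sum_(s < t) A s om i 0].
  move=> i.
  pose sel (B : set R) (j : 'I_n) := if j == i then B else setT.
  have msel (B : set R) : measurable B -> forall j, measurable (sel B j).
    by move=> mB j; rewrite /sel; case: ifP.
  have selE t (B : set R) : [set om | forall j, sel B j (A t om j 0)] =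
      (fun om => A t om i 0) @^-1` B.
    apply/seteqP; split=> om /=; first by move=> /(_ i); rewrite /sel eqxx.
    by move=> Bo j; rewrite /sel; case: eqP => // ->.
  have [|||||K [G [K0 mG PG Gsum]]] :=
      @lower_law R d T P (fun t om => A t om i 0) (lam i 0) _ _ _ _ _ eta kap eta0 kap0.
  - by move=> t; exact: mA.
  - by move=> t x; exact: A0.
  - exact: meanA.
  - by move=> t B mB; rewrite -!selE; apply: ident; exact: msel.
  - move=> s t B C st mB mC.
    pose BB (u : nat) : 'I_n -> set R := if u == s then sel B else if u == t then sel C else fun=> setT.
    have mBB u j : measurable (BB u j).
      by rewrite /BB; case: ifP => _; [exact: msel|case: ifP => _; [exact: msel|]].
    have sM : (s < (maxn s t).+1)%N by rewrite ltnS leq_maxl.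
    have tM : (t < (maxn s t).+1)%N by rewrite ltnS leq_maxr.
    have := ind (maxn s t).+1 BB mBB.
    have -> : [set om | forall t0 i0, (t0 < (maxn s t).+1)%N -> BB t0 i0 (A t0 om i0 0)] =
       ((fun om => A s om i 0) @^-1` B) `&` ((fun om => A t om i 0) @^-1` C).
      apply/seteqP; split=> om /=.
        move=> h; split.
          by have := h s i sM; rewrite /BB eqxx /sel eqxx.
        have := h t i tM; rewrite /BB; case: eqP => [ts|_]; first by rewrite ts in st.
        by rewrite eqxx /sel eqxx.
      move=> [Bs Ct] u j _; rewrite /BB; case: eqP => [->|_].
        by rewrite /sel; case: eqP => // ->.
      case: eqP => [->|//]; by rewrite /sel; case: eqP => // ->.
    move=> ->; rewrite (bigD1 (Ordinal sM))//= (bigD1 (Ordinal tM))/=; last first.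
      by apply/eqP => /(congr1 val) /= ts; apply: st.
    have BBs : BB s = sel B by rewrite /BB eqxx.
    have BBt : BB t = sel C.
      by rewrite /BB; case: eqP => [ts|_]; [rewrite ts in st|rewrite eqxx].
    rewrite BBs BBt !selE big1 ?mule1// => u /andP[us ut].
    rewrite -[RHS]P1; congr (P _); apply/seteqP; split=> // om _ j.
    rewrite /BB; case: eqP => [ue|_].
      by move: us; rewrite -(inj_eq val_inj) /= ue eqxx.
    by case: eqP => [ue|//]; move: ut; rewrite -(inj_eq val_inj) /= ue eqxx.
  by exists (K, G).
pose G := \bigcap_(i : 'I_n) (KG i).2.
have mG : measurable G.
  by apply: fin_bigcap_measurable => [|i _]; [exact: finite_finset|have [] := KGP i].
have PG : (0 < P G)%E.
  have : (P (~` G) <= (2^-1)%:E)%E.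
    apply: (@le_trans _ _ (\sum_(k < n) kap%:E)%E); last first.
      rewrite sumEFin lee_fin sumr_const card_ord -[kap *+ n]mulr_natl /kap invfM mulrCA ler_piMr//.
      by rewrite ler_pdivrMr// mul1r ler_nat.
    case: (posnP n) => [n0|n0].
      rewrite (_ : ~` G = set0) ?measure0; first by rewrite sume_ge0// => i _; rewrite lee_fin ltW.
      apply/seteqP; split=> // om; apply => i _; exfalso.
      by have : (i < 0)%N by rewrite -[X in (_ < X)%N]n0; exact: ltn_ord.
    pose F (k : nat) : set T := ~` (KG (insubd (Ordinal n0) k)).2.
    have Fi (i : 'I_n) : F i = ~` (KG i).2 by rewrite /F valKd.
    apply: (@le_trans _ _ (\sum_(k < n) P (F k))%E).
      apply: (@content_subadditive _ _ _ P _ F) => //.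
      - by move=> k _; apply: measurableC; have [] := KGP (insubd (Ordinal n0) k).
      - exact: measurableC.
      - move=> om /existsNP[i /not_implyP[_ nG]]; rewrite -bigcup_mkord.
        by exists i => /=; [exact: ltn_ord|rewrite Fi].
    by apply: lee_sum => i _; rewrite Fi; have [] := KGP i.
  rewrite probability_setC// -[P G]fineK ?fin_num_measure// -EFinB lee_fin lte_fin.
  lra.
pose K := \sum_i (KG i).1.
have K0 i : 0 <= (KG i).1 by have [] := KGP i.
(* Starting this high, a return to the ball of radius [M] lowers every coordinate by at least [K],
   which cancels the deficit of the lower law. *)
pose x : 'cV[R]_n := const_mx (`|M| + K).
have x0 : nonneg x by move=> i; rewrite mxE addr_ge0//; apply: sumr_ge0.
(* Otherwise the return time is [+oo], the infimum of the empty set, on an event of positive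
   probability. *)
have [om [t [Gom t1 Qt]]] : exists om t, [/\ G om, (1 <= t)%N &
    norm2 (pol_queue Rm pi (A^~ om) x t) <= M].
  apply: contrapT => none.
  have := ret x x0; rewrite (integral_pinfty_on mG PG)//.
    by move=> om; apply: le_ereal_inf_tmp => _ [t _ <-]; rewrite lee_fin.
  move=> om Gom; rewrite -ereal_inf0; congr ereal_inf.
  by apply/seteqP; split=> // y [t [t1 Qt] yE]; exfalso; apply: none; exists om, t.
pose q s := pol_queue Rm pi (A^~ om) x s.
have q0 s : nonneg (q s) by apply: pol_queue_nonneg => // u; exact: A0.
have tR : 0 < t%:R :> R by rewrite ltr0n.
(* The time average of the service actually given up to the return; each term lies below a service
   vector, hence in the hull. *)
exists (\sum_(s <- index_enum 'I_t) t%:R^-1 *: cmin (pi (q s)) (q s)).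
  apply: hull_comb.
  - by move=> s _; rewrite invr_ge0.
  - by rewrite sumr_const card_ord -[_ *+ _]mulr_natl divff// gt_eqF.
  - move=> s _; apply: (hull_down net (m := pi (q s))).
      by apply: hull_mem; rewrite ?undup_uniq// mem_undup.
    by move=> i; exact: (cmin_bounds net).
move=> i; rewrite -scaler_sumr -scalemxAr mxE.
set z := ((1%:M - Rm) *m _) i 0; pose sA := (\sum_(s < t) A s om) i 0.
have qE : q t i 0 = `|M| + K + sA - z.
  by rewrite /q pol_queueE [LHS]mxE [X in X + _]mxE [X in X + _ + _]mxE [X in _ + X]mxE.
have Qle := le_trans (ler_norm _) (le_trans (coord_le_norm2 _ i) Qt).
rewrite -/(q t) qE in Qle.
have sAE : (lam i 0 - eta) * t%:R - (KG i).1 <= sA.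
  have [_ _ _ h] := KGP i; rewrite /sA summxE; exact: (h om (Gom i Logic.I) t).
have KK : (KG i).1 <= K by rewrite /K (bigD1 i)//= lerDl; apply: sumr_ge0.
have MM := ler_norm M.
have : (lam i 0 - eta) * t%:R <= z by lra.
by rewrite -ler_pdivlMr// (mulrC z) lerBlDr.
Qed.

Lemma supportable_nonneg lam : supportable Rm S lam -> nonneg lam /\ S != [::].
Proof.
move=> [d [T [P [A [pi [[mA A0] [_ [meanA [piS _]]]]]]]]]; split.
  move=> i; rewrite -lee_fin -meanA; apply: integral_ge0 => om _.
  by rewrite lee_fin; exact: A0.
by apply/eqP => S0; have := piS 0; rewrite S0.
Qed.

Lemma capacity_nonneg lam : capacity_region Rm S lam -> nonneg lam /\ S != [::].
Proof.
move=> cap; split; last first.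
  by have [lam' [/supportable_nonneg[]]] := cap 1 ltr01.
move=> i; apply/ler_addgt0Pr => e e0.
have [lam' [/supportable_nonneg[/(_ i) l0 _] dl]] := cap e e0.
have := le_trans (coord_le_norm2 (lam - lam') i) (ltW dl).
rewrite !mxE ler_norml => /andP[]; lra.
Qed.

(** Choose the mixture of least total positive excess of [lam]. Supportable rates near [lam] make
    the excess arbitrarily small, so the minimum is 0. *)
Lemma capacity_le lam : capacity_region Rm S lam ->
  exists2 rho, hull (undup S) rho & forall i, lam i 0 <= ((1%:M - Rm) *m rho) i 0.
Proof.
move=> cap; have [lam0 S0] := capacity_nonneg cap.
have uS : undup S != [::] by apply: contra S0 => /eqP/undup_nil ->.
have cmax : continuous (fun x : R => Num.max 0 x).
  move=> x; apply: (@continuous_max _ _ (cst 0) id); [exact: cst_continuous|exact: cvg_id].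
have [rho hrho rmin] := @hull_min R n (undup S) (1%:M - Rm) lam _ (undup_uniq S) uS cmax.
exists rho => // i.
set F := \sum_i _ in rmin.
have F0 : F <= 0.
  apply/ler_addgt0Pr => e e0; rewrite add0r.
  pose e' := e / n.+1%:R.
  have e'0 : 0 < e' by rewrite divr_gt0.
  have e'2 : 0 < e' / 2 by rewrite divr_gt0.
  have [lam' [sup' dl]] := cap _ e'2.
  have [rho' hr' hle] := supportable_hull_le sup' e'2.
  apply: le_trans (rmin _ hr') _.
  apply: (@le_trans _ _ (\sum_(k < n) e')); last first.
    rewrite sumr_const card_ord -mulr_natl /e' mulrCA ger_pMr// ler_pdivrMr// mul1r.
    by rewrite ler_nat.
  apply: ler_sum => k _; rewrite ge_max (ltW e'0) /= [X in X <= _]mxE [X in _ + X]mxE.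
  have := le_trans (coord_le_norm2 (lam - lam') k) (ltW dl).
  rewrite !mxE ler_norml => /andP[_]; have := hle k; rewrite !mxE; lra.
have Fi : Num.max 0 ((lam - (1%:M - Rm) *m rho) i 0) <= F.
  by rewrite /F (bigD1 i)//= lerDl; apply: sumr_ge0 => j _; rewrite le_max lexx.
have := le_trans Fi F0; rewrite ge_max => /andP[_].
by rewrite [X in X <= _]mxE [X in _ + X]mxE subr_le0.
Qed.

(** The fixed point of the routing map below [rho] gives equality, and the hull is closed under
    lowering coordinates. *)
Lemma capacity_hull lam : capacity_region Rm S lam ->
  exists2 rho, hull (undup S) rho & lam = (1%:M - Rm) *m rho.
Proof.
move=> cap; have [rho hrho lamrho] := capacity_le cap.
have [lam0 _] := capacity_nonneg cap.
have rho0 : nonneg rho.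
  by apply: (hull_nonneg net (L := undup S)) => // mu; rewrite mem_undup.
have [y lamE yrho] := routing_fixpoint net.1 lam0 rho0 lamrho.
by exists y => //; exact: (hull_down net hrho).
Qed.

End Capacity.

(** * Convergence and rates along the sequence of systems *)

Section StateSpaceCollapse.
Variables (R : realType) (n : nat) (Rm : 'M[R]_n) (S : seq 'cV[R]_n) (w lam : 'cV[R]_n)
  (Tend : R) (lamr : nat -> 'cV[R]_n) (f : nat -> R -> R) (g : nat -> R)
  (d : nat -> measure_display) (Om : forall r, measurableType (d r))
  (P : forall r, probability (Om r) R)
  (A : forall r, nat -> Om r -> 'cV[R]_n)
  (Q : forall r, nat -> Om r -> 'cV[R]_n) (Q0 : nat -> 'cV[R]_n).
Hypotheses (net : network_ok Rm S) (w0 : pos_weights w) (cap : capacity_region Rm S lam)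
  (T0 : 0 <= Tend) (f0 : forall r e, 0 <= e -> 0 <= f r e)
  (ginf : (0 < limn_einf (fun r => (g r / r%:R)%:E))%E)
  (ft : f_tailed f P A lamr lam) (Q00 : forall r, nonneg (Q0 r))
  (qp : queue_processes Rm S w A Q Q0)
  (dQ0 : (dist_set ((r%:R)^-1 *: Q0 r) (invariant_states Rm S w lam)) @[r --> \oo] --> 0).
Local Notation I := (invariant_states Rm S w lam).
Local Notation far r delta := (fine (P r (far_event g r (@Q r) I Tend delta))).

Lemma far_rate (delta e : R) (h : nat -> nat) : 0 < e ->
  (forall r, (0 < h r)%N /\ (r <= 4 * h r)%N) ->
  (\forall r \near \oo, forall om,
    (forall j, max_dev (fun t => @A r (j * h r + t)%N om) (lamr r) r.+1 <= e * r%:R \/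
       (`|Num.floor (g r * Tend)| < j * h r)%N) ->
     forall k, (k <= `|Num.floor (g r * Tend)|)%N -> dist_set (@Q r k om) I <= delta * r%:R) ->
  (r%:R * f r e / g r * far r delta) @[r --> \oo] --> 0.
Proof.
move=> e0 hh good; have [rho hrho lamE] := capacity_hull net cap.
have [stat [_ tail]] := ft.
have gc := limn_einf_gt0_near ginf.
have fine_ge (r : nat) (E : set (Om r)) : 0 <= fine (P r E).
  by apply: fine_ge0.
apply: (@far_prob_cvg _ (fun r => f r e) g h _ _ Tend T0 _ _ _ gc hh _ (tail e e0)) => //.
- by move=> r; apply: f0; exact: ltW.
near=> r.
have r0 : (0 < r)%N by near: r; exact: nbhs_infty_gt.
have r0R : 0 < r%:R :> R by rewrite ltr0n.
have g0 : 0 < g r.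
  near: r; case: gc => c c0; apply: filterS2 (nbhs_infty_gt 0) => k k0 ck.
  by rewrite -(pmulr_lgt0 _ (_ : 0 < k%:R^-1)) ?invr_gt0 ?ltr0n// (lt_le_trans c0).
have goodr : forall om,
    (forall j, max_dev (fun t => @A r (j * h r + t)%N om) (lamr r) r.+1 <= e * r%:R \/
       (`|Num.floor (g r * Tend)| < j * h r)%N) ->
     forall k, (k <= `|Num.floor (g r * Tend)|)%N -> dist_set (@Q r k om) I <= delta * r%:R.
  by near: r.
have [arr [st _]] := stat r.
apply: (far_event_prob_le (A := @A r)) => //.
- exact: (invariant_states_neq0 net w0 hrho lamE).
- exact: (qp r).1.
- move=> om gd k kM; rewrite (invariant_states_scale net w0 hrho lamE) ?invr_gt0//.
  by rewrite mulrC ler_pdivrMr//; exact: goodr.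
- exact: (hh r).1.
Unshelve. all: end_near. Qed.

Lemma initial_near (eta : R) : 0 < eta ->
  \forall r \near \oo, dist_set (Q0 r) I <= eta * r%:R.
Proof.
move=> eta0; have [rho hrho lamE] := capacity_hull net cap.
have : \forall r \near \oo, `|0 - dist_set ((r%:R)^-1 *: Q0 r) I| < eta.
  by move/cvgrPdist_lt : dQ0; exact.
apply: filterS2 (nbhs_infty_gt 0) => r r0.
have r0R : 0 < r%:R :> R by rewrite ltr0n.
rewrite sub0r normrN ger0_norm ?dist_set_ge0//.
rewrite (invariant_states_scale net w0 hrho lamE) ?invr_gt0//.
by rewrite mulrC ltr_pdivrMr// => /ltW.
Qed.

Lemma far_rate_exists (delta : R) : 0 < delta -> exists2 e, 0 < e &
  (r%:R * f r e / g r * far r delta) @[r --> \oo] --> 0.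
Proof.
move=> del0; have [rho hrho lamE] := capacity_hull net cap.
have [d' [e [r0 [d'0 e0 stay]]]] := windows_stay_close net w0 hrho lamE del0.
(* The spacing is [r], except at [r = 0], where it must still be positive. *)
exists e => //; apply: (@far_rate delta e (fun r => maxn 1 r)) => //.
  by move=> r; rewrite leq_maxl; split=> //; rewrite (leq_trans (leq_maxr 1 r))// leq_pmull.
near=> r => om.
have r_gt0 : (0 < r)%N by near: r; exact: nbhs_infty_gt.
rewrite (maxn_idPr r_gt0) => good k kM.
have [QE path] := (qp r).2 om.
have [[_ An] _] := ft.1 r.
apply: (stay _ _ r _ (lamr r) path) kM => //.
- by rewrite QE.
- by near: r; exact: nbhs_infty_ger.
- near: r; exact: norm2_cvg ft.2.1.
- by rewrite QE; near: r; exact: initial_near.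
Unshelve. all: end_near. Qed.

Lemma far_prob_cvg0 (delta : R) :
  (forall e, 0 < e -> (0 < limn_einf (fun r => (r%:R * f r e / g r)%:E))%E) ->
  0 < delta -> far r delta @[r --> \oo] --> 0.
Proof.
move=> finf /far_rate_exists[e e0 cv].
have [c c0 fc] := limn_einf_gt0_near (finf e e0).
have cv' : (c^-1 * (r%:R * f r e / g r * far r delta)) @[r --> \oo] --> 0.
  by rewrite -(mulr0 c^-1); apply: cvgMl_tmp cv.
apply: squeeze_cvgr (cvg_cst 0) cv'.
near=> r; rewrite fine_ge0//= -ler_pdivrMl ?invr_gt0// invrK.
by rewrite ler_wpM2r ?fine_ge0//; near: r.
Unshelve. all: end_near. Qed.

Lemma far_rate_mw (C alpha delta e : R) : w = ones R n -> sensitivity_const Rm S C ->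
  attraction_const Rm S lam alpha -> 0 < delta -> 0 < e ->
  e <= Num.min delta alpha / (2 * C) ->
  (r%:R * f r e / g r * far r delta) @[r --> \oo] --> 0.
Proof.
move=> wE sens attr del0 e0 eC; have [rho hrho lamE] := capacity_hull net cap.
have [lam0 S0] := capacity_nonneg cap.
have C0 := sens.1; have al0 := attr.1.
apply: (@far_rate delta e (fun r => (r %/ 4).+1)) => //.
  by move=> r; split=> //; rewrite mulnC ltnW// -ltn_divLR.
pose eta := Num.min (delta / 4) (alpha / 4).
have eta0 : 0 < eta by rewrite lt_min !divr_gt0.
have eta1 : eta <= delta / 4 by rewrite ge_min lexx.
have eta2 : eta <= alpha / 4 by rewrite ge_min lexx orbT.
pose e' := eta / (4 * C).
have e'0 : 0 < e' by rewrite divr_gt0// mulr_gt0.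
near=> r => om good k kM.
have [QE path] := (qp r).2 om.
have [[_ An] _] := ft.1 r.
apply: (mw_windows_stay_close net w0 hrho lamE lam0 wE S0 sens attr del0 e0 eC
  eta0 eta1 eta2 path) kM => //.
- by rewrite QE.
- by near: r; exact: nbhs_infty_ge.
- have rge : (1 + norm2 lam) / (2 * e') <= r%:R by near: r; exact: nbhs_infty_ger.
  have lr : norm2 (lamr r - lam) <= e' by near: r; exact: norm2_cvg ft.2.1.
  have r1 : (1 <= r)%N by near: r; exact: nbhs_infty_gt.
  have r1R : 1 <= r%:R :> R by rewrite ler1n.
  have e'2 : 0 < 2 * e' by apply: mulr_gt0.
  move: rge; rewrite (ler_pdivrMr _ _ e'2) => rge.
  have : r.+1%:R * norm2 (lamr r - lam) <= 2 * r%:R * e'.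
    by rewrite ler_pM ?norm2_ge0// -natr1; lra.
  have -> : eta = 4 * C * e' by rewrite /e' mulrC divfK ?gt_eqF ?mulr_gt0.
  move=> h; rewrite -mulrA -mulrA mulrCA ler_pM2l//; lra.
- by rewrite QE; near: r; exact: initial_near.
Unshelve. all: end_near. Qed.

End StateSpaceCollapse.

(** * Bursty arrivals *)

Section UniformPhase.
Variable R : realType.
Variable N : nat.

Lemma inv_natS_ge0 : 0 <= (N.+1%:R^-1 : R).
Proof. by rewrite invr_ge0. Qed.

(** Uniform on the phases [0, ..., N], but carried by [nat], where every set is measurable. *)
Definition unif : set nat -> \bar R :=
  mscale (NngNum inv_natS_ge0) (msum (fun k : nat => \d_k) N.+1).

HB.instance Definition _ := Measure.on unif.

Lemma unifE (E : set nat) : unif E = (N.+1%:R^-1 * \sum_(k < N.+1) (nat_of_ord k \in E)%:R)%:E.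
Proof.
rewrite /unif /mscale /msum /= EFinM; congr (_ * _)%E.
by rewrite -sumEFin; apply: eq_bigr.
Qed.

Lemma unif_full (E : set nat) : (forall k, (k <= N)%N -> E k) -> unif E = 1%E.
Proof.
move=> kE; rewrite unifE (eq_bigr (fun=> 1)); last by move=> k _; rewrite mem_set//; apply: kE; rewrite -ltnS.
by rewrite sumr_const card_ord mulVf.
Qed.

Lemma unif_setT : unif setT = 1%E.
Proof. exact: unif_full. Qed.

HB.instance Definition _ := Measure_isProbability.Build _ _ _ unif unif_setT.

Definition unif_prob : probability nat R := unif.

(** Addition of [k] permutes the residues; this rotation invariance makes the bursts stationary. *)
Lemma unif_shift (E : set nat) k :
  unif [set om | E ((om + k) %% N.+1)%N] = unif E.
Proof.
rewrite !unifE; congr (_ * _)%:E.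
rewrite [RHS](reindex_inj (addIr (inZp k : 'I_N.+1))) /=.
apply: eq_bigr => om _; congr (nat_of_bool _)%:R.
by apply/idP/idP; rewrite !inE /= modnDmr.
Qed.

Lemma unif_single k : unif [set om | (k + om) %% N.+1 == 0]%N = (N.+1%:R^-1)%:E.
Proof.
rewrite (_ : mkset _ = [set om | [set x | x == 0%N] ((om + k) %% N.+1)%N]); last first.
  by apply/seteqP; split=> om /=; rewrite addnC.
rewrite unif_shift unifE (bigD1 ord0)//= mem_set//= big1 ?addr0 ?mulr1// => i i0.
rewrite (_ : (_ \in _) = false)//; apply/negbTE; apply/negP; rewrite inE /= => /eqP i0'.
by move/negP: i0; apply; apply/eqP/val_inj.
Qed.

Lemma measurable_fun_nat (d : measure_display) (T : measurableType d) (f : nat -> T) :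
  measurable_fun setT f.
Proof. by []. Qed.

Lemma unif_integral (f : nat -> R) : (forall k, 0 <= f k) ->
  (\int[unif_prob]_om (f om)%:E = (N.+1%:R^-1 * \sum_(k < N.+1) f k)%:E)%E.
Proof.
move=> f0; have f0' x : [set: nat] x -> (0 <= (f x)%:E)%E by rewrite lee_fin.
rewrite /unif_prob /unif ge0_integral_mscale//= ge0_integral_measure_sum// EFinM.
congr (_ * _)%E; rewrite -sumEFin; apply: eq_bigr => k _.
by rewrite integral_dirac// diracT mul1e.
Qed.

End UniformPhase.

(** * A direction that leaves the invariant cone *)

Section NoninvariantStates.
Variables (R : realType) (n : nat) (Rm : 'M[R]_n) (S : seq 'cV[R]_n) (lam : 'cV[R]_n).
Hypotheses (net : network_ok Rm S) (cap : capacity_region Rm S lam).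
Implicit Types (q u : 'cV[R]_n).
Local Notation e1 := (ones R n).
Local Notation I := (invariant_states Rm S e1 lam).

Lemma inv_cone_closed q : dist_set q (inv_cone Rm S e1 lam) = 0 -> inv_cone Rm S e1 lam q.
Proof.
have e1pos : pos_weights e1 by exact: ones_pos.
have e10 : nonneg e1 by move=> i; rewrite mxE.
move=> dq; have close (e : R) : 0 < e -> exists2 y, inv_cone Rm S e1 lam y & norm2 (q - y) < e.
  move=> e0; have [y Ky] := dist_set_adherent q (inv_cone_neq0 Rm S e1 lam) e0.
  by rewrite dq add0r; exists y.
split=> [i|nu nuS].
  apply/ler_addgt0Pr => e e0; have [y [y0 _] qy] := close e e0.
  have := le_trans (coord_le_norm2 (q - y) i) (ltW qy); rewrite !mxE ler_norml => /andP[].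
  have := y0 i; lra.
pose v := (1%:M - Rm) *m nu - lam.
pose V := \sum_i `|v i 0|.
have vV i : `|v i 0| <= V by rewrite /V (bigD1 i)//= lerDl; apply: sumr_ge0.
have V0 : 0 <= V by apply: sumr_ge0.
pose c := (\sum_i e1 i 0) * V.
have c0 : 0 <= c by rewrite mulr_ge0//; apply: sumr_ge0 => i _; exact: e10.
apply/ler_addgt0Pr => e e0.
have c1 : 0 < c + 1 by rewrite ltr_wpDl.
have [y [_ yS] qy] := close (e / (c + 1)) (divr_gt0 e0 c1).
have := dotw_norm_le e1pos (q - y) vV; rewrite ler_norml => /andP[_ h].
have : c * norm2 (q - y) <= e.
  apply: (@le_trans _ _ (c * (e / (c + 1)))); first by rewrite ler_wpM2l// ltW.
  by rewrite mulrCA ler_piMr ?(ltW e0)// ler_pdivrMr// mul1r lerDl.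
have := yS nu nuS; move: h; rewrite -/c /v dotwBr !dotwBl !wobjE.
rewrite !(dotwC _ ((1%:M - Rm) *m nu)) !(dotwC _ lam); lra.
Qed.

(* If every state were invariant, [lam] would dominate the whole capacity
   region coordinatewise and hence be one of its extreme points. *)
Lemma noninvariant_exists : ~ extreme_point (capacity_region Rm S) lam ->
  exists2 u, nonneg u & 0 < dist_set u (inv_cone Rm S e1 lam).
Proof.
move=> next; apply: contrapT => none.
have all_inv u : nonneg u -> inv_cone Rm S e1 lam u.
  move=> u0; apply: inv_cone_closed; apply/eqP; rewrite eq_le dist_set_ge0 andbT.
  by rewrite leNgt; apply/negP => du; apply: none; exists u.
have dom y : capacity_region Rm S y -> forall i, y i 0 <= lam i 0.
  move=> /(capacity_le net)[rho hrho yrho] i; apply: le_trans (yrho i) _.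
  (* Invariance of the [i]-th unit vector says that no mixture drains queue [i] at a net rate above
     [lam i 0]. *)
  have d0 : nonneg (delta_mx i 0 : 'cV[R]_n) by move=> j; rewrite mxE ler0n.
  have dE z : dotw e1 (delta_mx i 0) z = z i 0.
    rewrite /dotw (bigD1 i)//= !mxE !eqxx !mul1r big1 ?addr0// => j /negbTE ji.
    by rewrite !mxE ji mulr0 mul0r.
  have [_ dS] := all_inv _ d0.
  by have := hull_wobj_le dS hrho; rewrite wobjE !dE.
apply: next; split=> // y z th Cy Cz /andP[th0 th1] lamE.
have key i : y i 0 = lam i 0 /\ z i 0 = lam i 0.
  have lamEi : lam i 0 = th * y i 0 + (1 - th) * z i 0 by rewrite {1}lamE !mxE.
  have yl := dom _ Cy i; have zl := dom _ Cz i.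
  have th1' : 0 < 1 - th by rewrite subr_gt0.
  have h1 : th * (lam i 0 - y i 0) = 0 /\ (1 - th) * (lam i 0 - z i 0) = 0.
    have p1 : 0 <= th * (lam i 0 - y i 0) by rewrite mulr_ge0 ?subr_ge0// ltW.
    have p2 : 0 <= (1 - th) * (lam i 0 - z i 0) by rewrite mulr_ge0 ?subr_ge0// ltW.
    by split; lra.
  case: h1 => /eqP; rewrite mulf_eq0 gt_eqF//= subr_eq0 => /eqP ->.
  by move=> /eqP; rewrite mulf_eq0 gt_eqF//= subr_eq0 => /eqP ->.
by split; apply/colP => i; have [] := key i.
Qed.

End NoninvariantStates.

(** * The burst construction and its exit from the cone *)

Section Bursts.
Variables (R : realType) (n : nat) (Rm : 'M[R]_n) (S : seq 'cV[R]_n) (lam q0 u : 'cV[R]_n).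
Variables (f : nat -> R -> R) (g : nat -> R) (Tend : R).
Hypotheses (net : network_ok Rm S) (cap : capacity_region Rm S lam).
Hypotheses (f0 : forall r e, 0 <= e -> 0 <= f r e) (g0 : forall r, 0 <= g r)
  (fg : forall e, 0 < e -> (r%:R * f r e / g r) @[r --> \oo] --> 0)
  (gr : (g r / r%:R) @[r --> \oo] --> +oo) (T0 : 0 < Tend).
Local Notation e1 := (ones R n).
Local Notation I := (invariant_states Rm S e1 lam).
Hypotheses (Iq0 : I q0) (u0 : nonneg u) (du : 0 < dist_set u (inv_cone Rm S e1 lam)).

(** Taking a predecessor makes the period positive by construction; for large [r] it is the floor of
    [g r * Tend]. *)
Definition last_phase r : nat := (`|Num.floor (g r * Tend)|%N).-1.
Local Notation period r := (last_phase r).+1.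
(* Between [r] and [g r] in order of magnitude, so that one burst per period is
   visible at scale [r] while the mean is unchanged in the limit; it also
   dominates the drift [sqrt (g r)] accumulated over a period. *)
Definition burst_size r : R := Num.sqrt (r%:R * g r).
Definition is_burst r t om : bool := ((t + om) %% period r == 0)%N.
Definition burst_arrival r (t om : nat) : 'cV[R]_n :=
  lam + ((is_burst r t om)%:R * burst_size r) *: u.
Definition burst_mean r : 'cV[R]_n := lam + (burst_size r / (period r)%:R) *: u.

Let lam0 : nonneg lam := (capacity_nonneg cap).1.

Lemma burst_size_ge0 r : 0 <= burst_size r.
Proof. exact: sqrtr_ge0. Qed.

Lemma growth_near (c : R) : \forall r \near \oo, c * r%:R <= g r.
Proof.
move/cvgryPge : gr => /(_ c); apply: filterS2 (nbhs_infty_gt 0) => r r0 h.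
by rewrite -ler_pdivlMr// ltr0n.
Qed.

Lemma scales_near (e : R) : 0 < e -> \forall r \near \oo,
  [/\ (0 < r)%N, 2 <= g r * Tend, r%:R <= e * burst_size r & burst_size r <= e * g r].
Proof.
move=> e0; near=> r.
have r0 : (0 < r)%N by near: r; exact: nbhs_infty_gt.
have r0R : 0 < r%:R :> R by rewrite ltr0n.
have r1 : 1 <= r%:R :> R by rewrite ler1n.
have h1 : 2 / Tend * r%:R <= g r by near: r; exact: growth_near.
have h2 : (e ^+ 2)^-1 * r%:R <= g r by near: r; exact: growth_near.
have h3 : 1 * r%:R <= g r by near: r; exact: growth_near.
have gpos : 0 < g r by rewrite mul1r in h3; exact: lt_le_trans h3.
have h2' : r%:R <= e ^+ 2 * g r by rewrite -ler_pdivrMl ?exprn_gt0.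
have b2 : burst_size r ^+ 2 = r%:R * g r by rewrite sqr_sqrtr// mulr_ge0.
split=> //.
- have : 2 / Tend <= g r by rewrite (le_trans _ h1)// ler_peMr// divr_ge0// ltW.
  by rewrite ler_pdivrMr.
- rewrite -(@ler_pXn2r _ 2%N) ?nnegrE ?mulr_ge0 ?burst_size_ge0 ?(ltW e0)//.
  by rewrite exprMn b2 mulrCA expr2 ler_pM2l.
- rewrite -(@ler_pXn2r _ 2%N) ?nnegrE ?mulr_ge0 ?burst_size_ge0 ?(ltW e0)//.
  by rewrite exprMn b2 [g r ^+ 2]expr2 mulrA ler_pM2r.
Unshelve. all: end_near. Qed.

Lemma periodE r : 2 <= g r * Tend -> period r = `|Num.floor (g r * Tend)|%N.
Proof.
move=> gT; rewrite /last_phase prednK// -(ltr_nat R).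
have gT0 : 0 <= g r * Tend by apply: le_trans gT.
have := absz_floor_gt gT0; rewrite -natr1; lra.
Qed.

Lemma period_ge r : 2 <= g r * Tend -> g r * Tend / 2 <= (period r)%:R.
Proof.
move=> gT; rewrite periodE//.
have gT0 : 0 <= g r * Tend by apply: le_trans gT.
have := absz_floor_gt gT0; rewrite -natr1; lra.
Qed.

Lemma burst_over_period (e : R) r : 0 < e -> 2 <= g r * Tend ->
  burst_size r <= e * g r -> burst_size r / (period r)%:R <= 2 * e / Tend.
Proof.
move=> e0 gT be; rewrite ler_pdivrMr ?ltr0n//.
apply: (@le_trans _ _ (2 * e / Tend * (g r * Tend / 2))); last first.
  by rewrite ler_wpM2l ?period_ge// divr_ge0 ?mulr_ge0// ltW.
suff -> : 2 * e / Tend * (g r * Tend / 2) = e * g r by [].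
by field; rewrite gt_eqF.
Qed.

Lemma burst_sum r : \sum_(k < period r) (is_burst r 0 k)%:R = 1 :> R.
Proof.
have bE (k : 'I_(period r)) : is_burst r 0 k = (k == ord0).
  by rewrite /is_burst add0n modn_small// -(inj_eq val_inj).
rewrite (eq_bigr (fun k => (k == ord0)%:R)) => [|k _]; last by rewrite bE.
by rewrite (bigD1 ord0)//= big1 ?addr0// => k /negbTE ->.
Qed.

Lemma burst_stationary r :
  stationary_with_mean (unif_prob R (last_phase r)) (burst_arrival r) (burst_mean r).
Proof.
have nn t om : nonneg (burst_arrival r t om).
  by move=> i; rewrite !mxE addr_ge0 ?mulr_ge0 ?burst_size_ge0.
split; [|split].
- by split=> [t i|t om]; [exact: measurable_fun_nat|exact: nn].
- move=> k m B mB.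
  rewrite (_ : [set om | forall t i, (t < m)%N -> B t i (burst_arrival r (t + k) om i 0)] =
    [set om | [set om | forall t i, (t < m)%N -> B t i (burst_arrival r t om i 0)]
        ((om + k) %% period r)%N]); first exact: unif_shift.
  have bE t om : burst_arrival r t ((om + k) %% period r) = burst_arrival r (t + k) om.
    by rewrite /burst_arrival /is_burst modnDmr addnA (addnAC t om) .
  by apply/seteqP; split=> om /= h t i tm; have := h t i tm; rewrite bE.
- move=> i; rewrite unif_integral; last by move=> k; exact: nn.
  congr EFin; rewrite (eq_bigr (fun k : 'I_(period r) =>
     lam i 0 + (burst_size r * u i 0) * (is_burst r 0 k)%:R)); last first.
    by move=> k _; rewrite !mxE; ring.
  rewrite big_split /= sumr_const card_ord -mulr_sumr burst_sum mulr1 !mxE.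
  rewrite mulrDr -[lam i 0 *+ _]mulr_natl mulKf ?pnatr_eq0//; congr (_ + _).
  by rewrite mulrC mulrAC.
Qed.

Lemma burst_mean_cvg i : (fun r => burst_mean r i 0) @ \oo --> lam i 0.
Proof.
apply/cvgrPdist_lt => e e0.
pose c := e * Tend / (4 * (1 + `|u i 0|)).
have ui : 0 < 1 + `|u i 0| by rewrite ltr_pwDl.
have c0 : 0 < c by rewrite divr_gt0 ?mulr_gt0.
apply: filterS (scales_near c0) => r [r0 gT _ bc].
rewrite !mxE opprD addrA subrr add0r normrN normrM ger0_norm ?divr_ge0 ?burst_size_ge0//.
apply: (@le_lt_trans _ _ (2 * c / Tend * `|u i 0|)).
  by rewrite ler_wpM2r//; exact: burst_over_period.
rewrite /c.
have -> : 2 * (e * Tend / (4 * (1 + `|u i 0|))) / Tend * `|u i 0| =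
    e * (`|u i 0| / (2 * (1 + `|u i 0|))).
  by field; rewrite !gt_eqF.
by rewrite gtr_pMr// ltr_pdivrMr ?mulr_gt0// mul1r; have := normr_ge0 (u i 0); lra.
Qed.

(** Without a burst the deviation comes only from the shifted mean and stays below [delta * r]. A
    burst falls among [r + 1 <= 2 * r] steps with probability at most [2 * r] over the period, which
    is at least [g r * Tend / 2]; hence [4 / Tend]. *)
Lemma burst_tail_prob (delta : R) : 0 < delta -> \forall r \near \oo,
  fine (unif_prob R (last_phase r) [set om |
    (r%:R)^-1 * max_dev (burst_arrival r ^~ om) (burst_mean r) r.+1 > delta]) <=
  4 / Tend * (r%:R / g r).
Proof.
move=> del0.
pose c := delta * Tend / (4 * (1 + norm2 u)).
have u1 : 0 < 1 + norm2 u by rewrite ltr_pwDl// norm2_ge0.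
have c0 : 0 < c by rewrite divr_gt0 ?mulr_gt0.
apply: filterS (scales_near c0) => r [r0 gT _ bc].
have r0R : 0 < r%:R :> R by rewrite ltr0n.
have r1R : 1 <= r%:R :> R by rewrite ler1n.
have gpos : 0 < g r by rewrite -(pmulr_lgt0 _ T0) (lt_le_trans _ gT).
pose E t : set nat := [set om | is_burst r t om].
set bad := [set om | _].
have : (unif_prob R (last_phase r) bad <= \sum_(t < r.+1) unif_prob R (last_phase r) (E t))%E.
  apply: (@content_subadditive _ _ _ (unif_prob R (last_phase r)) _ E) => //.
  move=> om /= badom; rewrite -bigcup_mkord; apply: contrapT => noburst.
  have nb t : (t <= r)%N -> is_burst r t om = false.
    by move=> tr; apply/negP => bt; apply: noburst; exists t.
  move: badom; apply/negP; rewrite -leNgt mulrC ler_pdivrMr//.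
  apply/bigmax_leP; split=> [|t _]; first by rewrite mulr_ge0// ltW.
  have -> : \sum_(tau < t.+1) (burst_arrival r tau om - burst_mean r) =
      (- (t.+1%:R * (burst_size r / (period r)%:R))) *: u.
    rewrite (eq_bigr (fun=> - ((burst_size r / (period r)%:R) *: u))); last first.
      move=> tau _; rewrite /burst_arrival nb; last first.
        by rewrite -ltnS (leq_trans (ltn_ord tau))// ltn_ord.
      by rewrite mul0r scale0r addr0 /burst_mean opprD addrA subrr add0r.
    by rewrite sumr_const card_ord -scaler_nat -scaleNr scalerA mulrN.
  rewrite norm2Z normrN ger0_norm; last by rewrite mulr_ge0// divr_ge0 ?burst_size_ge0.
  have bN := burst_over_period c0 gT bc.
  have tR : t.+1%:R <= 2 * r%:R :> R.
    have : t.+1%:R <= r.+1%:R :> R by rewrite ler_nat.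
    rewrite -(natr1 r); lra.
  apply: (@le_trans _ _ (2 * r%:R * (2 * c / Tend) * norm2 u)).
    rewrite ler_wpM2r ?norm2_ge0// ler_pM// divr_ge0 ?burst_size_ge0//.
  have -> : 2 * r%:R * (2 * c / Tend) * norm2 u = delta * r%:R * (norm2 u / (1 + norm2 u)).
    by rewrite /c; field; rewrite !gt_eqF.
  rewrite ler_piMr ?mulr_ge0 ?(ltW del0)// ler_pdivrMr// mul1r; lra.
rewrite (eq_bigr (fun=> ((period r)%:R^-1)%:E)); last first.
  by move=> t _; exact: unif_single.
rewrite sumEFin -[unif_prob _ _ _]fineK ?fin_num_measure// lee_fin => h.
apply: le_trans h _; rewrite sumr_const card_ord -[(period r)%:R^-1 *+ r.+1]mulr_natl.
rewrite ler_pdivrMr ?ltr0n//.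
apply: (@le_trans _ _ (4 / Tend * (r%:R / g r) * (g r * Tend / 2))); last first.
  by rewrite ler_wpM2l ?period_ge// mulr_ge0// divr_ge0// ltW.
have -> : 4 / Tend * (r%:R / g r) * (g r * Tend / 2) = 2 * r%:R.
  by field; rewrite !gt_eqF.
rewrite -natr1; lra.
Qed.

Lemma burst_f_tailed : f_tailed f (fun r => unif_prob R (last_phase r)) burst_arrival burst_mean lam.
Proof.
split; first exact: burst_stationary.
split; first exact: burst_mean_cvg.
move=> delta del0.
have cv : (4 / Tend * (r%:R * f r delta / g r)) @[r --> \oo] --> 0.
  by rewrite -(mulr0 (4 / Tend)); apply: cvgMl_tmp; exact: fg.
apply: squeeze_cvgr (cvg_cst 0) cv.
near=> r.
have fd : 0 <= f r delta by apply: f0; exact: ltW.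
rewrite mulr_ge0 ?fine_ge0//=.
have -> : 4 / Tend * (r%:R * f r delta / g r) = f r delta * (4 / Tend * (r%:R / g r)) by ring.
rewrite ler_wpM2l//; near: r; exact: burst_tail_prob.
Unshelve. all: end_near. Qed.

Lemma burst_queues : exists Q : nat -> nat -> nat -> 'cV[R]_n,
  queue_processes Rm S e1 (d := fun=> _) (T := fun=> nat) burst_arrival Q (fun r => r%:R *: q0).
Proof.
have [_ S0] := capacity_nonneg cap.
have /choice [pi piP] := wmw_choice_exists Rm S0 e1.
exists (fun r t om => pol_queue Rm pi (fun s => burst_arrival r s om) (r%:R *: q0) t).
move=> r; split=> [t i|om]; first exact: measurable_fun_nat.
split=> // t; exists (pi (pol_queue Rm pi (fun s => burst_arrival r s om) (r%:R *: q0) t)).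
by split.
Qed.

Lemma burst_far (Q : nat -> nat -> nat -> 'cV[R]_n) (delta : R) :
  queue_processes Rm S e1 (d := fun=> _) (T := fun=> nat) burst_arrival Q (fun r => r%:R *: q0) ->
  0 < delta -> \forall r \near \oo, forall om, (om <= last_phase r)%N ->
    far_event g r (Q r) I Tend delta om.
Proof.
move=> qp del0.
have [rho hrho lamE] := capacity_hull net cap.
have w0 : pos_weights e1 := @ones_pos R n.
have IE := invariant_statesE net w0 hrho lamE.
have [c [M [B [c0 M0 B0 lyap]]]] := lyapunov_sum net w0 hrho lamE.
pose db := n%:R * drift_bound Rm S lam.
have dB0 : 0 <= drift_bound Rm S lam.
  have sm := serv_max_ge0 net.
  apply: sumr_ge0 => i _; rewrite !addr_ge0//; apply: sumr_ge0 => j _.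
  by rewrite mulr_ge0//; exact: net.1.
have db0 : 0 <= db by rewrite mulr_ge0.
pose D := dist_set u (inv_cone Rm S e1 lam).
have BT : 0 <= B * Tend by rewrite mulr_ge0// ltW.
have den : 0 < delta + norm2 q0 + B * Tend + db + 2.
  have := norm2_ge0 q0; lra.
(* With this [e], all competing terms together stay below half of [burst_size r * D], the distance
   created by the burst. *)
have [e e0 eD] : exists2 e : R, 0 < e & e * (2 * (delta + norm2 q0 + B * Tend + db + 2)) = D.
  exists (D / (2 * (delta + norm2 q0 + B * Tend + db + 2))); first by rewrite divr_gt0// mulr_gt0.
  by rewrite divfK// gt_eqF// mulr_gt0.
have e0' : 0 < e ^+ 2 by rewrite exprn_gt0.
near=> r => om omN.
have [r0 gT re _] : [/\ (0 < r)%N, 2 <= g r * Tend, r%:R <= e * burst_size r &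
    burst_size r <= e * g r] by near: r; exact: scales_near.
have er2 : (e ^+ 2)^-1 <= r%:R by near: r; exact: nbhs_infty_ger.
have r0R : 0 < r%:R :> R by rewrite ltr0n.
have r1 : 1 <= r%:R :> R by rewrite ler1n.
have gpos : 0 < g r by rewrite -(pmulr_lgt0 _ T0) (lt_le_trans _ gT).
have bpos : 0 < burst_size r by rewrite -(pmulr_rgt0 _ e0) (lt_le_trans r0R).
have [mQ] := qp r; move=> /(_ om)[Q0E path].
have An t : nonneg (burst_arrival r t om) by have [[_ h] _] := burst_stationary r; exact: h.
have q00 : nonneg q0 by case: Iq0.
have Q00 : nonneg (Q r 0%N om) by rewrite Q0E => i; rewrite mxE mulr_ge0.
have Qnn := wmw_path_nonneg net path An Q00.
(* The time of the first burst; the outer remainder gives 0 when [om = 0]. *)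
pose t0 := ((period r - om) %% period r)%N.
have t0N : (t0 < period r)%N by rewrite ltn_pmod.
have bt0 : is_burst r t0 om.
  by rewrite /is_burst /t0 modnDml subnK ?modnn// (leqW omN).
have nb t : (t < t0)%N -> is_burst r t om = false.
  rewrite /t0 /is_burst; case: (posnP om) => [->|om0]; first by rewrite subn0 modnn.
  rewrite modn_small; last by rewrite ltn_subrL om0.
  move=> tN; rewrite modn_small; last by rewrite -ltn_subRL ltn_subRL addnC -ltn_subRL.
  by apply/negbTE; rewrite -lt0n addn_gt0 om0 orbT.
have Kp : inv_cone Rm S e1 lam (r%:R *: q0).
  by apply: inv_coneZ => //; rewrite -IE.
have cd l : (l <= t0)%N -> cumdev lam (burst_arrival r ^~ om) l = 0.
  move=> lt0; rewrite /cumdev big1// => t _; rewrite /burst_arrival nb; last first.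
    exact: leq_trans lt0.
  by rewrite mul0r scale0r addr0 subrr.
(* Before [t0] arrivals equal [lam], so the deviation vanishes and each step adds at most [B] to the
   squared distance from [r *: q0]. The total [B * Tend * g r] is small against
   [burst_size r ^+ 2 = r * g r]. *)
have dev : norm2 (Q r t0 om - r%:R *: q0) <= (B * Tend + 1) * e * burst_size r.
  have cdn l : (l <= t0)%N -> norm2 (cumdev lam (burst_arrival r ^~ om) l) <= 0.
    by move=> lt0; rewrite cd// norm2_0.
  have := lyap _ _ _ path Qnn Kp 0 t0 cdn.
  rewrite cd// subr0 Q0E subrr dotw0l sub0r mulr0 add0r -norm2_sqr => h.
  have sumd : 0 <= 2 * c * \sum_(l < t0) dist_set (Q r l om) (inv_cone Rm S e1 lam).
    by rewrite !mulr_ge0 ?(ltW c0)//; apply: sumr_ge0 => l _; exact: dist_set_ge0.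
  have t0B : t0%:R * B <= g r * Tend * B.
    rewrite ler_wpM2r//; apply: (@le_trans _ _ (period r)%:R); first by rewrite ler_nat ltnW.
    by rewrite periodE//; apply: absz_floor_le; rewrite mulr_ge0// ltW.
  have b2 : burst_size r ^+ 2 = r%:R * g r by rewrite sqr_sqrtr// mulr_ge0.
  have g2 : g r <= e ^+ 2 * burst_size r ^+ 2.
    rewrite b2 mulrA ler_peMl ?(ltW gpos)//.
    by rewrite -ler_pdivrMl// mulr1.
  rewrite -(@ler_pXn2r _ 2%N) ?nnegrE ?norm2_ge0//; last first.
    by apply: mulr_ge0 (burst_size_ge0 r); apply: mulr_ge0 (ltW e0); rewrite addr_ge0.
  rewrite !exprMn -mulrA.
  have h1 : norm2 (Q r t0 om - r%:R *: q0) ^+ 2 <= B * Tend * g r by lra.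
  apply: le_trans h1 _.
  apply: (@le_trans _ _ (B * Tend * (e ^+ 2 * burst_size r ^+ 2))); first by rewrite ler_wpM2l.
  rewrite ler_wpM2r ?mulr_ge0 ?sqr_ge0//; nra.
(* The burst arriving at [t0] is seen in the queue one step later, at most at the period and so
   still within the horizon. *)
apply/(far_eventP _ _ _ _ gpos (ltW T0)); exists t0.+1.
  by rewrite -periodE.
have [mu [qmu QE]] := path t0.
have vb : norm2 (drift Rm lam mu (Q r t0 om)) <= db.
  by apply: norm2_le_coord => // i; exact: (drift_le net lam i qmu.1 (Qnn t0)).
have decomp : Q r t0.+1 om = burst_size r *: u +
    ((Q r t0 om - r%:R *: q0) + (r%:R *: q0 + drift Rm lam mu (Q r t0 om))).
  rewrite QE /qstep /burst_arrival bt0 mul1r /drift -(opprB 1%:M Rm) mulNmx.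
  by apply/colP => i; rewrite !mxE; ring.
rewrite IE dist_setZ ?invr_gt0//; last 2 first.
- exact: inv_cone_neq0.
- by move=> b y b0; apply: inv_coneZ; exact: ltW.
rewrite mulrC ltr_pdivlMr//.
have bu : dist_set (burst_size r *: u) (inv_cone Rm S e1 lam) = burst_size r * D.
  apply: dist_setZ => //; first exact: inv_cone_neq0.
  by move=> b y b0; apply: inv_coneZ; exact: ltW.
have := dist_set_lip (burst_size r *: u) (Q r t0.+1 om) (inv_cone_neq0 Rm S e1 lam).
rewrite bu norm2_distC {2}decomp addrAC subrr add0r => h.
have n1 := norm2D (Q r t0 om - r%:R *: q0) (r%:R *: q0 + drift Rm lam mu (Q r t0 om)).
have n2 := norm2D (r%:R *: q0) (drift Rm lam mu (Q r t0 om)).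
rewrite norm2Z (ger0_norm (ltW r0R)) in n2.
have rq : r%:R * norm2 q0 <= e * burst_size r * norm2 q0 by rewrite ler_wpM2r ?norm2_ge0.
have rd : delta * r%:R <= delta * (e * burst_size r) by rewrite ler_wpM2l// ltW.
have dbe : db <= db * (e * burst_size r) by rewrite ler_peMr// (le_trans r1).
have bD : burst_size r * D = 2 * (delta * (e * burst_size r) + e * burst_size r * norm2 q0
   + (B * Tend + 1) * e * burst_size r + db * (e * burst_size r) + e * burst_size r).
  by rewrite -eD; ring.
have pD : 0 < burst_size r * D by rewrite mulr_gt0.
have pe : 0 < e * burst_size r by rewrite mulr_gt0.
have ph : 0 <= e * burst_size r * norm2 q0 by rewrite mulr_ge0 ?norm2_ge0// ltW.
lra.
Unshelve. all: end_near. Qed.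

End Bursts.

Theorem theorem3 (R : realType) :
  (* parts (a) and (b) *)
  (forall (n : nat) (Rm : 'M[R]_n) (S : seq 'cV[R]_n) (w : 'cV[R]_n)
          (lam : 'cV[R]_n) (Tend : R) (lamr : nat -> 'cV[R]_n)
          (f : nat -> R -> R) (g : nat -> R)
          (d : nat -> measure_display) (Om : forall r, measurableType (d r))
          (P : forall r, probability (Om r) R)
          (A : forall r, nat -> Om r -> 'cV[R]_n)
          (Q : forall r, nat -> Om r -> 'cV[R]_n) (Q0 : nat -> 'cV[R]_n),
     network_ok Rm S -> pos_weights w ->
     capacity_region Rm S lam ->
     0 <= Tend ->
     (forall r e, 0 <= e -> 0 <= f r e) -> (forall r, 0 <= g r) ->
     (0 < limn_einf (fun r => (g r / r%:R)%:E))%E ->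
     f_tailed f P A lamr lam ->
     (forall r, nonneg (Q0 r)) ->
     queue_processes Rm S w A Q Q0 ->
     (dist_set ((r%:R)^-1 *: Q0 r) (invariant_states Rm S w lam)) @[r --> \oo] --> 0 ->
     (forall e, 0 < e -> (0 < limn_einf (fun r => (r%:R * f r e / g r)%:E))%E) ->
     (* (a) *)
     (forall delta, 0 < delta ->
        fine (P r (far_event g r (Q r) (invariant_states Rm S w lam) Tend delta))
          @[r --> \oo] --> 0)
     /\
     (* (b) *)
     (forall delta, 0 < delta -> exists2 e, 0 < e &
        (r%:R * f r e / g r *
           fine (P r (far_event g r (Q r) (invariant_states Rm S w lam) Tend delta)))
          @[r --> \oo] --> 0)
     /\
     (* (b), MW case *)
     (w = @ones R n -> forall C alpha, sensitivity_const Rm S C ->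
        attraction_const Rm S lam alpha ->
        forall delta, 0 < delta -> forall e, 0 < e -> e <= Num.min delta alpha / (2 * C) ->
        (r%:R * f r e / g r *
           fine (P r (far_event g r (Q r) (invariant_states Rm S w lam) Tend delta)))
          @[r --> \oo] --> 0))
  /\
  (* part (c) *)
  (forall (f : nat -> R -> R) (g : nat -> R) (Tend : R),
     (forall r e, 0 <= e -> 0 <= f r e) -> (forall r, 0 <= g r) ->
     (forall e, 0 < e -> (r%:R * f r e / g r) @[r --> \oo] --> 0) ->
     (g r / r%:R) @[r --> \oo] --> +oo ->
     0 < Tend ->
     forall (n : nat) (Rm : 'M[R]_n) (S : seq 'cV[R]_n) (lam : 'cV[R]_n) (q0 : 'cV[R]_n),
       network_ok Rm S ->
       capacity_region Rm S lam -> ~ extreme_point (capacity_region Rm S) lam ->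
       invariant_states Rm S (@ones R n) lam q0 ->
       exists (d : nat -> measure_display) (Om : forall r, measurableType (d r))
              (P : forall r, probability (Om r) R)
              (A : forall r, nat -> Om r -> 'cV[R]_n)
              (Q : forall r, nat -> Om r -> 'cV[R]_n) (lamr : nat -> 'cV[R]_n),
         f_tailed f P A lamr lam /\
         queue_processes Rm S (@ones R n) A Q (fun r => r%:R *: q0) /\
         forall delta, 0 < delta ->
           fine (P r (far_event g r (Q r) (invariant_states Rm S (@ones R n) lam) Tend delta))
             @[r --> \oo] --> (1 : R)).
Proof.
split.
  move=> n Rm S w lam Tend lamr f g d Om P A Q Q0 net w0 cap T0 f0 g0 ginf ft Q00 qp dQ0 finf.
  split; [|split].
  - by move=> delta; exact: (far_prob_cvg0 net w0 cap T0 f0 ginf ft Q00 qp dQ0 finf).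
  - by move=> delta; exact: (far_rate_exists net w0 cap T0 f0 ginf ft Q00 qp dQ0).
  - move=> wE C alpha sens attr delta del0 e e0 eC.
    exact: (far_rate_mw net w0 cap T0 f0 ginf ft Q00 qp dQ0 wE sens attr del0 e0 eC).
move=> f g Tend f0 g0 fg gr T0 n Rm S lam q0 net cap next Iq0.
have [u u0 du] := noninvariant_exists net cap next.
have [Q qp] := burst_queues q0 u g Tend cap.
exists (fun=> _), (fun=> nat), (fun r => unif_prob R (last_phase g Tend r)).
exists (burst_arrival lam u g Tend), Q, (burst_mean lam u g Tend).
split; first exact: (burst_f_tailed cap f0 g0 fg gr T0 u0).
split=> // delta del0.
apply: cvg_near_cst.
apply: filterS (burst_far net cap g0 gr T0 Iq0 u0 du qp del0) => r far.
have -> : unif_prob R (last_phase g Tend r) (far_event g r (Q r)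
    (invariant_states Rm S (ones R n) lam) Tend delta) = 1%E by exact: unif_full.
by [].
Qed.
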